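(* Let $\bar z_h^{1/2}\in\mathcal Z_{h,\Delta t}$ be the unique minimizer of $\mathcal J_{h,\Delta t}$ over $\mathcal Z_{h,\Delta t}$, and let $(\bar E_h^n,\bar B_h^n)$ be the associated Crank--Nicolson state. Then there exist unique adjoint sequences $(\bar p_{E,h}^n,\bar p_{B,h}^n)\in\mathcal N_h^0\times\mathcal{RT}_h$, $n=0,\dots,N_t$, with terminal data $\bar p_{E,h}^{N_t}=0$, $\bar p_{B,h}^{N_t}=0$, solving, backward for $n=N_t-1,\dots,0$, $$(\varepsilon\,\delta_t^-\bar p_{E,h}^n,\psi_h)+(\sigma\,\bar p_{E,h}^{n+\frac12},\psi_h)+(\operatorname{curl}\psi_h,\bar p_{B,h}^{n+\frac12})=(\varepsilon(\bar E_h^{n+\frac12}-E_d^{n+\frac12}),\psi_h)\quad\forall\psi_h\in\mathcal N_h^0,$$ $$(\delta_t^-\bar p_{B,h}^n,\phi_h)-(\mu^{-1}\phi_h,\operatorname{curl}\bar p_{E,h}^{n+\frac12})=(\mu^{-1}(\bar B_h^{n+\frac12}-B_d^{n+\frac12}),\phi_h)\quad\forall\phi_h\in\mathcal{RT}_h,$$ and the discrete stationarity condition $$\alpha_1\sum_{n=0}^{N_t-1}\Delta t\,(\bar z_h^{n+\frac12},w_h^{n+\frac12})+\alpha_2\sum_{n=0}^{N_t-1}\Delta t\,(\operatorname{curl}\bar z_h^{n+\frac12},\operatorname{curl}w_h^{n+\frac12})+\sum_{n=0}^{N_t-1}\Delta t\,(\bar p_{E,h}^{n+\frac12},\operatorname{curl}w_h^{n+\frac12})=0$$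 for all $w_h^{1/2}\in\mathcal Z_{h,\Delta t}$. Equivalently, time-cellwise, $$\alpha_1\bar z_h^{n+\frac12}+\mathcal C_h^*\big(\alpha_2\operatorname{curl}\bar z_h^{n+\frac12}+P_h\,\bar p_{E,h}^{n+\frac12}\big)=0\quad\text{in }\mathcal N_h,\qquad n=0,\dots,N_t-1,$$ where $\mathcal C_h^*:\mathcal{RT}_h\to\mathcal N_h$ is the discrete adjoint of curl defined by $(\mathcal C_h^*q_h,w_h)=(q_h,\operatorname{curl}w_h)$ for all $q_h\in\mathcal{RT}_h$, $w_h\in\mathcal N_h$.
   Context: $\Omega\subset\mathbb R^3$ is a bounded Lipschitz domain with outward unit normal $\nu$, and $T>0$. $(\cdot,\cdot)$ is the $L^2(\Omega)$ inner product (scalar or vector). The tensors $\varepsilon,\mu,\sigma\in L^\infty(\Omega;\mathbb R^{3\times3})$ are symmetric; there are $\varepsilon_0,\mu_0>0$ with $\xi^\top\varepsilon(x)\xi\ge\varepsilon_0|\xi|^2$, $\xi^\top\mu(x)\xi\ge\mu_0|\xi|^2$ for a.e. $x$ and all $\xi\in\mathbb R^3$; $\sigma$ is positive semidefinite; $I_{\rm src}\in L^2(0,T;L^2(\Omega)^3)$; $E_0,B_0\in L^2(\Omega)^3$, $\operatorname{div}B_0=0$; $\alpha_1,\alpha_2>0$. Discrete spaces: $\{\mathcal T_h\}_h$ shape-regular meshes of $\Omega$, $k\ge0$. $\mathcal N_h=\{v_h\in H(\operatorname{curl};\Omega): v_h|_K\in\mathcal N_k(K)\ \forall K\in\mathcal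 T_h\}$ (local Nédélec spaces of the first kind of degree $k$, convention $\mathbb P_k(K)^3\subset\mathcal N_k(K)$); $\mathcal N_h^0=\{v_h\in\mathcal N_h:v_h\times\nu=0\text{ on }\partial\Omega\}$; $\mathcal{RT}_h=\{w_h\in H(\operatorname{div};\Omega): w_h|_K\in\mathcal{RT}_k(K)\ \forall K\}$ (local Raviart--Thomas spaces of degree $k$). $\operatorname{curl}\mathcal N_h\subset\mathcal{RT}_h$. $P_h:L^2(\Omega)^3\to\mathcal{RT}_h$ is the $L^2$-orthogonal projection. Time grid: $\Delta t=T/N_t$, $t^n=n\Delta t$; $\delta_tg^{n+1}=(g^{n+1}-g^n)/\Delta t$, $\delta_t^-p^n=(p^n-p^{n+1})/\Delta t$, $g^{n+\frac12}=\tfrac12(g^{n+1}+g^n)$ for states and adjoints; $I_{\rm src}^{n+\frac12}=\frac1{\Delta t}\int_{t^n}^{t^{n+1}}I_{\rm src}\,ds$. Discrete controls: $\mathcal Z_{h,\Delta t}$ is the set of functions $z_h^{1/2}:(0,T]\to\mathcal N_h$ with constant value $z_h^{n+\frac12}\in\mathcal N_h$ on $(t^n,t^{n+1}]$, $n=0,\dots,N_t-1$, with $\|z_h^{1/2}\|_Z^2=\sum_{n=0}^{N_t-1}\Delta t\big(\alpha_1\|z_h^{n+\frac12}\|_{L^2(\Omega)}^2+\alpha_2\|\operatorname{curl}z_h^{n+\frac12}\|_{L^2(\Omega)}^2\big)$. Crank--Nicolson state for $z_h^{1/2}$: $(E_h^n,B_h^n)\in\mathcal N_h^0\times\mathcal{RT}_h$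 with, for $n=0,\dots,N_t-1$ and all $(\psi_h,\phi_h)\in\mathcal N_h^0\times\mathcal{RT}_h$, $$(\varepsilon\,\delta_tE_h^{n+1},\psi_h)+(\sigma E_h^{n+\frac12},\psi_h)-(\mu^{-1}B_h^{n+\frac12},\operatorname{curl}\psi_h)=(I_{\rm src}^{n+\frac12}+\operatorname{curl}z_h^{n+\frac12},\psi_h),\quad(\delta_tB_h^{n+1},\phi_h)+(\operatorname{curl}E_h^{n+\frac12},\phi_h)=0,$$ with $E_h^0$ the $L^2$-projection of $E_0$ onto $\mathcal N_h^0$ and $B_h^0$ the $L^2$-projection of $B_0$ onto $\{v_h\in\mathcal{RT}_h:\operatorname{div}v_h=0\}$. Cost: for given $E_d^{n+\frac12},B_d^{n+\frac12}\in L^2(\Omega)^3$ (midpoint values of the desired fields), $$\mathcal J_{h,\Delta t}(z_h^{1/2})=\frac12\sum_{n=0}^{N_t-1}\Delta t\Big(\|\sqrt\varepsilon(E_h^{n+\frac12}-E_d^{n+\frac12})\|_{L^2(\Omega)}^2+\|\sqrt{\mu^{-1}}(B_h^{n+\frac12}-B_d^{n+\frac12})\|_{L^2(\Omega)}^2\Big)+\frac12\|z_h^{1/2}\|_Z^2.$$ *)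

(* Defs.v *)
From HB Require Import structures.
From mathcomp Require Import all_boot all_order all_algebra.
From mathcomp Require mpoly.
Import (canonicals, coercions) mpoly.
From mathcomp Require Import all_classical all_reals all_analysis.
Import Order.TTheory GRing.Theory Num.Theory.
Import numFieldNormedType.Exports.

Set Implicit Arguments.
Unset Strict Implicit.
Unset Printing Implicit Defensive.

Local Open Scope classical_set_scope.
Local Open Scope ring_scope.

Notation pt R := (R * R * R)%type.

Lemma sigma_finite_product d1 d2 (T1 : measurableType d1)
    (T2 : measurableType d2) (R : realType)
    (m1 : {sigma_finite_measure set T1 -> \bar R})
    (m2 : {sigma_finite_measure set T2 -> \bar R}) :
  sigma_finite setT (m1 \x m2)%E.
Proof.
have /sigma_finiteP[F [TF ndF Foo]] := sigma_finiteT m1.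
have /sigma_finiteP[G [TG ndG Goo]] := sigma_finiteT m2.
exists (fun n => F n `*` G n).
  rewrite -setXTT TF TG predeqE => -[x y]; split.
    move=> [/= [n _ Fnx] [k _ Gky]]; exists (maxn n k) => //; split.
    - by move: x Fnx; exact/subsetPset/ndF/leq_maxl.
    - by move: y Gky; exact/subsetPset/ndG/leq_maxr.
  by move=> [n _ []/= ? ?]; split; exists n.
move=> k; have [? ?] := Foo k; have [? ?] := Goo k.
split; first exact: measurableX.
by rewrite product_measure1E// lte_mul_pinfty// ge0_fin_numE.
Qed.

(* The sigma-finiteness of a product of Lebesgue measures is not inferred by
   unification, so it is attached to the constants below. *)
Section Lebesgue.
Context {R : realType}.

Definition leb2 := (@lebesgue_measure R \x @lebesgue_measure R)%E.
HB.instance Definition _ := Measure.on leb2.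
HB.instance Definition _ := @Measure_isSigmaFinite.Build _ _ _ leb2
  (sigma_finite_product (@lebesgue_measure R) (@lebesgue_measure R)).

Definition leb3 := (leb2 \x @lebesgue_measure R)%E.
HB.instance Definition _ := Measure.on leb3.
HB.instance Definition _ := @Measure_isSigmaFinite.Build _ _ _ leb3
  (sigma_finite_product leb2 (@lebesgue_measure R)).

End Lebesgue.
Arguments leb3 R : clear implicits.

Section Vectors.
Context {R : realType}.

(* Points of R^3 are triples, on which Lebesgue measure is a product measure;
   vectors are columns.  Indices in 'I_3 are added modulo 3. *)
Definition vec := 'cV[R]_3.
Definition field := pt R -> vec.
Definition tensor := pt R -> 'M[R]_3.

Definition vec_of (x : pt R) : vec := \col_i [:: x.1.1; x.1.2; x.2]`_i.
Definition ptbasis (i : 'I_3) : pt R :=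
  ((i == 0)%:R, (i == 1)%:R, (i == 2%:R)%:R).

Definition dot (a b : vec) : R := \sum_i a i 0 * b i 0.
Definition enorm (a : vec) : R := Num.sqrt (dot a a).
Definition cross (a b : vec) : vec :=
  \col_i (a (i + 1) 0 * b (i + 2%:R) 0 - a (i + 2%:R) 0 * b (i + 1) 0).

(* the positive semidefinite square root *)
Definition sqrtmx (A : 'M[R]_3) : 'M[R]_3 :=
  xget 0 [set S | S^T = S /\ (forall xi, 0 <= dot xi (S *m xi)) /\ S *m S = A].

Definition mact (A : tensor) (v : field) : field := fun x => A x *m v x.
Definition minv (A : tensor) : tensor := fun x => invmx (A x).
Definition msqrt (A : tensor) : tensor := fun x => sqrtmx (A x).

End Vectors.
Arguments vec R : clear implicits.
Arguments field R : clear implicits.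
Arguments tensor R : clear implicits.

Section Domain.
Context {R : realType}.
Implicit Types (Om : set (pt R)) (x : pt R).

Definition bdry Om : set (pt R) := closure Om `\` Om.

Definition lipschitz_boundary Om :=
  forall x0, bdry Om x0 ->
  exists (Q : 'M[R]_3) (L : R) (g : R * R -> R),
    [/\ Q *m Q^T = 1%:M, L.-lipschitz g &
      \forall x \near x0,
        let y := Q *m (vec_of x - vec_of x0) in
        Om x <-> g (y 0 0, y 1 0) < y 2%:R 0].

Definition bounded_lipschitz_domain Om :=
  [/\ open Om, connected Om,
      Om !=set0, bounded_set Om & lipschitz_boundary Om].

(* n is the outward unit normal at x: the directions forming an obtuse
   (resp. acute) angle with n enter Om (resp. leave the closure of Om).  There
   is at most one such n, and there is one wherever the boundary is the graph
   of a differentiable function. *)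
Definition outward_normal Om x (n : vec R) :=
  dot n n = 1 /\
  forall d : pt R,
    (dot n (vec_of d) < 0 ->
       \forall t \near 0^'+, Om (x + t *: d)) /\
    (0 < dot n (vec_of d) ->
       \forall t \near 0^'+, ~ closure Om
                                       (x + t *: d)).

End Domain.

Section Sobolev.
Context {R : realType}.
Variable Om : set (pt R).
Implicit Types (f : pt R -> R) (u v c : field R).

Definition L2s f := f \_ Om \in Lfun (leb3 R) 2%:E.
Definition L2v v := forall i, L2s (fun x => v x i 0).
Definition LinftyM (A : tensor R) :=
  forall i j, (fun x => A x i j) \_ Om \in Lfun (leb3 R) +oo%E.

Definition aeeq (A : set (pt R)) u v :=
  {ae leb3 R, forall x, A x -> u x = v x}.

Definition ip u v : R := \int[leb3 R]_(x in Om) dot (u x) (v x).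
Definition normsq v : R := ip v v.

Definition pderiv (i : 'I_3) (f : pt R -> R) : pt R -> R :=
  fun x => 'D_(ptbasis i) f x.

Fixpoint Ck (m : nat) (f : pt R -> R) : Prop :=
  continuous f /\
  if m is m'.+1 then
    forall i, (forall x, derivable f x (ptbasis i)) /\ Ck m' (pderiv i f)
  else True.

(* C_c^oo(Om), extended by zero *)
Definition test (f : pt R -> R) :=
  (forall m, Ck m f) /\
  exists K : set (pt R),
    [/\ compact K, K `<=` Om & forall x, ~ K x -> f x = 0].
Definition testv v := forall i, test (fun x => v x i 0).

Definition sgrad f : field R := fun x => \col_i pderiv i f x.
Definition scurl v : field R := fun x =>
  \col_i (pderiv (i + 1) (fun y => v y (i + 2%:R) 0) x
          - pderiv (i + 2%:R) (fun y => v y (i + 1) 0) x).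

Definition weak_curl v c := forall phi, testv phi -> ip v (scurl phi) = ip c phi.
Definition weak_div v (d : pt R -> R) := forall phi, test phi ->
  ip v (sgrad phi) = - \int[leb3 R]_(x in Om) (d x * phi x).

Definition Hcurl v := L2v v /\ exists c, L2v c /\ weak_curl v c.
Definition Hdiv v := L2v v /\ exists d, L2s d /\ weak_div v d.

(* a representative of the weak curl, determined almost everywhere on Om *)
Definition curl v : field R := xget 0 [set c | L2v c /\ weak_curl v c].

Definition is_L2proj (V : set (field R)) u v :=
  V v /\ forall w, V w -> ip v w = ip u w.
Definition L2proj (V : set (field R)) u : field R := xget 0 (is_L2proj V u).

End Sobolev.

Section Mesh.
Context {R : realType}.

(* a tetrahedron, given by its four vertices *)
Definition tetra := 'I_4 -> pt R.

Definition subsimplex (a : tetra) (S : {set 'I_4}) : set (pt R) :=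
  [set x | exists l : 'I_4 -> R,
     [/\ forall i, 0 <= l i, forall i, i \notin S -> l i = 0,
         \sum_i l i = 1 & vec_of x = \sum_i l i *: vec_of (a i)]].
Definition tet (a : tetra) : set (pt R) := subsimplex a [set: 'I_4]%SET.
(* the two-dimensional face opposite to vertex i *)
Definition facet (a : tetra) (i : 'I_4) : set (pt R) := subsimplex a (~: [set i])%SET.

Definition nondegenerate (a : tetra) := forall l : 'I_4 -> R,
  \sum_i l i = 0 -> \sum_i l i *: vec_of (a i) = 0 -> forall i, l i = 0.

(* conforming tetrahedral mesh: two elements meet in the subsimplex spanned by
   their common vertices *)
Definition is_mesh (Om : set (pt R)) (Th : set tetra) :=
  [/\ finite_set Th,
      forall a, Th a -> nondegenerate a,
      closure Om = \bigcup_(a in Th) tet a &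
      forall a b, Th a -> Th b ->
        tet a `&` tet b = subsimplex a [set i | `[< exists j, a i = b j >]]%SET].

Definition shape_regular (H : Type) (Th : H -> set tetra) :=
  exists kappa : R, forall h a, Th h a ->
    exists (c : pt R) (rho : R),
      [/\ 0 < rho,
          forall x, enorm (vec_of x - vec_of c) <= rho -> tet a x &
          forall x y, tet a x -> tet a y ->
            enorm (vec_of x - vec_of y) <= kappa * rho].

Definition pvec := 'I_3 -> mpoly.mpoly 3 R.
Definition peval (P : pvec) : field R := fun x =>
  \col_i mpoly.meval (fun j => vec_of x j 0) (P i).

Definition Pk (k : nat) (P : pvec) := forall i, (mpoly.msize (P i) <= k.+1)%N.

(* P_k^3 + { S homogeneous of degree k+1 | x . S = 0 } *)
Definition nedelec (k : nat) (P : pvec) :=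
  exists A S : pvec,
    [/\ Pk k A, forall i, S i \is mpoly.ishomog1 k.+1 mpoly.mdeg,
        \sum_i mpoly.mpolyX R (mpoly.mnm1 i) * S i = 0 &
        forall i, P i = A i + S i].

(* P_k^3 + x * { b homogeneous of degree k } *)
Definition raviart_thomas (k : nat) (P : pvec) :=
  exists (A : pvec) (b : mpoly.mpoly 3 R),
    [/\ Pk k A, b \is mpoly.ishomog1 k mpoly.mdeg &
        forall i, P i = A i + mpoly.mpolyX R (mpoly.mnm1 i) * b].

Variables (Om : set (pt R)) (Th : set tetra) (k : nat).

Definition Nh : set (field R) := [set v | Hcurl Om v /\
  forall a, Th a -> exists P, nedelec k P /\ aeeq (tet a) v (peval P)].

(* v x nu = 0 holds pointwise, for the polynomial traces of v on the element
   faces that make up the boundary of Om *)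
Definition Nh0 : set (field R) := [set v | Nh v /\
  forall a, Th a -> exists P, [/\ nedelec k P, aeeq (tet a) v (peval P) &
    forall i, facet a i `<=` bdry Om ->
    forall x nu, facet a i x -> outward_normal Om x nu ->
      cross (peval P x) nu = 0]].

Definition RTh : set (field R) := [set v | Hdiv Om v /\
  forall a, Th a -> exists P, raviart_thomas k P /\ aeeq (tet a) v (peval P)].

Definition RTh_div0 : set (field R) := [set v | RTh v /\ weak_div Om v (cst 0)].

(* the adjoint RTh -> Nh of curl : Nh -> RTh *)
Definition Cstar (q : field R) : field R :=
  xget 0 [set v | Nh v /\ forall w, Nh w -> ip Om v w = ip Om q (curl Om w)].

Definition Ph : field R -> field R := L2proj Om RTh.

End Mesh.
Arguments tetra R : clear implicits.

Section TimeDiscretization.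
Context {R : realType}.
Variables (Om : set (pt R)) (Th : set (tetra R)) (k : nat).
Variables (T : R) (Nt : nat).

Definition dt : R := T / Nt%:R.
Definition tn (n : nat) : R := n%:R * dt.

Definition mid (g : nat -> field R) (n : nat) : field R :=
  2^-1 *: (g n.+1 + g n).
(* [ddt g n] is delta_t g^{n+1}, and [ddtm p n] is delta_t^- p^n *)
Definition ddt (g : nat -> field R) (n : nat) : field R :=
  dt^-1 *: (g n.+1 - g n).
Definition ddtm (p : nat -> field R) (n : nat) : field R :=
  dt^-1 *: (p n - p n.+1).

(* L^2(0,T;L^2(Om)^3) is identified with L^2((0,T) x Om)^3 *)
Definition L2L2 (I : R -> field R) := forall i : 'I_3,
  (fun q : R * pt R => I q.1 q.2 i 0) \_ (`]0, T[ `*` Om)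
    \in Lfun (@lebesgue_measure R \x leb3 R)%E 2%:E.

Definition tavg (I : R -> field R) (n : nat) : field R := fun x =>
  \col_i (dt^-1 * \int[@lebesgue_measure R]_(s in `[tn n, tn n.+1]) I s x i 0).

(* value of a control on the n-th time cell (t^n, t^{n+1}] *)
Definition cell (z : R -> field R) (n : nat) : field R := z (tn n.+1).

Definition Zh : set (R -> field R) := [set z | forall n, (n < Nt)%N ->
  Nh Om Th k (cell z n) /\
  forall t, tn n < t <= tn n.+1 -> aeeq Om (z t) (cell z n)].

Definition normZsq (alpha1 alpha2 : R) (z : R -> field R) : R :=
  \sum_(n < Nt) dt * (alpha1 * normsq Om (cell z n)
                      + alpha2 * normsq Om (curl Om (cell z n))).

Definition cn_state (eps mu sigma : tensor R) (Isrc : R -> field R)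
    (E0 B0 : field R) (z : R -> field R) (E B : nat -> field R) : Prop :=
  [/\ forall n, (n <= Nt)%N -> Nh0 Om Th k (E n) /\ RTh Om Th k (B n),
      is_L2proj Om (Nh0 Om Th k) E0 (E 0%N),
      is_L2proj Om (RTh_div0 Om Th k) B0 (B 0%N) &
      forall n, (n < Nt)%N -> forall psi phi,
        Nh0 Om Th k psi -> RTh Om Th k phi ->
        ip Om (mact eps (ddt E n)) psi + ip Om (mact sigma (mid E n)) psi
          - ip Om (mact (minv mu) (mid B n)) (curl Om psi)
        = ip Om (tavg Isrc n + curl Om (cell z n)) psi
        /\
        ip Om (ddt B n) phi + ip Om (curl Om (mid E n)) phi = 0].

Definition cost (eps mu : tensor R) (alpha1 alpha2 : R)
    (Ed Bd : nat -> field R) (z : R -> field R) (E B : nat -> field R) : R :=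
  2^-1 * \sum_(n < Nt) dt *
      (normsq Om (mact (msqrt eps) (mid E n - Ed n))
       + normsq Om (mact (msqrt (minv mu)) (mid B n - Bd n)))
  + 2^-1 * normZsq alpha1 alpha2 z.

(* z, with state (E, B), minimizes the cost over Zh *)
Definition minimizer (eps mu sigma : tensor R) (Isrc : R -> field R)
    (E0 B0 : field R) (alpha1 alpha2 : R) (Ed Bd : nat -> field R)
    (z : R -> field R) (E B : nat -> field R) : Prop :=
  [/\ Zh z, cn_state eps mu sigma Isrc E0 B0 z E B &
      forall z' E' B', Zh z' -> cn_state eps mu sigma Isrc E0 B0 z' E' B' ->
        cost eps mu alpha1 alpha2 Ed Bd z E B
        <= cost eps mu alpha1 alpha2 Ed Bd z' E' B'].

(* [Ed n], [Bd n] are the desired fields at the midpoint n + 1/2 *)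
Definition adjoint (eps mu sigma : tensor R) (Ed Bd E B : nat -> field R)
    (pE pB : nat -> field R) : Prop :=
  [/\ forall n, (n <= Nt)%N -> Nh0 Om Th k (pE n) /\ RTh Om Th k (pB n),
      aeeq Om (pE Nt) 0, aeeq Om (pB Nt) 0 &
      forall n, (n < Nt)%N ->
        (forall psi, Nh0 Om Th k psi ->
           ip Om (mact eps (ddtm pE n)) psi + ip Om (mact sigma (mid pE n)) psi
             + ip Om (curl Om psi) (mid pB n)
           = ip Om (mact eps (mid E n - Ed n)) psi) /\
        (forall phi, RTh Om Th k phi ->
           ip Om (ddtm pB n) phi
             - ip Om (mact (minv mu) phi) (curl Om (mid pE n))
           = ip Om (mact (minv mu) (mid B n - Bd n)) phi)].

Definition stationary (alpha1 alpha2 : R) (z : R -> field R)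
    (pE : nat -> field R) : Prop :=
  forall w, Zh w ->
    alpha1 * \sum_(n < Nt) dt * ip Om (cell z n) (cell w n)
    + alpha2 * \sum_(n < Nt) dt * ip Om (curl Om (cell z n)) (curl Om (cell w n))
    + \sum_(n < Nt) dt * ip Om (mid pE n) (curl Om (cell w n)) = 0.

Definition cellwise_stationary (alpha1 alpha2 : R) (z : R -> field R)
    (pE : nat -> field R) : Prop :=
  forall n, (n < Nt)%N ->
    aeeq Om (alpha1 *: cell z n
             + Cstar Om Th k (alpha2 *: curl Om (cell z n)
                              + Ph Om Th k (mid pE n))) 0.

End TimeDiscretization.

(* Main.v *)
(* The Crank-Nicolson step is a bilinear form on Nh0 x RTh; the adjoint scheme
   uses this form and the state scheme its transpose.  Because curl maps Nh into
   RTh, the magnetic unknown can be eliminated and the energy shows that the form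
   is nondegenerate modulo fields vanishing almost everywhere; the discrete
   spaces being finite dimensional modulo such fields, both schemes are solvable
   and the adjoint is unique.  Perturbing the minimizer in a direction w changes
   the cost quadratically, so the first variation vanishes, and summation by
   parts in time turns the variation of the tracking term into the pairing of
   the adjoint with curl w.  Controls supported in one time cell localize the
   resulting identity, which is then rewritten with the Riesz representatives
   defining Cstar and Ph.  The weak curl of a discrete field is piecewise
   polynomial because weak curls are unique, by testing against smooth bumps. *)

Require Import Defs.
From mathcomp Require Import all_boot all_order all_algebra.
From mathcomp Require mpoly.
Import (canonicals, coercions) mpoly.
From mathcomp Require Import all_classical all_reals all_analysis.
From mathcomp Require Import measurable_realfun ess_sup_inf spectral complex ring lra.
Import Order.TTheory GRing.Theory Num.Theory.
Import numFieldNormedType.Exports.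

Set Implicit Arguments.
Unset Strict Implicit.
Unset Printing Implicit Defensive.

Local Open Scope classical_set_scope.
Local Open Scope ring_scope.

(** * Boxes and measurability in R^3 *)

(* The domain of [leb3 R]: it carries the same sets as the canonical
   measurable structure of [pt R], but under another display. *)
Notation P3 R := (measurableTypeR R * measurableTypeR R * measurableTypeR R)%type.

Section Boxes.
Context {R : realType}.
Implicit Types (a b x : pt R) (U : set (pt R)).

(** The discrete spaces consist of functions, not of classes, and [curl], [Cstar], [Ph] and [msqrt]
    pick arbitrary representatives. Linearity of the curl therefore holds only almost everywhere or
    inside an inner product, and linear algebra is done on a set [S] of fields together with a set
    [N] of null fields, without forming a quotient. Two points of analysis shape the proof. A
    discrete curl is seen to lie in the Raviart-Thomas space once it is known to be polynomial on
    each element; for this the open elements must lie in [Om], whereas the mesh describes only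
    [closure Om]. This is where the Lipschitz boundary enters. Moreover the square roots in the cost
    are chosen matrix by matrix, without any control of measurability, so the cost is turned into a
    quadratic form by comparing integrals of arbitrary functions that agree almost everywhere. The
    variation needs no solution operator: the given state plus t times one response with zero
    initial data is a state for z + t w, and comparing costs for all real t is enough. *)

Definition obox a b : set (pt R) :=
  (`]a.1.1, b.1.1[ `*` `]a.1.2, b.1.2[) `*` `]a.2, b.2[.
Definition cbox a b : set (pt R) :=
  (`[a.1.1, b.1.1] `*` `[a.1.2, b.1.2]) `*` `[a.2, b.2].

Lemma measurable_obox a b : measurable (obox a b : set (P3 R)).
Proof. by do 2?apply: measurableX; exact: measurable_itv. Qed.

Lemma measurable_cbox a b : measurable (cbox a b : set (P3 R)).
Proof. by do 2?apply: measurableX; exact: measurable_itv. Qed.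

Lemma compact_cbox a b : compact (cbox a b).
Proof. by do 2?apply: compact_setX; exact: segment_compact. Qed.

Lemma obox_sub_cbox a b : obox a b `<=` cbox a b.
Proof.
by move=> x [[/= h1 h2] h3]; split; [split|]; exact: subset_itv_oo_cc.
Qed.

Definition ratpt (q : rat * rat * rat) : pt R :=
  (ratr q.1.1, ratr q.1.2, ratr q.2).

Lemma rat_around (t e : R) : 0 < e ->
  exists p q : rat, [/\ t - e < ratr p, ratr p < t, t < ratr q & ratr q < t + e].
Proof.
move=> e0.
have [p /itvP hp] : exists p, ratr p \in `]t - e, t[.
  by apply: rat_in_itvoo; rewrite ltrBlDr ltrDl.
have [q /itvP hq] : exists p, ratr p \in `]t, t + e[.
  by apply: rat_in_itvoo; rewrite ltrDl.
by exists p, q; split; rewrite ?hp ?hq.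
Qed.

(** Rational corners leave only countably many boxes. Both the measurability of open sets and the
    localization in [fundamental_lemma] depend on this. *)
Lemma open_obox U x : open U -> U x ->
  exists p q, obox (ratpt p) (ratpt q) x /\ cbox (ratpt p) (ratpt q) `<=` U.
Proof.
move=> oU Ux.
have /nbhs_ballP[e /= e0 he] : nbhs x U by move: oU; rewrite openE; exact.
have [p1 [q1 [a1 b1 c1 d1]]] := rat_around x.1.1 e0.
have [p2 [q2 [a2 b2 c2 d2]]] := rat_around x.1.2 e0.
have [p3 [q3 [a3 b3 c3 d3]]] := rat_around x.2 e0.
exists (p1, p2, p3), (q1, q2, q3); split.
  by split; [split|] => /=; rewrite in_itv /= ?b1 ?c1 ?b2 ?c2 ?b3 ?c3.
move=> y [[/=]]; rewrite !in_itv /= => /andP[u1 v1] /andP[u2 v2] /andP[u3 v3].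
apply: he; split; [split|]; rewrite /ball /= /ball_ /= ltr_distl; apply/andP; split; lra.
Qed.

(** Measurability refers to a product sigma-algebra and openness to the product topology; countable
    unions of rational boxes link the two. *)
Lemma open_pt_measurable U : open U -> measurable (U : set (P3 R)).
Proof.
move=> oU.
pose D := [set pq : (rat * rat * rat) * (rat * rat * rat) |
  cbox (ratpt pq.1) (ratpt pq.2) `<=` U].
have -> : U = \bigcup_(pq in D) obox (ratpt pq.1) (ratpt pq.2).
  apply/seteqP; split => [x Ux|x [pq /= h1 /obox_sub_cbox]]; last exact: h1.
  by have [p [q [h1 h2]]] := open_obox oU Ux; exists (p, q).
rewrite bigcup_mkcond; apply: countable_bigcupT_measurable => //.
by move=> pq; case: ifP => // _; exact: measurable_obox.
Qed.

Lemma continuous_pt_measurable (f : pt R -> R) :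
  continuous f -> measurable_fun setT (f : P3 R -> R).
Proof.
move=> /continuousP cf; apply: (measurability _ (RGenOpens.measurableE R)).
move=> _ [_ [a [b ->] <-]]; rewrite setTI; apply: open_pt_measurable.
exact/cf/interval_open.
Qed.

Lemma leb3_cbox a b : (leb3 R (cbox a b) < +oo)%E.
Proof.
rewrite /leb3 product_measure1E/=; last 2 first.
- by apply: measurableX; exact: measurable_itv.
- exact: measurable_itv.
rewrite /leb2 product_measure1E/=; last 2 first.
- exact: measurable_itv.
- exact: measurable_itv.
by rewrite !lebesgue_measure_itv /=; repeat case: ifP => _ //=; rewrite -?EFinM ?mule0 ?mul0e ?ltry.
Qed.

Lemma bounded_cbox U : bounded_set U -> exists a b, U `<=` cbox a b.
Proof.
move=> [M [Mr hM]]; have := hM (M + 1); rewrite ltrDl ltr01 => /(_ isT) h.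
exists (- (M + 1), - (M + 1), - (M + 1)), (M + 1, M + 1, M + 1) => x /h /=.
rewrite /Num.norm /= !ge_max => /andP[/andP[h1 h2] h3].
by split; [split|]; rewrite /= in_itv /= -ler_norml.
Qed.

End Boxes.

(** * The L^2 inner product *)

Lemma aeS (R : realType) (P Q : pt R -> Prop) : (forall x, P x -> Q x) ->
  {ae leb3 R, forall x, P x} -> {ae leb3 R, forall x, Q x}.
Proof. by move=> PQ; apply: (@filterS _ _ (ae_filter_ringOfSetsType (leb3 R))) PQ. Qed.

Lemma aeS2 (R : realType) (P Q S : pt R -> Prop) : (forall x, P x -> Q x -> S x) ->
  {ae leb3 R, forall x, P x} -> {ae leb3 R, forall x, Q x} ->
  {ae leb3 R, forall x, S x}.
Proof. by move=> PQ; apply: (@filterS2 _ _ (ae_filter_ringOfSetsType (leb3 R))) PQ. Qed.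

Section L2calc.
Context {R : realType}.
Variables (Om : set (pt R)) (mOm : measurable (Om : set (P3 R))).
Local Notation mu := (leb3 R).
Implicit Types (f g : pt R -> R) (u v w : field R).

Lemma L2sP f : L2s Om f <->
  measurable_fun (Om : set (P3 R)) f /\ mu.-integrable Om (EFin \o (fun x => f x ^+ 2)).
Proof.
have sqE : (fun x => (f \_ Om) x ^+ 2) = (fun x => f x ^+ 2) \_ Om.
  by apply/funext => x; rewrite !patchE; case: ifP => //; rewrite expr0n.
have mE : measurable_fun setT (f \_ Om) <-> measurable_fun (Om : set (P3 R)) f.
  by rewrite -(measurable_restrictT f mOm).
split=> [h|[mf intf]].
  split; first by apply/mE; move: h; rewrite /L2s inE => /andP[/[1!inE]].
  have := Lfun2_integrable_sqr h; rewrite sqE => h2.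
  by apply/(integrable_mkcond _ mOm); rewrite restrict_EFin.
rewrite /L2s inE; apply/andP; split; rewrite inE; first exact/mE.
rewrite /= /finite_norm unlock /= poweR_lty//.
move/(integrable_mkcond _ mOm): intf; rewrite restrict_EFin -sqE => /integrableP[_].
apply: le_lt_trans; rewrite le_eqVlt; apply/orP; left; apply/eqP.
apply: eq_integral => x _ /=.
by rewrite powR_mulrn// normrX.
Qed.

Lemma L2s_meas f : L2s Om f -> measurable_fun (Om : set (P3 R)) f.
Proof. by case/L2sP. Qed.

(** The product is dominated by [f ^ 2 + g ^ 2]. *)
Lemma L2s_mul f g : L2s Om f -> L2s Om g -> mu.-integrable Om (EFin \o (fun x => f x * g x)).
Proof.
move=> /L2sP[mf hf] /L2sP[mg hg].
have h := integrableD mOm hf hg.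
apply: (le_integrable mOm _ _ h).
  by apply/measurable_EFinP; exact: measurable_funM.
move=> x _ /=; rewrite lee_fin [leRHS]ger0_norm ?addr_ge0 ?sqr_ge0//.
rewrite normrM -[f x ^+ 2]real_normK ?num_real// -[g x ^+ 2]real_normK ?num_real//.
by nra.
Qed.

Lemma L2sD f g : L2s Om f -> L2s Om g -> L2s Om (fun x => f x + g x).
Proof.
move=> hf hg; apply/L2sP; split.
  by apply: measurable_funD; exact: L2s_meas.
have [_ h1] := (L2sP f).1 hf; have [_ h2] := (L2sP g).1 hg.
have h3 := L2s_mul hf hg.
apply: eq_integrable (integrableD mOm (integrableD mOm h1 h2) (integrableZl mOm 2 h3)) => //.
by move=> x _ /=; rewrite -EFinM -!EFinD; congr EFin; ring.
Qed.

Lemma L2sZ (k : R) f : L2s Om f -> L2s Om (fun x => k * f x).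
Proof.
move=> /L2sP[mf hf]; apply/L2sP; split; first exact: measurable_funM.
apply: eq_integrable (integrableZl mOm (k ^+ 2) hf) => //.
by move=> x _ /=; rewrite -EFinM exprMn.
Qed.

Lemma L2s0 : L2s Om (fun=> 0).
Proof.
apply/L2sP; split; first exact: measurable_cst.
by rewrite expr0n; exact: integrable0.
Qed.

Lemma L2s_dom f g : measurable_fun (Om : set (P3 R)) f -> L2s Om g ->
  {ae mu, forall x, Om x -> `|f x| <= `|g x|} -> L2s Om f.
Proof.
move=> mf /L2sP[mg /integrableP[mgg hg]] fg; apply/L2sP; split => //.
have mff : measurable_fun Om (EFin \o (fun x => f x ^+ 2)).
  by apply/measurable_EFinP; exact: measurable_funX.
apply/integrableP; split => //; apply: le_lt_trans hg.
apply: ae_ge0_le_integral => //.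
- by apply: measurableT_comp.
- by apply: measurableT_comp.
apply: aeS fg => x h Ox /=; rewrite lee_fin !normrX.
by rewrite ler_sqr ?nnegrE ?normr_ge0//; exact: h.
Qed.

Lemma L2s_bounded f M : (mu Om < +oo)%E -> measurable_fun (Om : set (P3 R)) f ->
  (forall x, Om x -> `|f x| <= M) -> L2s Om f.
Proof.
move=> fin mf hM; apply: (@L2s_dom _ (fun=> M)) => //; last first.
  by apply: aeW => x /hM h; rewrite (le_trans h)// ler_norm.
apply/L2sP; split; first exact: measurable_cst.
apply: measurable_bounded_integrable => //.
exists (M ^+ 2); split; first exact: num_real.
by move=> y hy x _ /=; rewrite (le_trans _ (ltW hy))// ger0_norm ?sqr_ge0.
Qed.

Lemma L2vD u v : L2v Om u -> L2v Om v -> L2v Om (u + v).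
Proof.
move=> hu hv i; rewrite (_ : (fun x => _) = (fun x => u x i 0 + v x i 0)).
  exact: L2sD.
by apply/funext => x; rewrite mxE.
Qed.

Lemma L2vZ (k : R) u : L2v Om u -> L2v Om (k *: u).
Proof.
move=> hu i; rewrite (_ : (fun x => _) = (fun x => k * u x i 0)).
  exact: L2sZ.
by apply/funext => x; rewrite mxE.
Qed.

Lemma L2v0 : L2v Om 0.
Proof.
move=> i; rewrite (_ : (fun x => _) = (fun=> 0)); first exact: L2s0.
by apply/funext => x; rewrite mxE.
Qed.

Lemma L2vB u v : L2v Om u -> L2v Om v -> L2v Om (u - v).
Proof. by move=> hu hv; rewrite -scaleN1r; apply: L2vD => //; exact: L2vZ. Qed.

Lemma L2v_dot u v : L2v Om u -> L2v Om v ->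
  mu.-integrable Om (EFin \o (fun x => dot (u x) (v x))).
Proof.
move=> hu hv.
rewrite (_ : _ \o _ = (fun x => \sum_(i < 3) (u x i 0 * v x i 0)%:E)%E).
  by apply: (integrable_sum mOm) => i _; exact: L2s_mul.
by apply/funext => x /=; rewrite sumEFin.
Qed.

Lemma dotC (a b : vec R) : dot a b = dot b a.
Proof. by apply: eq_bigr => i _; rewrite mulrC. Qed.
Lemma dotDl (a b c : vec R) : dot (a + b) c = dot a c + dot b c.
Proof. by rewrite -big_split; apply: eq_bigr => i _; rewrite !mxE mulrDl. Qed.
Lemma dotZl (k : R) (a b : vec R) : dot (k *: a) b = k * dot a b.
Proof. by rewrite /dot mulr_sumr; apply: eq_bigr => i _; rewrite !mxE mulrA. Qed.
Lemma dot_ge0 (a : vec R) : 0 <= dot a a.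
Proof. by apply: sumr_ge0 => i _; rewrite -expr2 sqr_ge0. Qed.
Lemma dot_eq0 (a : vec R) : dot a a = 0 -> a = 0.
Proof.
move/eqP; rewrite psumr_eq0; last by move=> i _; rewrite -expr2 sqr_ge0.
move=> /allP h; apply/matrixP => i j; rewrite (ord1 j) mxE.
by have := h i (mem_index_enum _); rewrite /= -expr2 sqrf_eq0 => /eqP.
Qed.

Lemma ipC u v : ip Om u v = ip Om v u.
Proof. by rewrite /ip; apply: eq_Rintegral => x _; rewrite dotC. Qed.

Lemma ipDl u v w : L2v Om u -> L2v Om v -> L2v Om w ->
  ip Om (u + v) w = ip Om u w + ip Om v w.
Proof.
move=> hu hv hw; rewrite -RintegralD//; [|exact: L2v_dot..].
by apply: eq_Rintegral => x _; rewrite dotDl.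
Qed.

Lemma ipZl k u w : L2v Om u -> L2v Om w -> ip Om (k *: u) w = k * ip Om u w.
Proof.
move=> hu hw; rewrite -RintegralZl//; last exact: L2v_dot.
by apply: eq_Rintegral => x _; rewrite dotZl.
Qed.

Lemma ipDr u v w : L2v Om u -> L2v Om v -> L2v Om w ->
  ip Om w (u + v) = ip Om w u + ip Om w v.
Proof. by move=> ? ? ?; rewrite !(ipC w) ipDl. Qed.

Lemma ipZr k u w : L2v Om u -> L2v Om w -> ip Om w (k *: u) = k * ip Om w u.
Proof. by move=> ? ?; rewrite !(ipC w) ipZl. Qed.

Lemma ip0l w : ip Om 0 w = 0.
Proof.
rewrite /ip (@eq_Rintegral _ _ _ _ _ (fun=> 0)) ?Rintegral0//; last first.
  by move=> x _; rewrite /dot big1// => i _; rewrite mxE mul0r.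
by rewrite /Rintegral integral0_eq.
Qed.

Lemma aeeq_refl u : aeeq Om u u.
Proof. exact: aeW. Qed.
Lemma aeeq_trans u v w : aeeq Om u v -> aeeq Om v w -> aeeq Om u w.
Proof. by apply: aeS2 => x h1 h2 Ox; rewrite h1// h2. Qed.
Lemma aeeqD u u' v v' : aeeq Om u u' -> aeeq Om v v' -> aeeq Om (u + v) (u' + v').
Proof. by apply: aeS2 => x h1 h2 Ox; rewrite !fctE h1// h2. Qed.
Lemma aeeqZ (k : R) u u' : aeeq Om u u' -> aeeq Om (k *: u) (k *: u').
Proof. by apply: aeS => x h1 Ox; rewrite !fctE h1. Qed.

Lemma ip_ael u u' v : L2v Om u -> L2v Om u' -> L2v Om v ->
  aeeq Om u u' -> ip Om u v = ip Om u' v.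
Proof.
move=> hu hu' hv uu'; congr fine; apply: ae_eq_integral => //.
- exact: (measurable_int mu (L2v_dot hu hv)).
- exact: (measurable_int mu (L2v_dot hu' hv)).
- by apply: aeS uu' => x h Ox; rewrite h.
Qed.

Lemma ip_ge0 v : 0 <= ip Om v v.
Proof. by apply: Rintegral_ge0 => x _; exact: dot_ge0. Qed.

Lemma ip_eq0 v : L2v Om v -> ip Om v v = 0 -> aeeq Om v 0.
Proof.
move=> hv h; have hi := L2v_dot hv hv.
have h0 : (\int[mu]_(x in Om) (dot (v x) (v x))%:E = 0)%E.
  have f0 := integrable_fin_num mOm hi.
  by rewrite -[LHS](fineK f0) -[fine _]/(ip Om v v) h.
have /ae_eq_integral_abs h1 : (\int[mu]_(x in Om) `|(dot (v x) (v x))%:E| = 0)%E.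
  rewrite -[RHS]h0; apply: eq_integral => x _.
  by rewrite gee0_abs// lee_fin dot_ge0.
have := h1 mOm (measurable_int _ hi).
by apply: aeS => x h2 Ox; apply: dot_eq0; have [] := h2 Ox.
Qed.

End L2calc.

(** * Smooth bumps *)

Section Flat.
Context {R : realType}.
Implicit Types (u r : {poly R}) (k m : nat).

(* The family [x |-> r(x) u(x)^-k exp(-1/u(x))], cut off where [u <= 0], is
   stable under differentiation; this is what makes the bumps smooth. *)
Definition flat u k r (x : R) : R :=
  if 0 < u.[x] then r.[x] * u.[x] ^- k * expR (- u.[x]^-1) else 0.

(** The new numerator: the derivative of r u^-k exp(-1/u) is (r' u^2 - k r u' u + r u') u^-(k+2)
    exp(-1/u). *)
Definition flatd u k r := r^`() * u ^+ 2 - k%:R *: (r * u^`() * u) + r * u^`().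

(** A single term of the exponential series at 1/t, inverted. *)
Lemma expRN_bound m (t : R) : 0 < t -> expR (- t^-1) <= m.+1`!%:R * t ^+ m.+1.
Proof.
move=> t0; have h := @expR_ge1Dxn R t^-1 m (ltW (eqbRL (invr_gt0 _) t0)).
have f0 : (0 : R) < m.+1`!%:R by rewrite ltr0n fact_gt0.
rewrite expRN -[leRHS]invrK lef_pV2 ?posrE ?expR_gt0//; last first.
  by rewrite invr_gt0 mulr_gt0 ?exprn_gt0.
rewrite (le_trans _ h)// invfM -exprVn mulrC.
by rewrite lerDr ler01.
Qed.

(** Bounding the exponential by the power k+2 of u leaves u^2 after division by u^k. This quadratic
    decay yields a zero derivative at the points where u vanishes. *)
Lemma flat_bound u k r (x : R) :
  `|flat u k r x| <= k.+2`!%:R * `|r.[x]| * Num.max 0 u.[x] ^+ 2.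
Proof.
rewrite /flat; case: ifPn => [u0|]; last first.
  by move=> _; rewrite normr0 mulr_ge0 ?sqr_ge0// mulr_ge0.
rewrite !normrM [`|expR _|]ger0_norm ?expR_ge0// [`|_ ^- _|]ger0_norm; last first.
  by rewrite invr_ge0 exprn_ge0// ltW.
rewrite (max_idPr (ltW u0)).
have h := expRN_bound k.+1 u0.
apply: (le_trans (ler_wpM2l _ h)); first by rewrite mulr_ge0// invr_ge0 exprn_ge0// ltW.
rewrite le_eqVlt; apply/orP; left; apply/eqP.
by rewrite -addn2 exprD; field; rewrite expf_neq0// gt_eqF.
Qed.

Lemma is_derive_sq_small (f : R -> R) (g : R -> R) (x : R) :
  continuous g -> f x = 0 -> (forall y, `|f y| <= g y * (y - x) ^+ 2) ->
  is_derive x 1 f 0.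
Proof.
move=> cg fx0 hf.
have lim0 : h^-1 *: ((f \o shift x) (h *: 1) - f x) @[h --> 0^'] --> (0 : R).
  apply/cvgr0Pnorm_lt => e e0.
  have : g (h + x) * h @[h --> (0 : R)] --> (0 : R).
    rewrite -[X in _ --> X](mulr0 (g (0 + x))); apply: cvgM; last exact: cvg_id.
    apply: continuous_comp; last exact: cg.
    by apply: cvgD; [exact: cvg_id|exact: cvg_cst].
  move/cvgr0Pnorm_lt => /(_ e e0) H.
  have H' : \forall h \near (0 : R)^', `|g (h + x) * h| < e by apply: cvg_within H.
  near=> h.
  have h0 : h != 0 by near: h; exact: nbhs_dnbhs_neq.
  have : `|g (h + x) * h| < e by near: h.
  apply: le_lt_trans; rewrite fx0 subr0 /= scaler1 [_ *: _]/(_ * _) normrM normfV.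
  rewrite ler_pdivrMl ?normr_gt0//.
  apply: (le_trans (hf _)); rewrite addrK normrM.
  have -> : `|h| * (`|g (h + x)| * `|h|) = `|g (h + x)| * h ^+ 2.
    by rewrite -[in RHS](real_normK (num_real h)); ring.
  by rewrite ler_wpM2r ?sqr_ge0 ?ler_norm.
apply: DeriveDef; first by apply/cvg_ex; exists 0.
by apply/cvg_lim => //.
Unshelve. all: by end_near.
Qed.

Lemma flat_is_derive u k r (x : R) :
  is_derive x 1 (flat u k r) (flat u k.+2 (flatd u k r) x).
Proof.
have [u0|u0] := ltP 0 u.[x]; last first.
  rewrite {2}/flat ltNge u0 /=.
  (* Since u(x) <= 0, max(0, u(y)) is at most |u(y) - u(x)|; factoring out y - x then gives a bound
     quadratic in y - x. *)
  have [q hq] : exists q, u - u.[x]%:P = q * ('X - x%:P).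
    by apply/factor_theorem; rewrite rootE !hornerE subrr.
  pose p : {poly R} := q ^+ 2.
  apply: (@is_derive_sq_small _ (fun y => k.+2`!%:R * `|r.[y]| * p.[y])).
  - move=> y; apply: cvgM; last exact: continuous_horner.
    apply: cvgM; first exact: cvg_cst.
    by apply: cvg_norm; exact: continuous_horner.
  - by rewrite /flat ltNge u0.
  move=> y; apply: (le_trans (flat_bound _ _ _ _)).
  rewrite -[leRHS]mulrA ler_wpM2l ?mulr_ge0// /p horner_exp -exprMn.
  have e1 : q.[y] * (y - x) = u.[y] - u.[x].
    by have := congr1 (fun s => s.[y]) hq; rewrite !hornerE => ->.
  rewrite e1 -[leLHS]real_normK ?num_real// -[leRHS]real_normK ?num_real//.
  rewrite ler_sqr ?nnegrE//.
  rewrite /Num.max; case: ifP => h; last by rewrite normr0.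
  by rewrite !ger0_norm; lra.
have near_eq : \forall y \near x, r.[y] * u.[y] ^- k * expR (- u.[y]^-1) = flat u k r y.
  have : \forall y \near x, 0 < u.[y] by apply: (cvgr_gt _ (continuous_horner (p := u) (x:=x))).
  by apply: filterS => y uy; rewrite /flat uy.
apply: near_eq_is_derive near_eq _ => //.
have un0 : u.[x] != 0 by rewrite gt_eqF.
have du : is_derive x 1 (horner u) u^`().[x].
  by apply: DeriveDef; [exact: derivable_horner|rewrite -derive1E -derivE].
have dr : is_derive x 1 (horner r) r^`().[x].
  by apply: DeriveDef; [exact: derivable_horner|rewrite -derive1E -derivE].
have dv : is_derive x 1 (fun y => u.[y]^-1) (- u.[x] ^- 2 *: u^`().[x]) by exact: is_deriveV.
have dn : is_derive x 1 (fun y => - u.[y]^-1) (- (- u.[x] ^- 2 *: u^`().[x])) by exact: is_deriveN.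
have de : is_derive x 1 (fun y => expR (- u.[y]^-1)) _ :=
  @is_derive1_comp _ expR (fun y => - u.[y]^-1) _ _ _ (is_derive_expR _) dn.
have dk : is_derive x 1 (fun y => u.[y] ^+ k) ((k%:R * u.[x] ^+ k.-1) *: u^`().[x]).
  by rewrite (_ : (fun y => _) = horner u ^+ k)//; [exact: is_deriveX|rewrite fctE].
have dik : is_derive x 1 (fun y => u.[y] ^- k) _ :=
  @is_deriveV _ (fun y => u.[y] ^+ k) _ _ _ (expf_neq0 k un0) dk.
have drk : is_derive x 1 (fun y => r.[y] * u.[y] ^- k) _ := is_deriveM dr dik.
have dall : is_derive x 1 (fun y => r.[y] * u.[y] ^- k * expR (- u.[y]^-1)) _ := is_deriveM drk de.
apply: is_derive_eq dall _.
rewrite /flat u0 /flatd !hornerE /=.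
rewrite /GRing.scale /= -![(expR _ * _) ]mulrC.
have -> : k%:R * u.[x] ^+ k.-1 = k%:R * u.[x] ^+ k / u.[x].
  by case: (k) => [|m]; rewrite ?mul0r//= exprS; field.
have hk : u.[x] ^+ k != 0 by rewrite expf_neq0.
by rewrite -[k.+2]addn2 exprD; field; rewrite hk un0.
Qed.

Lemma flat_derivable u k r (x : R) : derivable (flat u k r) x 1.
Proof. by have [] := flat_is_derive u k r x. Qed.

Lemma flat_derive1 u k r : (flat u k r)^`()%classic = flat u k.+2 (flatd u k r).
Proof.
by apply/funext => x; rewrite derive1E; have [_ ->] := flat_is_derive u k r x.
Qed.

Lemma flat_derive1n n u k r : exists k' r', (flat u k r)^`(n)%classic = flat u k' r'.
Proof.
elim: n => [|n [k' [r' IH]]]; first by exists k, r.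
by exists k'.+2, (flatd u k' r'); rewrite derive1nS IH flat_derive1.
Qed.

Definition smooth1 (g : R -> R) := forall n x, derivable (g^`(n)%classic) x 1.

Lemma smooth1_flat u k r : smooth1 (flat u k r).
Proof. by move=> n x; have [k' [r' ->]] := flat_derive1n n u k r; exact: flat_derivable. Qed.

Lemma smooth1_derive (g : R -> R) : smooth1 g -> smooth1 g^`()%classic.
Proof. by move=> sg n x; rewrite -derive1Sn; exact: sg. Qed.

Lemma smooth1_continuous (g : R -> R) : smooth1 g -> continuous g.
Proof. by move=> sg x; apply/differentiable_continuous/derivable1_diffP/(sg 0%N). Qed.

(** For n > 0 the factor n does not change the support, but it drives exp(-1/(n (x - a)(b - x))) to
    1 inside: the bumps converge pointwise to the indicator of the open interval. *)
Definition bump1 n (a b : R) : R -> R :=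
  flat (n%:R *: (('X - a%:P) * (b%:P - 'X))) 0 1.

Lemma smooth1_bump1 n a b : smooth1 (bump1 n a b).
Proof. exact: smooth1_flat. Qed.

Lemma bump1E n a b x :
  bump1 n a b x = if 0 < n%:R * ((x - a) * (b - x)) then
    expR (- (n%:R * ((x - a) * (b - x)))^-1) else 0.
Proof. by rewrite /bump1 /flat !hornerE /= expr0 invr1 !mul1r. Qed.

Lemma bump1_ge0 n a b x : 0 <= bump1 n a b x.
Proof. by rewrite bump1E; case: ifP => // _; exact: expR_ge0. Qed.

Lemma bump1_le1 n a b x : bump1 n a b x <= 1.
Proof.
rewrite bump1E; case: ifP => // h; rewrite -[leRHS]expR0 ler_expR oppr_le0 invr_ge0.
exact: ltW.
Qed.

Lemma bump1_out n a b x : a < b -> ~ (x \in `[a, b]) -> bump1 n a b x = 0.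
Proof.
move=> ab xab; rewrite bump1E; case: ifPn => // h; exfalso; apply: xab.
rewrite in_itv /=; have n0 : (0 : R) <= n%:R by [].
have h2 : 0 < (x - a) * (b - x) by rewrite ltNge; apply/negP => h3; nra.
by apply/andP; split; nra.
Qed.

Lemma bump1_cvg a b x : a < b ->
  bump1 n a b x @[n --> \oo] --> (\1_(`]a, b[%classic) x : R).
Proof.
move=> ab; rewrite indicE; case: (boolP (x \in `]a, b[%classic)) => xab; last first.
  have h : (x - a) * (b - x) <= 0.
    by move: xab; rewrite notin_setE /= in_itv /= => /negP; rewrite negb_and -!leNgt => /orP[]; nra.
  apply: cvg_near_cst; apply: nearW => n; rewrite bump1E ltNge.
  by rewrite mulr_ge0_le0.
have h : 0 < (x - a) * (b - x).
  by move: xab; rewrite inE /= in_itv /= => /andP[h1 h2]; rewrite mulr_gt0 ?subr_gt0.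
rewrite -[true%:R]expR0 -(cvg_shiftS _ _) /=.
rewrite [X in X @ _](_ : _ = (fun n => expR (- (n.+1%:R^-1 * ((x - a) * (b - x))^-1)))); last first.
  by apply/funext => n; rewrite bump1E mulr_gt0// invfM.
apply: continuous_cvg; first exact: continuous_expR.
rewrite -oppr0; apply: cvgN; rewrite -(mul0r ((x - a) * (b - x))^-1).
apply: cvgM; last exact: cvg_cst.
exact: cvg_harmonic.
Qed.

End Flat.

(** * Partial derivatives along coordinate lines, and tensor products *)

Section Coordinates.
Context {R : realType}.
Implicit Types (i j : 'I_3) (x y : pt R) (f g : pt R -> R).

Definition crd i x : R := vec_of x i 0.
(** The line through [x] in direction [i], parametrized by the coordinate; along it, partial
    derivatives become derivatives in one variable. *)
Definition upd i x (t : R) : pt R :=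
  (if i == 0 then t else x.1.1, if i == 1 then t else x.1.2,
   if i == 2%:R then t else x.2).

Lemma ord3P (P : 'I_3 -> Prop) : P 0 -> P 1 -> P 2%:R -> forall i, P i.
Proof.
move=> h0 h1 h2 [[|[|[|//]]] hi].
- by rewrite (_ : Ordinal hi = 0)//; exact/val_inj.
- by rewrite (_ : Ordinal hi = 1)//; exact/val_inj.
- by rewrite (_ : Ordinal hi = 2%:R)//; exact/val_inj.
Qed.

Lemma crd0 x : crd 0 x = x.1.1. Proof. by rewrite /crd /vec_of mxE. Qed.
Lemma crd1 x : crd 1 x = x.1.2. Proof. by rewrite /crd /vec_of mxE. Qed.
Lemma crd2 x : crd 2%:R x = x.2. Proof. by rewrite /crd /vec_of mxE. Qed.
Definition crdE := (crd0, crd1, crd2).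

Lemma crd_inj x y : (forall i, crd i x = crd i y) -> x = y.
Proof.
case: x => [[a b] c]; case: y => [[a' b'] c'] h.
by have := (h 0, h 1, h 2%:R); rewrite !crdE /= => -[[-> ->] ->].
Qed.

Lemma upd_crd i x : upd i x (crd i x) = x.
Proof. by case: x => [[a b] c]; elim/ord3P: i; rewrite !crdE. Qed.

Lemma crd_upd i x t : crd i (upd i x t) = t.
Proof. by elim/ord3P: i; rewrite !crdE. Qed.

Lemma crd_upd_neq i j x t : j != i -> crd j (upd i x t) = crd j x.
Proof. by elim/ord3P: i; elim/ord3P: j; rewrite !crdE. Qed.

Lemma crdD i x y : crd i (x + y) = crd i x + crd i y.
Proof. by elim/ord3P: i; rewrite !crdE. Qed.

Lemma crdZ i (h : R) x : crd i (h *: x) = h * crd i x.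
Proof. by elim/ord3P: i; rewrite !crdE. Qed.

Lemma crd_basis i j : crd j (ptbasis i) = (j == i)%:R :> R.
Proof. by elim/ord3P: j; rewrite crdE /ptbasis /= eq_sym. Qed.

Lemma shift_upd i x (h : R) : h *: ptbasis i + x = upd i x (h + crd i x).
Proof.
apply: crd_inj => j; rewrite crdD crdZ crd_basis.
have [->|ji] := eqVneq j i; first by rewrite crd_upd mulr1.
by rewrite crd_upd_neq// mulr0 add0r.
Qed.

Lemma upd_upd i x t s : upd i (upd i x t) s = upd i x s.
Proof. by case: x => [[a b] c]; elim/ord3P: i. Qed.

Lemma quotient_upd i f x :
  (fun h => h^-1 *: ((f \o shift x) (h *: ptbasis i) - f x)) =
  (fun h => h^-1 *: (((f \o upd i x) \o shift (crd i x)) (h *: 1)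
                     - (f \o upd i x) (crd i x))).
Proof.
apply/funext => h; congr (_ *: (_ - _)); rewrite /= ?upd_crd//.
by rewrite shift_upd [h *: 1]mulr1.
Qed.

Lemma derivable_upd i f x :
  derivable f x (ptbasis i) = derivable (f \o upd i x) (crd i x) 1.
Proof. by rewrite /derivable quotient_upd. Qed.

Lemma pderiv_upd i f x : pderiv i f x = (f \o upd i x)^`()%classic (crd i x).
Proof. by rewrite /pderiv derive1E /derive quotient_upd. Qed.

Lemma derivable_upd_line i f : (forall x, derivable f x (ptbasis i)) ->
  forall x t, derivable (f \o upd i x) t 1.
Proof.
move=> df x t; have := df (upd i x t); rewrite derivable_upd crd_upd.
by rewrite (_ : f \o upd i (upd i x t) = f \o upd i x)//; apply/funext => s /=; rewrite upd_upd.
Qed.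

Lemma pderiv_upd_line i f x t :
  pderiv i f (upd i x t) = (f \o upd i x)^`()%classic t.
Proof.
rewrite pderiv_upd crd_upd.
by rewrite (_ : f \o upd i (upd i x t) = f \o upd i x)//; apply/funext => s /=; rewrite upd_upd.
Qed.

Lemma continuous_crd i : continuous (crd i).
Proof.
move=> x; elim/ord3P: i.
- rewrite (_ : crd 0 = fst \o fst); last by apply/funext => y; rewrite crdE.
  by apply: continuous_comp; exact: cvg_fst.
- rewrite (_ : crd 1 = snd \o fst); last by apply/funext => y; rewrite crdE.
  by apply: continuous_comp; [exact: cvg_fst|exact: cvg_snd].
- rewrite (_ : crd 2%:R = snd); last by apply/funext => y; rewrite crdE.
  exact: cvg_snd.
Qed.

Lemma continuous_upd i x : continuous (upd i x).
Proof.
have h (c : bool) (s : R) : continuous (fun t : R => if c then t else s).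
  by case: c => t; [exact: cvg_id|exact: cvg_cst].
move=> t; apply: (@cvg_pair _ _ _ (nbhs t) (nbhs _) (nbhs _)); last exact: h.
by apply: (@cvg_pair _ _ _ (nbhs t) (nbhs _) (nbhs _)); exact: h.
Qed.

(** Bumps and monomials both have this form, in which a partial derivative acts on a single
    factor. *)
Definition prod3 (g : 'I_3 -> R -> R) x := \prod_i g i (crd i x).

Lemma prod3E (g : 'I_3 -> R -> R) x : prod3 g x = g 0 x.1.1 * g 1 x.1.2 * g 2%:R x.2.
Proof.
rewrite /prod3 !big_ord_recl big_ord0 mulr1 mulrA.
have -> : lift ord0 (lift ord0 ord0) = 2%:R :> 'I_3 by exact/val_inj.
have -> : lift ord0 ord0 = 1 :> 'I_3 by exact/val_inj.
have -> : ord0 = 0 :> 'I_3 by exact/val_inj.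
by rewrite !crdE.
Qed.

Lemma prod3_upd (g : 'I_3 -> R -> R) i x t :
  prod3 g (upd i x t) = (\prod_(j | j != i) g j (crd j x)) * g i t.
Proof.
rewrite /prod3 (bigD1 i)//= crd_upd mulrC; congr (_ * _).
by apply: eq_bigr => j ji; rewrite crd_upd_neq.
Qed.

Lemma continuous_prod3 (g : 'I_3 -> R -> R) :
  (forall i, continuous (g i)) -> continuous (prod3 g).
Proof.
move=> cg x; rewrite (_ : prod3 g = (fun x => g 0 (crd 0 x) * g 1 (crd 1 x) * g 2%:R (crd 2%:R
    x))); last first.
  by apply/funext => y; rewrite prod3E !crdE.
apply: cvgM; first apply: cvgM;
  by apply: continuous_comp; [exact: continuous_crd|exact: cg].
Qed.

Lemma derivable_prod3 (g : 'I_3 -> R -> R) i x :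
  derivable (g i) (crd i x) 1 -> derivable (prod3 g) x (ptbasis i).
Proof.
move=> dg; rewrite derivable_upd.
rewrite (_ : _ \o _ = (\prod_(j | j != i) g j (crd j x)) *: g i); last first.
  by apply/funext => t /=; rewrite prod3_upd.
exact: derivableZ.
Qed.

Lemma pderiv_prod3 (g : 'I_3 -> R -> R) i : (forall t, derivable (g i) t 1) ->
  pderiv i (prod3 g) = prod3 (fun j => if j == i then (g j)^`()%classic else g j).
Proof.
move=> dg; apply/funext => x; rewrite pderiv_upd.
rewrite (_ : _ \o _ = (\prod_(j | j != i) g j (crd j x)) *: g i); last first.
  by apply/funext => t /=; rewrite prod3_upd.
rewrite derive1E deriveZ//.
transitivity (prod3 (fun j => if j == i then (g j)^`()%classic else g j) (upd i x (crd i x)));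
    last by rewrite upd_crd.
rewrite prod3_upd eqxx derive1E.
by congr (_ * _); apply: eq_bigr => j /negbTE ->.
Qed.

Lemma Ck_prod3 m (g : 'I_3 -> R -> R) : (forall i, smooth1 (g i)) -> Ck m (prod3 g).
Proof.
elim: m g => [|m IH] g sg; split=> //;
  try by apply: continuous_prod3 => i; exact: smooth1_continuous.
move=> i; split; first by move=> x; apply: derivable_prod3; exact: (sg i 0%N).
rewrite pderiv_prod3; last by move=> t; exact: (sg i 0%N).
by apply: IH => j; case: ifP => // _; exact: smooth1_derive.
Qed.

Lemma pderivC_prod3 (g : 'I_3 -> R -> R) i j : (forall i, smooth1 (g i)) ->
  pderiv i (pderiv j (prod3 g)) = pderiv j (pderiv i (prod3 g)).
Proof.
move=> sg; have d0 k t : derivable (g k) t 1 by exact: (sg k 0%N).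
have d1 k t : derivable (g k)^`()%classic t 1 by exact: (sg k 1%N).
rewrite !pderiv_prod3//; last 2 first.
- by case: ifP.
- by case: ifP.
congr prod3; apply/funext => k; case: (eqVneq k i) => ki; case: (eqVneq k j) => kj //.
Qed.

Definition bump n (a b : pt R) := prod3 (fun i => bump1 n (crd i a) (crd i b)).

Lemma cboxP a b x : cbox a b x <-> forall i, crd i x \in `[crd i a, crd i b].
Proof.
split=> [[[/= h0 h1] h2]|h]; first by elim/ord3P; rewrite !crdE.
by have := (h 0, h 1, h 2%:R); rewrite !crdE => -[[]].
Qed.

Lemma oboxP a b x : obox a b x <-> forall i, crd i x \in `]crd i a, crd i b[.
Proof.
split=> [[[/= h0 h1] h2]|h]; first by elim/ord3P; rewrite !crdE.
by have := (h 0, h 1, h 2%:R); rewrite !crdE => -[[]].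
Qed.

Definition ptlt a b := forall i, crd i a < crd i b.

Lemma bump_out n a b x : ptlt a b -> ~ cbox a b x -> bump n a b x = 0.
Proof.
move=> ab /cboxP/existsNP[i hi]; rewrite /bump /prod3 (bigD1 i)//=.
by rewrite bump1_out ?mul0r.
Qed.

Lemma bump_norm n a b x : `|bump n a b x| <= 1.
Proof.
rewrite ger0_norm; last by apply: prodr_ge0 => i _; exact: bump1_ge0.
by apply: prodr_ile1 => i _; rewrite bump1_ge0 bump1_le1.
Qed.

Lemma bump_cvg a b x : ptlt a b ->
  bump n a b x @[n --> \oo] --> (\1_(obox a b) x : R).
Proof.
move=> ab.
have -> : (\1_(obox a b) x : R) = \prod_i \1_(`]crd i a, crd i b[%classic) (crd i x).
  rewrite indicE; case: (boolP (x \in obox a b)) => [/set_mem/oboxP h|].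
    by rewrite big1// => i _; rewrite indicE mem_set//; exact: h.
  rewrite notin_setE => /oboxP/existsNP[i hi]; rewrite (bigD1 i)//= indicE memNset ?mul0r//.
rewrite -/(prod3 (fun i => \1_(`]crd i a, crd i b[%classic)) x) prod3E -!crdE.
rewrite (_ : (fun n => bump n a b x) = fun n => bump1 n (crd 0 a) (crd 0 b) (crd 0 x) *
  bump1 n (crd 1 a) (crd 1 b) (crd 1 x) * bump1 n (crd 2%:R a) (crd 2%:R b) (crd 2%:R x));
      last first.
  by apply/funext => n; rewrite /bump prod3E !crdE.
by apply: cvgM; first apply: cvgM; exact: bump1_cvg.
Qed.

Lemma test_bump (Om : set (pt R)) n a b : ptlt a b -> cbox a b `<=` Om -> test Om (bump n a b).
Proof.
move=> ab abOm; split.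
  by move=> m; apply: Ck_prod3 => i; exact: smooth1_bump1.
exists (cbox a b); split=> //; first exact: compact_cbox.
by move=> x; exact: bump_out.
Qed.

End Coordinates.

(** * The fundamental lemma of the calculus of variations *)

Section FundamentalLemma.
Context {R : realType}.
Local Notation mu := (leb3 R).
Implicit Types (a b x : pt R) (U : set (pt R)) (f : pt R -> R).

Definition boxes : set (set (pt R)) := [set A | exists a b, A = obox a b].

(** The inclusion of closed boxes keeps a bump on the intersection supported in any set that
    contains [cbox a b]. *)
Lemma oboxI c d a b : exists e g,
  obox c d `&` obox a b = obox e g /\ cbox e g `<=` cbox a b.
Proof.
pose mx (s t : pt R) : pt R := (Num.max s.1.1 t.1.1, Num.max s.1.2 t.1.2, Num.max s.2 t.2).
pose mn (s t : pt R) : pt R := (Num.min s.1.1 t.1.1, Num.min s.1.2 t.1.2, Num.min s.2 t.2).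
have I (s t s' t' : R) : `]s, t[ `&` `]s', t'[ = `]Num.max s s', Num.min t t'[%classic.
  apply/seteqP; split => r; rewrite /= !in_itv /= gt_max lt_min.
    by case=> /andP[-> ->] /andP[-> ->].
  by case/andP=> /andP[-> ->] /andP[-> ->].
have J (s t s' t' : R) : `[Num.max s s', Num.min t t'] `<=` `[s', t'].
  by move=> r; rewrite /= !in_itv /= ge_max le_min => /andP[/andP[_ ->] /andP[_ ->]].
exists (mx c a), (mn d b); split; first by rewrite /obox -!setXI /= !I.
by move=> x [[/J h1 /J h2] /J h3].
Qed.

Lemma setI_boxes : setI_closed boxes.
Proof.
move=> _ _ [a [b ->]] [c [d ->]].
by have [e [g [-> _]]] := oboxI a b c d; exists e, g.
Qed.

(** A half-space orthogonal to an axis is a countable union of boxes, so the coordinates are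
    measurable for the generated sigma-algebra, and with them the identity into the product. *)
Lemma measurable_boxes : (@measurable _ (P3 R)) `<=` <<s boxes >>.
Proof.
pose T := g_sigma_algebraType boxes.
have cov (i : 'I_3) : measurable_fun setT (crd i : T -> R).
  apply: (measurability _ (RGenOInfty.measurableE R)) => _ [_ [t ->] <-].
  rewrite setTI.
  have -> : crd i @^-1` `]t, +oo[%classic = \bigcup_n
      obox (upd i (- n%:R, - n%:R, - n%:R) t) ((n%:R, n%:R, n%:R) : pt R).
    apply/seteqP; split => x.
      rewrite /= in_itv /= andbT => h.
      have [n hn] : exists n : nat, forall j, `|crd j x| < n%:R.
        pose M := \sum_j `|crd j x|.
        exists (Num.bound M) => j; apply: le_lt_trans (archi_boundP _).
          by rewrite /M (bigD1 j)//= lerDl sumr_ge0.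
        by apply: sumr_ge0.
      exists n => //; apply/oboxP => j.
      have -> : crd j ((n%:R, n%:R, n%:R) : pt R) = n%:R by elim/ord3P: j; rewrite crdE.
      have := hn j; rewrite ltr_norml => /andP[h1 h2]; rewrite in_itv /= h2 andbT.
      have [->|ji] := eqVneq j i; first by rewrite crd_upd.
      by rewrite crd_upd_neq//; move: h1; elim/ord3P: (j); rewrite !crdE.
    move=> [n _ /oboxP/(_ i)]; rewrite crd_upd /= !in_itv /= andbT.
    by case/andP.
  apply: bigcupT_measurable => n; apply: sub_sigma_algebra.
  by exists (upd i (- n%:R, - n%:R, - n%:R) t), (n%:R, n%:R, n%:R).
move=> A mA.
have mid : measurable_fun setT ((fun x : T => (crd 0 x, crd 1 x, crd 2%:R x)) : T -> P3 R).
  apply: measurable_fun_pair; last exact: cov.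
  by apply: measurable_fun_pair; exact: cov.
have := mid measurableT A mA; rewrite setTI.
rewrite (_ : _ @^-1` A = A)//; apply/seteqP; split => -[[p q] r]; by rewrite /= !crdE.
Qed.

(** The measurable sets over which [f] integrates to zero form a Dynkin system. It contains the
    boxes, which are stable under intersection, hence every measurable set. *)
Lemma ae_eq0_boxes a b f : mu.-integrable (obox a b) (EFin \o f) ->
  (forall c d, (\int[mu]_(x in obox c d `&` obox a b) (f x)%:E = 0)%E) ->
  {ae mu, forall x, obox a b x -> f x = 0}.
Proof.
move=> intf h0; set Q := obox a b.
have mQ : measurable (Q : set (P3 R)) := measurable_obox a b.
pose H := [set A : set (P3 R) | measurable A /\
  (\int[mu]_(x in A `&` Q) (f x)%:E = 0)%E].
have dH : dynkin H.
  split.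
  - split; first exact: measurableT.
    by rewrite setTI -[Q]setIid; exact: h0.
  - move=> A [mA hA]; split; first exact: measurableC.
    have : (\int[mu]_(x in (A `&` Q) `|` (~` A `&` Q)) (f x)%:E = 0)%E.
      by rewrite -setIUl setUv setTI -[Q]setIid; exact: h0.
    rewrite integral_setU//.
    + by rewrite hA add0e.
    + by apply: measurableI.
    + by apply: measurableI => //; exact: measurableC.
    + rewrite -setIUl setUv setTI; exact: measurable_int intf.
    + by rewrite disj_set2E; apply/eqP; rewrite setIACA setICr set0I.
  - move=> F tF hF; split.
      by apply: bigcupT_measurable => n; case: (hF n).
    rewrite setI_bigcupl integral_bigcup//.
    + by apply: eseries0 => n _ _; case: (hF n).
    + exact: trivIset_setIr.
    + by move=> n; apply: measurableI => //; case: (hF n).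
    + apply: integrableS intf => //.
      * apply: bigcupT_measurable => n; apply: measurableI => //; by case: (hF n).
      * by move=> x [n _ []].
have sub : <<s boxes >> `<=` H.
  apply: lambda_system_subset.
  - exact: setI_boxes.
  - exact/dynkin_lambda_system.
  - by move=> _ [c [d ->]]; split; [exact: measurable_obox|exact: h0].
  - by [].
have := @integral_ae_eq _ _ _ mu Q mQ (cst 0%E) (EFin \o f) intf (measurable_cst _).
move=> /(_ _)H1; have {}H1 : ae_eq mu Q (EFin \o f) (cst 0%E).
  apply: H1 => E EQ mE; rewrite integral0 -[E](setIidl EQ).
  by have [_] := sub _ (measurable_boxes mE).
by apply: aeS H1 => x h Qx; have [] := h Qx.
Qed.

(** Bumps tend boundedly to the indicator of a box, so by dominated convergence [f] integrates to
    zero over every box whose closure lies in [U]. The Dynkin argument then applies inside each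
    rational box, and countably many of these cover [U]. *)
Lemma fundamental_lemma U f : open U -> mu.-integrable U (EFin \o f) ->
  (forall n a b, ptlt a b -> cbox a b `<=` U ->
     (\int[mu]_(x in U) (f x * bump n a b x)%:E = 0)%E) ->
  {ae mu, forall x, U x -> f x = 0}.
Proof.
move=> oU intf h0.
have mU : measurable (U : set (P3 R)) := open_pt_measurable oU.
have mf := measurable_int _ intf.
have box0 a b : ptlt a b -> cbox a b `<=` U -> (\int[mu]_(x in obox a b) (f x)%:E = 0)%E.
  move=> ab abU.
  have mO : measurable (obox a b : set (P3 R)) := measurable_obox a b.
  have mfU : measurable_fun (U : set (P3 R)) f by exact/measurable_EFinP.
  have cvg : (\int[mu]_(x in U) (f x * bump n a b x)%:E @[n --> \oo] -->
              \int[mu]_(x in U) (f x * \1_(obox a b) x)%:E)%E.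
    have [||||| _ _ h] := @dominated_convergence _ _ _ mu U mU
      (fun n x => (f x * bump n a b x)%:E) (fun x => (f x * \1_(obox a b) x)%:E)
      (fun x => `|f x|%:E).
    - move=> n; apply/measurable_EFinP; apply: measurable_funM => //.
      apply: measurable_funTS; apply: continuous_pt_measurable.
      by apply: continuous_prod3 => i; apply: smooth1_continuous; exact: smooth1_bump1.
    - by apply/measurable_EFinP; apply: measurable_funM.
    - apply: aeW => x Ux; apply: cvg_EFin; first exact: nearW.
      by apply: cvgM; [exact: cvg_cst|exact: bump_cvg].
    - exact: (integrable_abse intf).
    - apply: aeW => x n Ux; rewrite lee_fin normrM ler_piMr//; exact: bump_norm.
    - exact: h.
  have -> : (\int[mu]_(x in obox a b) (f x)%:E = \int[mu]_(x in U) (f x * \1_(obox a b) x)%:E)%E.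
    rewrite -[obox a b in LHS](setIidr (subset_trans (@obox_sub_cbox _ a b) abU)) integral_mkcondr.
    apply: eq_integral => x _; rewrite patchE indicE.
    by case: (x \in obox a b); rewrite ?mulr1 ?mulr0.
  apply: (cvg_unique _ cvg) => //=.
  rewrite [X in X @ _](_ : _ = cst 0%E); first exact: cvg_cst.
  by apply/funext => n; exact: h0.
have loc p q : cbox (ratpt p) (ratpt q) `<=` U ->
    {ae mu, forall x, obox (ratpt p) (ratpt q) x -> f x = 0}.
  move=> pqU; apply: ae_eq0_boxes.
    apply: integrableS intf => //; first exact: measurable_obox.
    exact: (subset_trans (@obox_sub_cbox _ _ _)).
  move=> c d.
  have [e [g [eg egs]]] := oboxI c d (ratpt p) (ratpt q).
  rewrite eg; have [lt|nlt] := pselect (ptlt e g); first apply: box0 => //.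
    exact: subset_trans egs pqU.
  rewrite (_ : obox e g = set0) ?integral_set0//.
  apply/seteqP; split => // x /oboxP hx; apply: nlt => i.
  by have := hx i; rewrite in_itv /= => /andP[/lt_trans]; exact.
have : {ae mu, forall x, forall pq : (rat * rat * rat) * (rat * rat * rat),
   cbox (ratpt pq.1) (ratpt pq.2) `<=` U -> obox (ratpt pq.1) (ratpt pq.2) x -> f x = 0}.
  (* Decoding integers with [unpickle] enumerates the pairs of rational corners, so that a countable
     union of null sets suffices. *)
  have := @ae_foralln _ _ _ mu (fun n x =>
    if @unpickle ((rat * rat * rat) * (rat * rat * rat))%type n is Some pq then
      cbox (ratpt pq.1) (ratpt pq.2) `<=` U -> obox (ratpt pq.1) (ratpt pq.2) x -> f x = 0
    else True).
  move=> /(_ _)H; have {}H := H _; apply: aeS (H _) => [x hx pq|n].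
    by have := hx (pickle pq); rewrite pickleK.
  case: unpickle => [pq|]; last exact: aeW.
  have [h|h] := pselect (cbox (ratpt pq.1) (ratpt pq.2) `<=` U); last by apply: aeW => x /h.
  by apply: aeS (loc _ _ h) => x hx _.
apply: aeS => x hx Ux; have [p [q [h1 h2]]] := open_obox oU Ux.
exact: (hx (p, q) h2 h1).
Qed.

End FundamentalLemma.

(** * Weak derivatives *)

Section IntegrationByParts.
Context {R : realType}.
Local Notation mu := (leb3 R).
Local Notation leb := (@lebesgue_measure R).
Implicit Types (i j : 'I_3) (a b x : pt R) (f F : pt R -> R).

Lemma near0_derive1 (g : R -> R) t : (\forall s \near t, g s = 0) -> g^`()%classic t = 0.
Proof.
move=> h; rewrite derive1E (@near_eq_derive _ _ _ g (cst 0)) ?derive_cst//.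
Qed.

Lemma int_derive1_compact (g : R -> R) (a b : R) : a < b ->
  (forall t, derivable g t 1) -> continuous g^`()%classic ->
  (forall t, ~ (t \in `[a, b]) -> g t = 0) ->
  (\int[leb]_t (g^`()%classic t)%:E = 0)%E.
Proof.
move=> ab dg cg' g0.
have cg : continuous g by move=> t; apply/differentiable_continuous/derivable1_diffP.
have out t : ~ (t \in `[a, b]) -> g^`()%classic t = 0.
  move=> h; apply: near0_derive1.
  have : open (~` `[a, b]%classic) by apply: closed_openC; exact: interval_closed.
  rewrite openE => /(_ t) H; have {}H : (~` `[a, b]%classic)^° t by apply: H => /=.
  by apply: filterS H => s /= hs; apply: g0.
(* The function is assumed to vanish only outside the closed interval, so the endpoints are moved
   out by 1. *)
have -> : (\int[leb]_t (g^`()%classic t)%:E = \int[leb]_(t in `[(a - 1)%R,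
    (b + 1)%R]) (g^`()%classic t)%:E)%E.
  rewrite [RHS]integral_mkcond; apply: eq_integral => t _; rewrite patchE.
  case: ifPn => //; rewrite notin_setE /= => h; rewrite out//.
  by apply: contra_not h; rewrite !in_itv /= => /andP[h1 h2]; apply/andP; split; lra.
rewrite (@continuous_FTC2 _ _ g).
- by rewrite !g0 ?subee// in_itv /= => /andP[]; lra.
- by lra.
- exact: continuous_subspaceT.
- split; first by move=> t _; exact: dg.
  + by apply: cvg_at_right_filter; exact: cg.
  + by apply: cvg_at_left_filter; exact: cg.
- by [].
Qed.

Lemma continuous_cbox_bounded f a b : continuous f ->
  exists M, 0 <= M /\ forall x, cbox a b x -> `|f x| <= M.
Proof.
move=> cf.
have : compact (f @` cbox a b).
  apply: continuous_compact; last exact: compact_cbox.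
  exact: continuous_subspaceT.
move/compact_bounded => [M [Mr hM]]; exists (`|M| + 1); split; first by rewrite addr_ge0.
move=> x hx; apply: (hM (`|M| + 1)); last by exists x.
by rewrite (le_lt_trans (ler_norm M))// ltrDl.
Qed.

Lemma integrable_compact f a b : continuous f ->
  (forall x, ~ cbox a b x -> f x = 0) -> mu.-integrable setT (EFin \o f).
Proof.
move=> cf f0; have [M [M0 hM]] := continuous_cbox_bounded a b cf.
have mc : measurable (cbox a b : set (P3 R)) := measurable_cbox a b.
have -> : EFin \o f = (EFin \o f) \_ (cbox a b).
  by apply/funext => x; rewrite patchE /=; case: ifPn => //; rewrite notin_setE => /f0 ->.
apply/(integrable_mkcond _ mc).
apply: measurable_bounded_integrable => //.
- exact: leb3_cbox.
- by apply: measurable_funTS; exact: continuous_pt_measurable.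
- exists M; split; first exact: num_real.
  by move=> y hy x hx /=; rewrite (le_trans (hM _ hx))// ltW.
Qed.

Lemma pderiv_out i F (C : set (pt R)) : closed C -> (forall x, ~ C x -> F x = 0) ->
  forall x, ~ C x -> pderiv i F x = 0.
Proof.
move=> cC F0 x Cx; rewrite pderiv_upd; apply: near0_derive1.
have oc : open (~` C) by exact: closed_openC.
have : nbhs x (~` C) by move: oc; rewrite openE; exact.
rewrite -{1}(upd_crd i x) => hn.
have H : \forall s \near crd i x, (~` C) (upd i x s) := @continuous_upd _ i x (crd i x) _ hn.
by apply: filterS H => s /= hs; exact: F0.
Qed.

Lemma closed_cbox a b : closed (cbox a b).
Proof. by apply: compact_closed; [exact: norm_hausdorff|exact: compact_cbox]. Qed.

Lemma leb2_square (s t s' t' : R) : (leb2 (R := R) (`[s, t] `*` `[s', t']) < +oo)%E.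
Proof.
rewrite /leb2 product_measure1E/=; last 2 first.
- exact: measurable_itv.
- exact: measurable_itv.
by rewrite !lebesgue_measure_itv /=; repeat case: ifP => _ //=; rewrite -?EFinM ?mule0 ?mul0e ?ltry.
Qed.

(** Integrating first along direction [i] gives zero on every line. As [leb3] is an iterated
    product, directions 0 and 1 require a second use of Fubini, on the horizontal slices. *)
Lemma int_pderiv0 i F a b : ptlt a b -> (forall x, derivable F x (ptbasis i)) ->
  continuous (pderiv i F) -> (forall x, ~ cbox a b x -> F x = 0) ->
  (\int[mu]_x (pderiv i F x)%:E = 0)%E.
Proof.
move=> ab dF cF F0.
have out x : ~ cbox a b x -> pderiv i F x = 0.
  by apply: pderiv_out; [exact: closed_cbox|exact: F0].
have iF : mu.-integrable setT (EFin \o pderiv i F) by exact: integrable_compact out.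
have line x : (\int[leb]_t (pderiv i F (upd i x t))%:E = 0)%E.
  have H : (\int[leb]_t ((F \o upd i x)^`()%classic t)%:E = 0)%E.
    apply: (int_derive1_compact (ab i)).
    - by move=> t; exact: derivable_upd_line.
    - have -> : (F \o upd i x)^`()%classic = pderiv i F \o upd i x.
        by apply/funext => s; rewrite /= pderiv_upd_line.
      by move=> t; apply: continuous_comp; [exact: continuous_upd|exact: cF].
    - by move=> t ht /=; apply: F0 => /cboxP/(_ i); rewrite crd_upd.
  by apply: eq_trans H; apply: eq_integral => t _; rewrite pderiv_upd_line.
have i2 t : (leb2 (R := R)).-integrable setT (fun p : measurableTypeR R * measurableTypeR R =>
    (pderiv i F (p, t))%:E).
  have [M [M0 hM]] := continuous_cbox_bounded a b cF.
  pose S : set (measurableTypeR R * measurableTypeR R) := `[a.1.1, b.1.1] `*` `[a.1.2, b.1.2].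
  have mS : measurable S by apply: measurableX; exact: measurable_itv.
  have mG : measurable_fun setT (fun p : measurableTypeR R * measurableTypeR R => pderiv i F (p,
      t)).
    by apply: measurable_fun_pair1; exact: continuous_pt_measurable.
  have -> : (fun p => (pderiv i F (p, t))%:E) = (EFin \o (fun p => pderiv i F (p, t))) \_ S.
    apply/funext => p; rewrite patchE /=; case: ifPn => //; rewrite notin_setE => hp.
    by rewrite out// => -[].
  apply/(integrable_mkcond _ mS); apply: measurable_bounded_integrable => //.
  - exact: leb2_square.
  - exact: measurable_funTS.
  - exists M; split; first exact: num_real.
    move=> y hy p hp /=; apply: le_trans (ltW hy).
    by have [/hM//|/out ->] := pselect (cbox a b (p, t)); rewrite normr0.
have leb2E t : i = 0 \/ i = 1 -> (\int[(leb \x leb)%E]_p (pderiv i F (p, t))%:E = 0)%E.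
  case=> i01.
    rewrite -integral21_prod_meas1; last exact: (i2 t).
    by apply: integral0_eq => y _; have := line (0, y, t); rewrite i01.
  rewrite -integral12_prod_meas1; last exact: (i2 t).
  by apply: integral0_eq => x _; have := line (x, 0, t); rewrite i01.
have [i3|i3] : (i = 0 \/ i = 1) \/ i = 2%:R by elim/ord3P: (i); auto.
  rewrite -[LHS](@integral21_prod_meas1 _ _ _ _ _ leb2 leb _ iF).
  by apply: integral0_eq => t _; exact: (leb2E t).
rewrite -[LHS](@integral12_prod_meas1 _ _ _ _ _ leb2 leb _ iF).
by apply: integral0_eq => -[x y] _; have := line (x, y, 0); rewrite i3.
Qed.

Lemma bounded_around (K : set (pt R)) : compact K ->
  exists a b, ptlt a b /\ K `<=` cbox a b.
Proof.
move=> cK; have [a [b hK]] := bounded_cbox (compact_bounded cK).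
(* Lowering the corner strictly below both [a] and [b] makes the box nondegenerate even when
   [cbox a b] is flat or empty. *)
pose a' : pt R := (Num.min a.1.1 b.1.1 - 1, Num.min a.1.2 b.1.2 - 1, Num.min a.2 b.2 - 1).
exists a', b; split.
  elim/ord3P; rewrite !crdE /=; rewrite ltrBlDr ltr_pwDr// ge_min lexx orbT//.
have m0 (s t : R) : Num.min s t - 1 <= s.
  by rewrite lerBlDr ge_min lerDl ler01.
move=> x /hK /cboxP h; apply/cboxP; elim/ord3P; rewrite !crdE /=;
  [have := h 0|have := h 1|have := h 2%:R]; rewrite !crdE !in_itv /= => /andP[h1 ->]; rewrite andbT;
  exact: le_trans (m0 _ _) h1.
Qed.

Variables (Om : set (pt R)) (oOm : open Om) (bOm : bounded_set Om).

Lemma test_pderiv i f : test Om f -> test Om (pderiv i f).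
Proof.
move=> [sf [K [cK KOm f0]]]; split.
  by move=> m; have [_ /(_ i)[]] := sf m.+1.
exists K; split=> //; apply: pderiv_out => //.
by apply: compact_closed => //; exact: norm_hausdorff.
Qed.

Lemma test_out f : test Om f -> forall x, ~ Om x -> f x = 0.
Proof. by move=> [_ [K [_ KOm f0]]] x hx; apply: f0 => /KOm. Qed.

Lemma integration_by_parts i f (phi : pt R -> R) : Ck 1 f -> test Om phi ->
  \int[mu]_(x in Om) (pderiv i f x * phi x) = - \int[mu]_(x in Om) (f x * pderiv i phi x).
Proof.
move=> [cf df] tphi; have [sphi [K [cK KOm phi0]]] := tphi.
have [_ [K' [_ KOm' phi0']]] := test_pderiv i tphi.
have [a [b [ab Kab]]] := bounded_around cK.
have [cphi dphi] := sphi 1%N.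
have tdphi := test_pderiv i tphi.
have dfx x := (df i).1 x.
have dphix x := (dphi i).1 x.
have pE : pderiv i (fun x => f x * phi x) = fun x => f x * pderiv i phi x + phi x * pderiv i f x.
  by apply/funext => x; rewrite /pderiv (deriveM (dfx x) (dphix x)).
have cdf : continuous (pderiv i f) by have [] := (df i).2.
have cdphi : continuous (pderiv i phi) by have [] := (dphi i).2.
have out x : ~ cbox a b x -> phi x = 0 by move=> h; apply: phi0 => /Kab.
have out' x : ~ cbox a b x -> pderiv i phi x = 0.
  by apply: pderiv_out; [exact: closed_cbox|exact: out].
have h : (\int[mu]_x (pderiv i (fun x => f x * phi x) x)%:E = 0)%E.
  apply: (int_pderiv0 ab) => [x||x hx]; last by rewrite out ?mulr0.
  - exact: derivableM.
  - rewrite pE => x; apply: cvgD; first by apply: cvgM; [exact: cf|exact: cdphi].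
    by apply: cvgM; [exact: cphi|exact: cdf].
have i1 : mu.-integrable setT (EFin \o (fun x => f x * pderiv i phi x)).
  apply: (@integrable_compact _ a b).
    by move=> x; apply: cvgM; [exact: cf|exact: cdphi].
  by move=> x hx; rewrite out' ?mulr0.
have i2 : mu.-integrable setT (EFin \o (fun x => phi x * pderiv i f x)).
  apply: (@integrable_compact _ a b).
    by move=> x; apply: cvgM; [exact: cphi|exact: cdf].
  by move=> x hx; rewrite out ?mul0r.
have restr (g : pt R -> R) : (forall x, ~ Om x -> g x = 0) ->
    \int[mu]_(x in Om) g x = \int[mu]_x g x.
  move=> g0; rewrite Rintegral_mkcond; apply: eq_Rintegral => x _.
  by rewrite patchE; case: ifPn => //; rewrite notin_setE => /g0.
rewrite !restr; last 2 first.
- by move=> x hx; rewrite (test_out tdphi hx) mulr0.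
- by move=> x hx; rewrite (test_out tphi hx) mulr0.
apply/eqP; rewrite -addr_eq0 addrC -RintegralD//; last first.
  by apply: eq_integrable i2 => // x _ /=; rewrite mulrC.
apply/eqP; transitivity (\int[mu]_x pderiv i (fun x => f x * phi x) x); last first.
  by rewrite /Rintegral h.
by apply: eq_Rintegral => x _; rewrite pE (mulrC (phi x)).
Qed.

End IntegrationByParts.

(** * The weak curl and its divergence *)

Section WeakCurl.
Context {R : realType}.
Local Notation mu := (leb3 R).
Variables (Om : set (pt R)) (oOm : open Om) (bOm : bounded_set Om).
Implicit Types (u v w c : field R) (phi : pt R -> R) (i j : 'I_3).

Let mOm : measurable (Om : set (P3 R)) := open_pt_measurable oOm.

Lemma bounded_leb3 : (mu Om < +oo)%E.
Proof.
have [a [b h]] := bounded_cbox bOm; apply: le_lt_trans (leb3_cbox a b).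
by apply: le_measure => //; rewrite inE//; exact: measurable_cbox.
Qed.

Lemma L2s_continuous phi : continuous phi -> L2s Om phi.
Proof.
move=> cphi; have [a [b h]] := bounded_cbox bOm.
have [M [_ hM]] := continuous_cbox_bounded a b cphi.
apply: (@L2s_bounded _ _ mOm _ M); first exact: bounded_leb3.
  by apply: measurable_funTS; exact: continuous_pt_measurable.
by move=> x /h; exact: hM.
Qed.

Lemma L2s_integrable f : L2s Om f -> mu.-integrable Om (EFin \o f).
Proof.
move=> hf; have h1 : L2s Om (fun=> 1) by apply: L2s_continuous; exact: cst_continuous.
by apply: eq_integrable (L2s_mul mOm hf h1) => // x _ /=; rewrite mulr1.
Qed.

Lemma Ck_pderiv m i phi : Ck m.+1 phi -> Ck m (pderiv i phi).
Proof. by case=> _ /(_ i)[]. Qed.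

Lemma Ck_continuous m phi : Ck m phi -> continuous phi.
Proof. by case: m => [|m] []. Qed.

Lemma test_continuous phi : test Om phi -> continuous phi.
Proof. by case=> h _; exact: (@Ck_continuous 0). Qed.

Lemma testv_L2v u : testv Om u -> L2v Om u.
Proof. by move=> tu i; apply: L2s_continuous; exact: test_continuous. Qed.

Lemma testv_sgrad phi : test Om phi -> testv Om (sgrad phi).
Proof.
move=> tphi i; rewrite (_ : (fun x => _) = pderiv i phi); first exact: test_pderiv.
by apply/funext => x; rewrite mxE.
Qed.

Lemma testv_scurl_L2v u : testv Om u -> L2v Om (scurl u).
Proof.
move=> tu i; apply: L2s_continuous.
rewrite (_ : (fun x => _) = fun x => (pderiv (i + 1) (fun y => u y (i + 2%:R) 0) x
          - pderiv (i + 2%:R) (fun y => u y (i + 1) 0) x)); last first.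
  by apply/funext => x; rewrite mxE.
by move=> x; apply: cvgB; apply: test_continuous; exact: test_pderiv.
Qed.

Definition single j (f : pt R -> R) : field R := fun x => \col_i (if i == j then f x else 0).

Lemma test0 : test Om (fun=> 0).
Proof.
split; last by exists set0; split => //; exact: compact0.
elim=> [|m IH]; first by split=> //; exact: cst_continuous.
split; first exact: cst_continuous.
move=> i; split; first by move=> x; exact: derivable_cst.
rewrite (_ : pderiv i _ = fun=> 0)//; apply/funext => x.
by rewrite /pderiv derive_cst.
Qed.

Lemma dot_single (a : vec R) j f x : dot a (single j f x) = a j 0 * f x.
Proof.
rewrite /dot (bigD1 j)//= mxE eqxx big1 ?addr0// => i ij.
by rewrite mxE (negbTE ij) mulr0.
Qed.

(** Test fields with one nonzero component, a bump, reduce this to the scalar case. The open subset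
    [V] is the whole domain for the uniqueness of weak curls, and the interior of one element in
    [curl_tet]. *)
Lemma L2v_orth_tests (V : set (pt R)) c : open V -> V `<=` Om -> L2v Om c ->
  (forall u, testv V u -> ip Om c u = 0) -> aeeq V c 0.
Proof.
move=> oV VOm hc h.
have mV : measurable (V : set (P3 R)) := open_pt_measurable oV.
have comp j : {ae mu, forall x, V x -> c x j 0 = 0}.
  apply: fundamental_lemma => //.
    by apply: integrableS (L2s_integrable (hc j)).
  move=> n a b ab abV.
  have tb : test V (bump n a b) by exact: test_bump.
  have tv : testv V (single j (bump n a b)).
    move=> i; have [->|ij] := eqVneq i j.
      by rewrite (_ : (fun x => _) = bump n a b)//; apply/funext => x; rewrite mxE eqxx.
    rewrite (_ : (fun x => _) = fun=> 0).
      split; last by exists set0; split => //; exact: compact0.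
      by have [] := test0.
    by apply/funext => x; rewrite mxE (negbTE ij).
  have h0 := h _ tv.
  have hi : mu.-integrable Om (EFin \o (fun x => c x j 0 * bump n a b x)).
    apply: (L2s_mul mOm (hc j)); apply: L2s_continuous.
    by have [/(_ 0%N)/Ck_continuous] := tb.
  have -> : (\int[mu]_(x in V) (c x j 0 * bump n a b x)%:E =
             \int[mu]_(x in Om) (c x j 0 * bump n a b x)%:E)%E.
    rewrite -[V in LHS](setIidr VOm) integral_mkcondr; apply: eq_integral => x _.
    rewrite patchE; case: ifPn => //; rewrite notin_setE => Vx.
    by rewrite (test_out tb Vx) mulr0.
  rewrite -[LHS](fineK (integrable_fin_num mOm hi)); congr EFin; rewrite -[RHS]h0.
  by congr fine; apply: eq_integral => x _; rewrite dot_single.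
have := aeS2 (fun x h1 h2 => conj h1 h2) (comp 0) (comp 1).
move=> /(aeS2 (fun x h1 h2 => conj h1 h2) (comp 2%:R)).
apply: aeS => x [h2 [h0 h1]] Vx; apply/matrixP => i k; rewrite (ord1 k) [RHS]mxE.
by elim/ord3P: i; [exact: h0|exact: h1|exact: h2].
Qed.

Lemma weak_curl_uniq v c c' : L2v Om c -> L2v Om c' ->
  weak_curl Om v c -> weak_curl Om v c' -> aeeq Om c c'.
Proof.
move=> hc hc' wc wc'.
have : aeeq Om (c - c') 0.
  apply: (@L2v_orth_tests Om) => //; first exact: L2vB.
  move=> u tu; have hu := testv_L2v tu.
  rewrite -[- c']scaleN1r ipDl ?ipZl//; last exact: L2vZ.
  by rewrite -wc// -wc'// mulN1r subrr.
by apply: aeS => x h Ox; apply/eqP; rewrite -subr_eq0; apply/eqP; exact: h.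
Qed.

Lemma weak_curl_lin (k : R) u v c d : L2v Om u -> L2v Om v -> L2v Om c -> L2v Om d ->
  weak_curl Om u c -> weak_curl Om v d -> weak_curl Om (k *: u + v) (k *: c + d).
Proof.
move=> hu hv hc hd wu wv phi tphi.
have h1 := testv_L2v tphi; have h2 := testv_scurl_L2v tphi.
by rewrite !ipDl ?ipZl ?wu ?wv//; exact: L2vZ.
Qed.

Lemma curlP v : Hcurl Om v -> L2v Om (curl Om v) /\ weak_curl Om v (curl Om v).
Proof. by move=> [hv [c hc]]; exact: (@xgetPex _ _ [set c | L2v Om c /\ weak_curl Om v c])
    (ex_intro _ c hc). Qed.

Lemma Hcurl_lin (k : R) u v : Hcurl Om u -> Hcurl Om v -> Hcurl Om (k *: u + v).
Proof.
move=> hu hv; have [cu wu] := curlP hu; have [cv wv] := curlP hv.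
have L1 := hu.1; have L2 := hv.1.
split; first by apply: L2vD => //; exact: L2vZ.
exists (k *: curl Om u + curl Om v); split; first by apply: L2vD => //; exact: L2vZ.
exact: weak_curl_lin.
Qed.

Lemma curl_lin (k : R) u v : Hcurl Om u -> Hcurl Om v ->
  aeeq Om (curl Om (k *: u + v)) (k *: curl Om u + curl Om v).
Proof.
move=> hu hv; have [cu wu] := curlP hu; have [cv wv] := curlP hv.
have [cw ww] := curlP (Hcurl_lin k hu hv).
have L1 := hu.1; have L2 := hv.1.
apply: weak_curl_uniq ww _ => //; first by apply: L2vD => //; exact: L2vZ.
exact: weak_curl_lin.
Qed.

Lemma ip_curl_lin (k : R) u v w : Hcurl Om u -> Hcurl Om v -> L2v Om w ->
  ip Om (curl Om (k *: u + v)) w = k * ip Om (curl Om u) w + ip Om (curl Om v) w.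
Proof.
move=> hu hv hw; have [cu _] := curlP hu; have [cv _] := curlP hv.
have [cw _] := curlP (Hcurl_lin k hu hv).
have h : L2v Om (k *: curl Om u + curl Om v) by apply: L2vD => //; exact: L2vZ.
by rewrite (ip_ael mOm cw h hw (curl_lin k hu hv)) ipDl ?ipZl//; exact: L2vZ.
Qed.

Lemma curl_ae0 v : Hcurl Om v -> aeeq Om v 0 -> aeeq Om (curl Om v) 0.
Proof.
move=> hv v0; have [cv wv] := curlP hv; have L1 := hv.1.
apply: weak_curl_uniq wv _ => //; first exact: L2v0.
move=> phi tphi; rewrite ip0l.
by rewrite (ip_ael mOm L1 (L2v0 mOm) (testv_scurl_L2v tphi) v0) ip0l.
Qed.

(** Two integrations by parts move both derivatives onto a bump, a tensor product for which they
    visibly commute. The almost everywhere form is all that [weak_div_curl] requires. *)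
Lemma pderivC_ae phi i j : test Om phi ->
  {ae mu, forall x, Om x -> pderiv i (pderiv j phi) x = pderiv j (pderiv i phi) x}.
Proof.
move=> tphi; have tp k := test_pderiv k tphi; have tpp k l := test_pderiv k (tp l).
have C1 k : Ck 1 (pderiv k phi) by have [] := tp k.
have Cp : Ck 1 phi by have [] := tphi.
have hc k l := test_continuous (tpp k l).
have : {ae mu, forall x, Om x -> pderiv i (pderiv j phi) x - pderiv j (pderiv i phi) x = 0}.
  apply: fundamental_lemma => //.
    apply: L2s_integrable; apply: L2s_continuous => x.
    by apply: cvgB; exact: hc.
  move=> n a b ab abOm; have tb := test_bump n ab abOm.
  have Cb : Ck 1 (bump n a b) by have [] := tb.
  have tdb k := test_pderiv k tb.
  have bc := test_continuous tb.
  have I k l : mu.-integrable Om (EFin \o (fun x => pderiv k (pderiv l phi) x * bump n a b x)).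
    by apply: L2s_integrable; apply: L2s_continuous => x; apply: cvgM; [exact: hc|exact: bc].
  have E k l : \int[mu]_(x in Om) (pderiv k (pderiv l phi) x * bump n a b x) =
     \int[mu]_(x in Om) (phi x * pderiv l (pderiv k (bump n a b)) x).
    apply: (etrans (integration_by_parts k (C1 l) tb)); rewrite -[RHS]opprK; congr -%R.
    exact: (integration_by_parts l Cp (tdb k)).
  have e0 : \int[mu]_(x in Om) ((pderiv i (pderiv j phi) x - pderiv j (pderiv i phi) x) * bump n a
      b x) = 0.
    under eq_Rintegral do rewrite mulrBl.
    apply: (etrans (RintegralB mOm (I i j) (I j i))).
    have := E j i; rewrite pderivC_prod3; last by move=> k; exact: smooth1_bump1.
    by move=> Eji; apply/eqP; rewrite subr_eq0; apply/eqP; exact: (etrans (E i j) (esym Eji)).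
  have hi : mu.-integrable Om (EFin \o (fun x => (pderiv i (pderiv j phi) x - pderiv j (pderiv i
      phi) x) * bump n a b x)).
    apply: L2s_integrable; apply: L2s_continuous => x.
    by apply: cvgM; [apply: cvgB; exact: hc|exact: bc].
  by rewrite -[LHS](fineK (integrable_fin_num mOm hi)); congr EFin.
by apply: aeS => x h /h /eqP; rewrite subr_eq0 => /eqP.
Qed.

(** Testing the divergence against [phi] is testing the weak curl against the gradient of [phi],
    whose curl vanishes almost everywhere. *)
Lemma weak_div_curl v c : L2v Om v -> L2v Om c -> weak_curl Om v c -> weak_div Om c (cst 0).
Proof.
move=> hv hc wc phi tphi; rewrite -wc; last exact: testv_sgrad.
rewrite (_ : \int[mu]_(x in Om) _ = 0) ?oppr0; last first.
  by rewrite /Rintegral integral0_eq// => x _; rewrite /= mul0r.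
have h2 : L2v Om (scurl (sgrad phi)) by apply: testv_scurl_L2v; exact: testv_sgrad.
rewrite ipC (@ip_ael _ _ mOm _ 0) ?ip0l//; first exact: L2v0.
have sE j : (fun y => sgrad phi y j 0) = pderiv j phi.
  by apply/funext => y; rewrite mxE.
have := aeS2 (fun x h1 h2 => conj h1 h2) (pderivC_ae (0 + 1) (0 + 2%:R) tphi) (pderivC_ae (1 + 1)
    (1 + 2%:R) tphi).
move=> /(aeS2 (fun x h1 h2 => conj h1 h2) (pderivC_ae (2%:R + 1) (2%:R + 2%:R) tphi)).
apply: aeS => x [h20 [h0 h1]] Ox; apply/matrixP => i k; rewrite !mxE !sE.
apply/eqP; rewrite subr_eq0; apply/eqP.
by elim/ord3P: i; [exact: h0|exact: h1|exact: h20].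
Qed.

Lemma Hdiv_lin (k : R) u v : Hdiv Om u -> Hdiv Om v -> Hdiv Om (k *: u + v).
Proof.
move=> [hu [d [hd wd]]] [hv [e [he we]]]; split; first by apply: L2vD => //; exact: L2vZ.
exists (fun x => k * d x + e x); split; first by apply: L2sD => //; exact: L2sZ.
move=> phi tphi; have hg := testv_L2v (testv_sgrad tphi).
have hp := L2s_continuous (test_continuous tphi).
rewrite ipDl ?ipZl//; last exact: L2vZ.
rewrite wd// we// mulrN -opprD; congr -%R.
rewrite -RintegralZl//; last exact: L2s_mul.
rewrite -RintegralD//; last 2 first.
- by apply: eq_integrable (integrableZl mOm k (L2s_mul mOm hd hp)).
- exact: L2s_mul.
by apply: eq_Rintegral => x _; rewrite mulrDl mulrA.
Qed.

Lemma Hdiv0 : Hdiv Om 0.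
Proof.
split; first exact: L2v0.
exists (fun=> 0); split; first exact: L2s0.
move=> phi tphi; rewrite ip0l (_ : \int[mu]_(x in Om) _ = 0) ?oppr0//.
by rewrite /Rintegral integral0_eq// => x _; rewrite /= mul0r.
Qed.

Lemma Hcurl0 : Hcurl Om 0.
Proof.
split; first exact: L2v0.
by exists 0; split; [exact: L2v0|move=> phi tphi; rewrite !ip0l].
Qed.

End WeakCurl.

(** * Lipschitz domains and simplices *)

Section Geometry.
Context {R : realType}.
Local Notation mu := (leb3 R).
Local Notation leb := (@lebesgue_measure R).
Implicit Types (x y : pt R) (i j : 'I_3).

Definition pt_of (u : vec R) : pt R := (u 0 0, u 1 0, u 2%:R 0).

Lemma crd_pt_of u i : crd i (pt_of u) = u i 0.
Proof. by elim/ord3P: i; rewrite crdE. Qed.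

Lemma vec_of_pt_of u : vec_of (pt_of u) = u.
Proof.
apply/matrixP => i k; rewrite (ord1 k) -[LHS]/(crd i (pt_of u)); exact: crd_pt_of.
Qed.

Lemma continuous_pt_of (f : R -> vec R) t :
  (forall i, {for t, continuous (fun s => f s i 0)}) -> {for t, continuous (pt_of \o f)}.
Proof.
move=> h; apply: (@cvg_pair _ _ _ (nbhs t) (nbhs _) (nbhs _)); last exact: h.
by apply: (@cvg_pair _ _ _ (nbhs t) (nbhs _) (nbhs _)); exact: h.
Qed.

Lemma sum3E (F : 'I_3 -> R) : \sum_i F i = F 0 + F 1 + F 2%:R.
Proof.
rewrite !big_ord_recl big_ord0 addr0 addrA.
have -> : lift ord0 (lift ord0 ord0) = 2%:R :> 'I_3 by exact/val_inj.
have -> : lift ord0 ord0 = 1 :> 'I_3 by exact/val_inj.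
by have -> : ord0 = 0 :> 'I_3 by exact/val_inj.
Qed.

Lemma continuous_affine (c : 'I_3 -> R) (d : R) :
  continuous (fun x => \sum_i c i * crd i x + d).
Proof.
rewrite (_ : (fun x => _) = fun x => c 0 * crd 0 x + c 1 * crd 1 x + c 2%:R * crd 2%:R x + d);
    last first.
  by apply/funext => x; rewrite sum3E.
move=> x; apply: cvgD; last exact: cvg_cst.
by apply: cvgD; first apply: cvgD; (apply: cvgM; [exact: cvg_cst|exact: continuous_crd]).
Qed.

Lemma line_single (e f : R) : e != 0 -> [set t | e * t + f = 0] = [set - f / e].
Proof.
move=> e0; apply/seteqP; split => t /=.
  by move=> h; apply: (mulfI e0); rewrite mulrCA divff// mulr1; lra.
by move=> ->; field.
Qed.

(** Sections along an axis with nonzero coefficient are single points. If the third coefficient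
    vanishes, the plane is a cylinder over a line in the first two coordinates. *)
Lemma plane_null (c : 'I_3 -> R) (d : R) i : c i != 0 ->
  mu [set x | \sum_i c i * crd i x + d = 0] = 0%E.
Proof.
move=> ci; set A := [set x | _].
have mA : measurable (A : set (P3 R)).
  rewrite (_ : A = (fun x => \sum_i c i * crd i x + d) @^-1` [set 0])//.
  rewrite -[X in measurable X]setTI.
  by apply: (continuous_pt_measurable (@continuous_affine c d)).
have sumE x : \sum_i c i * crd i x + d = c 0 * x.1.1 + c 1 * x.1.2 + c 2%:R * x.2 + d.
  by rewrite sum3E !crdE.
have single (e f : R) : e != 0 -> leb [set t | e * t + f = 0] = 0%E.
  by move=> e0; rewrite line_single// lebesgue_measure_set1.
have [c2|c2] := eqVneq (c 2%:R) 0; last first.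
  rewrite /leb3 /product_measure1 integral0_eq// => -[p q] _ /=.
  rewrite (_ : xsection A (p, q) = [set t | c 2%:R * t + (c 0 * p + c 1 * q + d) = 0]) ?single//.
  apply/seteqP; split => t; rewrite /xsection /= inE /A /= sumE /= => h; lra.
pose B : set (measurableTypeR R * measurableTypeR R) := [set p | c 0 * p.1 + c 1 * p.2 + d = 0].
have mB : measurable B.
  have : measurable_fun setT (fun p : measurableTypeR R * measurableTypeR R => c 0 * p.1 + c 1 *
      p.2 + d).
    by apply: measurable_funD => //; apply: measurable_funD; apply: measurable_funM.
  by move=> /(_ measurableT [set 0] (measurable_set1 _)); rewrite setTI.
have AE : A = B `*` setT.
  by apply/seteqP; split => -[[p q] r]; rewrite /A /B /= sumE /= c2 => h; [split|case: h]; lra.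
have B0 : leb2 (R := R) B = 0%E.
  have [c1|c1] := eqVneq (c 1) 0; last first.
    rewrite /leb2 /product_measure1 integral0_eq// => p _ /=.
    rewrite (_ : xsection B p = [set t | c 1 * t + (c 0 * p + d) = 0]) ?single//.
    by apply/seteqP; split => t; rewrite /xsection /= inE /B /= => h; lra.
  have c0 : c 0 != 0.
    by apply: contraNneq ci => c0; apply/eqP; elim/ord3P: (i).
  rewrite (_ : B = [set t | c 0 * t + d = 0] `*` setT); last first.
    by apply/seteqP; split => -[p q]; rewrite /B /= c1 => h; [split|case: h]; lra.
  rewrite /leb2 product_measure1E//=; last first.
    by rewrite line_single.
  by rewrite [X in (X * _)%E](_ : _ = 0%E) ?mul0e//; exact: single.
by rewrite AE /leb3 product_measure1E//= [X in (X * _)%E](_ : _ = 0%E) ?mul0e.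
Qed.

(* A Lipschitz domain is the interior of its closure; the mesh only controls
   the closure. *)
Lemma interior_lipschitz (Om V : set (pt R)) : lipschitz_boundary Om -> open V ->
  V `<=` closure Om -> V `<=` Om.
Proof.
move=> lip oV Vcl x0 Vx0; apply: contrapT => nOm.
have [Q [L [g [QQ gL nx]]]] := lip x0 (conj (Vcl _ Vx0) nOm).
pose yc i x := \sum_k Q i k * crd k x + - (\sum_k Q i k * crd k x0).
have ycE i x : (Q *m (vec_of x - vec_of x0)) i 0 = yc i x.
  rewrite mxE /yc -sumrN -big_split; apply: eq_bigr => k _.
  by rewrite (_ : (vec_of x - vec_of x0) k 0 = crd k x - crd k x0) ?mulrDr ?mulrN// /crd !mxE.
have yc0 i : yc i x0 = 0 by rewrite /yc subrr.
have cyc i : continuous (yc i) by exact: continuous_affine.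
(* In the local frame [x0] is the origin; being outside [Om], it is not above the graph. *)
have g0 : 0 <= g (0, 0).
  rewrite leNgt; apply/negP => h; apply: nOm.
  by have [_] := nbhs_singleton nx; rewrite !ycE !yc0; apply.
(* The point at depth [t] under [x0]. Since [Om] lies above the graph, this point ought to be away
   from [closure Om], yet for small [t] it belongs to [V]. *)
pose xt (t : R) := pt_of (vec_of x0 - t *: (Q^T *m delta_mx (2%:R : 'I_3) 0)).
have ycxt i t : yc i (xt t) = if i == 2%:R then - t else 0.
  rewrite -ycE /xt vec_of_pt_of addrAC subrr sub0r mulmxN -scalemxAr mulmxA QQ mul1mx.
  by rewrite !mxE eqxx andbT; case: eqP => _; rewrite ?mulr1 ?mulr0 ?oppr0.
have cxt : {for (0 : R), continuous xt}.
  apply: continuous_pt_of => i; rewrite (_ : (fun s => _) =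
    fun s : R => vec_of x0 i 0 - s * (Q^T *m delta_mx (2%:R : 'I_3) 0 : vec R) i 0).
    apply: cvgB; first exact: cvg_cst.
    by apply: cvgM; [exact: cvg_id|exact: cvg_cst].
  by apply/funext => s; rewrite !mxE.
have xt0 : xt 0 = x0.
  by apply: crd_inj => i; rewrite /xt scale0r subr0 crd_pt_of.
pose N := [set x | Om x <-> g (yc 0 x, yc 1 x) < yc 2%:R x].
have nN : nbhs x0 N.
  by apply: filterS nx => x; rewrite /N /= !ycE.
have nVN : nbhs x0 (V `&` N^°).
  apply: filterI; first by move: oV; rewrite openE; exact.
  exact: nbhs_interior.
have : \forall t \near (0 : R), (V `&` N^°) (xt t) by apply: cxt; rewrite xt0.
move=> /nbhs_ballP[e /= e0 he].
pose t := e / 2.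
have t0 : 0 < t by rewrite divr_gt0.
have [Vt Nt] : (V `&` N^°) (xt t).
  by apply: he; rewrite /ball /= sub0r normrN gtr0_norm// /t; lra.
(* With horizontal coordinates below [delta], the Lipschitz bound keeps the graph above - t / 2,
   while the height stays below - t / 2: no such point is in [Om]. Adding 1 to the norm of [L] keeps
   the denominator positive. *)
pose delta := t / (2 * (`|L| + 1)).
have L1 : 0 < `|L| + 1 by rewrite ltr_wpDl.
have d0 : 0 < delta by rewrite divr_gt0// mulr_gt0.
have n0 i : i != 2%:R -> \forall x \near xt t, `|yc i x| < delta.
  move=> i2; have : yc i x @[x --> xt t] --> (0 : R).
    have <- : yc i (xt t) = 0 by rewrite ycxt (negbTE i2).
    exact: cyc.
  by move=> /cvgr0Pnorm_lt; exact.
have n2 : \forall x \near xt t, yc 2%:R x < - (t / 2).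
  have : yc 2%:R (xt t) < - (t / 2) by rewrite ycxt eqxx; lra.
  by move=> h; apply: (cvgr_lt _ (cyc 2%:R (xt t))).
have := Vcl _ Vt; move=> /(_ [set x | N x /\ `|yc 0 x| < delta /\ `|yc 1 x| < delta /\ yc 2%:R x <
    - (t / 2)]).
case.
  apply: filterI; first exact: Nt.
  by apply: filterI; [exact: n0|apply: filterI; [exact: n0|exact: n2]].
move=> x [Omx [Nx [h0 [h1 h2]]]].
have gx := Nx.1 Omx.
have /= := gL ((0, 0), (yc 0 x, yc 1 x)) (conj I I).
rewrite prod_normE /= !sub0r !normrN => hg.
have hm : Num.max `|yc 0 x| `|yc 1 x| <= delta by rewrite ge_max !ltW.
have hL : L * Num.max `|yc 0 x| `|yc 1 x| <= (`|L| + 1) * delta.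
  apply: (@le_trans _ _ ((`|L| + 1) * Num.max `|yc 0 x| `|yc 1 x|)).
    by rewrite ler_wpM2r ?le_max ?normr_ge0// (le_trans (ler_norm L))// lerDl.
  by rewrite ler_wpM2l// ltW.
have dE : (`|L| + 1) * delta = t / 2 by rewrite /delta; field; rewrite gt_eqF.
have := le_trans hg hL; rewrite dE ler_norml => /andP[_].
by lra.
Qed.

End Geometry.

(** * Barycentric coordinates *)

Section Tetrahedra.
Context {R : realType}.
Local Notation mu := (leb3 R).

(** Homogeneous coordinates: affine combinations of points become linear combinations of rows, and
    barycentric coordinates are read off an inverse matrix. *)
Definition homv (x : pt R) : 'rV[R]_(3 + 1) := row_mx (vec_of x)^T 1%:M.

Lemma homv_sum (I : finType) (l : I -> R) (y : I -> pt R) (u : vec R) (s : R) :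
  \sum_i l i *: homv (y i) = row_mx u^T s%:M <->
  \sum_i l i *: vec_of (y i) = u /\ \sum_i l i = s.
Proof.
have -> : \sum_i l i *: homv (y i) = row_mx (\sum_i l i *: vec_of (y i))^T (\sum_i l i)%:M.
  apply/matrixP => p q; rewrite summxE [RHS]mxE; case: (splitP q) => k hk.
    rewrite mxE summxE; apply: eq_bigr => i _.
    rewrite mxE (_ : q = lshift 1 k) /homv ?row_mxEl; last exact/val_inj.
    by rewrite !mxE.
  rewrite mxE (ord1 p) (ord1 k) eqxx mulr1n; apply: eq_bigr => i _.
  rewrite mxE (_ : q = rshift 3 0) /homv ?row_mxEr; last by apply/val_inj; rewrite /= hk (ord1 k).
  by rewrite mxE eqxx mulr1.
split=> [/eq_row_mx[/trmx_inj -> h]|[-> ->]//].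
by split=> //; have := congr1 (fun A : 'M[R]_1 => A 0 0) h; rewrite !mxE eqxx !mulr1n.
Qed.

(** [V] is the set where all four barycentric coordinates are positive; what is missing from the
    closed tetrahedron lies in four planes. *)
Lemma tet_interior (a : tetra R) : Defs.nondegenerate a -> exists V : set (pt R),
  [/\ open V, V `<=` tet a & {ae mu, forall x, tet a x -> V x}].
Proof.
move=> nd; pose M : 'M[R]_(4, 3 + 1) := \matrix_i homv (a i).
have lM (l : 'rV[R]_4) : l *m M = \sum_i l 0 i *: homv (a i).
  by rewrite mulmx_sum_row; apply: eq_bigr => i _; rewrite rowK.
have uM : M \in unitmx.
  rewrite unitmxE unitfE; apply/det0P => -[l l0].
  rewrite lM => h; have h' : \sum_i l 0 i *: homv (a i) = row_mx (0 : vec R)^T 0%:M.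
    by rewrite h trmx0 raddf0 row_mx0.
  have [h1 h2] := (homv_sum _ _ _ _).1 h'.
  by move/eqP: l0; apply; apply/rowP => i; rewrite mxE; exact: (nd _ h2 h1).
pose Mi : 'M[R]_(3 + 1, 4) := invmx M.
pose lam (j : 'I_4) (x : pt R) : R := (homv x *m Mi) 0 j.
have lamE j x : lam j x = \sum_k Mi (lshift 1 k) j * crd k x + Mi (rshift 3 0) j.
  rewrite /lam mxE big_split_ord big_ord1 /=; congr (_ + _).
    by apply: eq_bigr => k _; rewrite /homv row_mxEl mxE mulrC.
  by rewrite /homv row_mxEr mxE eqxx mul1r.
have clam j : continuous (lam j).
  rewrite (_ : lam j = fun x => \sum_k Mi (lshift 1 k) j * crd k x + Mi (rshift 3 0) j).
    exact: continuous_affine.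
  by apply/funext => x; exact: lamE.
have lam_sub j x : tet a x -> 0 <= lam j x.
  move=> [l [l0 _ l1 lx]].
  have : (\row_i l i) *m M = homv x.
    rewrite lM; apply/homv_sum; split.
      by rewrite lx; apply: eq_bigr => i _; rewrite mxE.
    by rewrite -l1; apply: eq_bigr => i _; rewrite mxE.
  by move=> h; rewrite /lam /Mi -h mulmxK// mxE.
exists [set x | forall j, 0 < lam j x]; split.
- rewrite openE => x Vx.
  suff : \forall y \near x, forall j, 0 < lam j y by [].
  have h j : nbhs x [set y | 0 < lam j y].
    by apply: (cvgr_gt _ (clam j x)); exact: Vx.
  exact: (@filter_forall _ 'I_4 (fun j => [set y | 0 < lam j y]) (nbhs x) (nbhs_filter x) h).
- move=> x Vx; exists (lam ^~ x); split=> //.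
  + by move=> i; exact: ltW.
  + by move=> i; rewrite inE.
  + have : (homv x *m Mi) *m M = row_mx (vec_of x)^T 1%:M by rewrite /Mi mulmxKV.
    by rewrite lM => /homv_sum[_].
  + have : (homv x *m Mi) *m M = row_mx (vec_of x)^T 1%:M by rewrite /Mi mulmxKV.
    by rewrite lM => /homv_sum[].
have nz j : {ae mu, forall x, lam j x != 0}.
  (* With zero linear part the [j]-th barycentric coordinate would be constant, but it is 1 at
     vertex [j] and 0 at the others. *)
  have [k hk] : exists k, Mi (lshift 1 k) j != 0.
    apply: contrapT => /forallNP h.
    have c x y : lam j x = lam j y.
      rewrite !lamE; congr (_ + _).
      by apply: eq_bigr => k _; have /negP := h k; rewrite negbK => /eqP ->; rewrite !mul0r.
    have d i : lam j (a i) = (i == j)%:R.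
      have rM : row i M = homv (a i) by rewrite rowK.
      by rewrite /lam /Mi -rM -row_mul mulmxV// rowE mulmx1 mxE eqxx eq_sym.
    have [i ij] : exists i : 'I_4, i != j.
      by exists (if j == 0 then 1 else 0); case: (eqVneq j 0) => [->|]//; rewrite eq_sym.
    have := c (a i) (a j); rewrite !d eqxx (negbTE ij) => /eqP.
    by rewrite eq_sym oner_eq0.
  exists [set x | lam j x = 0]; split.
  - rewrite (_ : [set x | _] = lam j @^-1` [set 0])// -[X in measurable X]setTI.
    exact: (continuous_pt_measurable (clam j)).
  - rewrite (_ : [set x | _] = [set x | \sum_k Mi (lshift 1 k) j * crd k x + Mi (rshift 3 0) j =
      0]).
      exact: plane_null hk.
    by apply/seteqP; split => x /=; rewrite lamE.
  - by move=> x /= /negP; rewrite negbK => /eqP.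
have : {ae mu, forall x, forall n : nat, lam (inord n) x != 0}.
  by apply: ae_foralln => n; exact: nz.
apply: aeS => x hx tx j; rewrite lt_neqAle eq_sym.
by have := hx j; rewrite inord_val => ->; exact: lam_sub.
Qed.

End Tetrahedra.

(** * Finite element spaces *)

Section Polynomials.
Context {R : realType}.
Local Notation mp := (mpoly.mpoly 3 R).
Implicit Types (p q : mp) (P Q : pvec (R := R)) (x : pt R) (i : 'I_3).

Definition pev p x : R := mpoly.meval (fun j => vec_of x j 0) p.

Lemma peval_i P x i : peval P x i 0 = pev (P i) x.
Proof. by rewrite mxE. Qed.

Lemma pevD p q x : pev (p + q) x = pev p x + pev q x.
Proof. exact: mpoly.mevalD. Qed.
Lemma pevZ (k : R) p x : pev (k *: p) x = k * pev p x.
Proof. exact: mpoly.mevalZ. Qed.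
Lemma pevB p q x : pev (p - q) x = pev p x - pev q x.
Proof. exact: mpoly.mevalB. Qed.

Lemma pev_mono m : pev (mpoly.mpolyX R m) = prod3 (fun i t => t ^+ (m i)).
Proof. by apply/funext => x; rewrite /pev mpoly.mevalX. Qed.

Lemma is_derive_pev p i x : is_derive x (ptbasis i) (pev p) (pev (mpoly.mderiv i p) x).
Proof.
elim/mpoly.mpolyind: p => [|c m p _ _ IH].
  rewrite mpoly.mderiv0 (_ : pev 0 = cst 0); first exact: is_derive_cst.
  by apply/funext => y; rewrite /pev mpoly.meval0.
rewrite (_ : pev (c *: mpoly.mpolyX R m + p) = c *: pev (mpoly.mpolyX R m) + pev p); last first.
  by apply/funext => y; rewrite pevD pevZ.
rewrite mpoly.mderivD mpoly.mderivZ pevD pevZ; apply: is_deriveD; apply: is_deriveZ.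
rewrite mpoly.mderivX pevZ !pev_mono.
have dX n (t : R) : is_derive t (1 : R) (fun s : R => s ^+ n) (n%:R * t ^+ n.-1).
  have := @is_deriveX _ _ id n t 1 1 (is_derive_id t 1).
  by rewrite [_ *: _]mulr1 (_ : id ^+ n = fun s : R => s ^+ n)//; apply/funext => s; rewrite fctE.
apply: DeriveDef; first by apply: derivable_prod3.
rewrite -[LHS]/(pderiv i _ x) pderiv_prod3; last by move=> t; apply: ex_derive.
transitivity (prod3 (fun j => if j == i then (fun s : R => s ^+ m j)^`()%classic else fun s => s ^+
    m j)
  (upd i x (crd i x))); first by rewrite upd_crd.
transitivity ((m i)%:R * prod3 (fun j t => t ^+ (mpoly.mnm_sub m (mpoly.mnm1 i) j)) (upd i x (crd i
    x))); last first.
  by rewrite upd_crd.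
rewrite !prod3_upd eqxx derive1E.
have [_ ->] := dX (m i) (crd i x).
rewrite mpoly.mnmBE mpoly.mnm1E eqxx subn1 mulrCA; congr (_ * _); congr (_ * _).
by apply: eq_bigr => j ji; rewrite (negbTE ji) mpoly.mnmBE mpoly.mnm1E eq_sym (negbTE ji) subn0.
Qed.

Lemma continuous_pev p : continuous (pev p).
Proof.
elim/mpoly.mpolyind: p => [|c m p _ _ IH].
  rewrite (_ : pev 0 = cst 0); first exact: cst_continuous.
  by apply/funext => y; rewrite /pev mpoly.meval0.
rewrite (_ : pev (c *: mpoly.mpolyX R m + p) = fun x => c * pev (mpoly.mpolyX R m) x + pev p x);
    last first.
  by apply/funext => y; rewrite pevD pevZ.
move=> x; apply: cvgD; last exact: IH.
apply: cvgM; first exact: cvg_cst.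
by rewrite pev_mono; apply: continuous_prod3 => i; exact: exprn_continuous.
Qed.

Lemma pderiv_pev p i : pderiv i (pev p) = pev (mpoly.mderiv i p).
Proof. by apply/funext => x; have [_] := is_derive_pev p i x. Qed.

Lemma Ck_pev m p : Ck m (pev p).
Proof.
elim: m p => [|m IH] p; split=> //; try exact: continuous_pev.
move=> i; split; first by move=> x; have [] := is_derive_pev p i x.
by rewrite pderiv_pev; exact: IH.
Qed.

Lemma msize_mderiv p i n : (mpoly.msize p <= n.+1)%N -> (mpoly.msize (mpoly.mderiv i p) <= n)%N.
Proof.
move=> hp; rewrite mpoly.mmeasureE; apply/bigmax_leqP_seq => m hm _.
have : mpoly.mnm_add m (mpoly.mnm1 i) \in mpoly.msupp p.
  rewrite mpoly.mcoeff_msupp; move: hm; rewrite mpoly.mcoeff_msupp mpoly.mcoeff_mderiv.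
  by apply: contraNneq => ->; rewrite mul0rn.
move/mpoly.msize_mdeg_lt; rewrite mpoly.mdegD mpoly.mdeg1 addn1 => h.
by have := leq_trans h hp; rewrite ltnS.
Qed.

Definition pcurl P : pvec (R := R) := fun i =>
  mpoly.mderiv (i + 1) (P (i + 2%:R)) - mpoly.mderiv (i + 2%:R) (P (i + 1)).

Lemma scurl_peval P : scurl (peval P) = peval (pcurl P).
Proof.
apply/funext => x; apply/matrixP => i j; rewrite (ord1 j) !mxE.
have e k : (fun y => peval P y k 0) = pev (P k) by apply/funext => y; rewrite peval_i.
by rewrite !e !pderiv_pev -pevB.
Qed.

Definition plin (k : R) P Q : pvec (R := R) := fun i => k *: P i + Q i.

Lemma peval_plin k P Q : peval (plin k P Q) = k *: peval P + peval Q.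
Proof. by apply/funext => x; apply/matrixP => i j;
    rewrite !mxE /plin mpoly.mevalD mpoly.mevalZ. Qed.

Lemma Pk_lin n k P Q : Pk n P -> Pk n Q -> Pk n (plin k P Q).
Proof.
move=> hP hQ i; apply: leq_trans (mpoly.msizeD_le _ _) _; rewrite geq_max hQ andbT.
exact: leq_trans (mpoly.msizeZ_le _ _) (hP i).
Qed.

Lemma homog_lin n (k : R) p q : p \is mpoly.ishomog1 n mpoly.mdeg -> q \is mpoly.ishomog1 n
    mpoly.mdeg ->
  k *: p + q \is mpoly.ishomog1 n mpoly.mdeg.
Proof. by move=> hp hq; apply: rpredD => //; exact: rpredZ. Qed.

Lemma homog_msize n p : p \is mpoly.ishomog1 n mpoly.mdeg -> (mpoly.msize p <= n.+1)%N.
Proof.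
move=> /allP hp; rewrite mpoly.mmeasureE; apply/bigmax_leqP_seq => m hm _.
by have /eqP -> := hp m hm.
Qed.

Lemma nedelec_lin n k P Q : nedelec n P -> nedelec n Q -> nedelec n (plin k P Q).
Proof.
move=> [A [S [hA hS xS PE]]] [A' [S' [hA' hS' xS' QE]]].
exists (plin k A A'), (plin k S S'); split.
- exact: Pk_lin.
- by move=> i; exact: homog_lin.
- under eq_bigr do rewrite mulrDr -scalerAr.
  by rewrite big_split /= -scaler_sumr xS xS' scaler0 addr0.
- by move=> i; rewrite /plin PE QE scalerDr addrACA.
Qed.

Lemma raviart_thomas_lin n k P Q :
  raviart_thomas n P -> raviart_thomas n Q -> raviart_thomas n (plin k P Q).
Proof.
move=> [A [b [hA hb PE]]] [A' [b' [hA' hb' QE]]].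
exists (plin k A A'), (k *: b + b'); split.
- exact: Pk_lin.
- exact: homog_lin.
- by move=> i; rewrite /plin PE QE scalerDr mulrDr scalerAr addrACA.
Qed.

Lemma nedelec0 n : nedelec (R := R) n (fun=> 0).
Proof.
exists (fun=> 0), (fun=> 0); split.
- by move=> i; rewrite mpoly.msize0.
- by move=> i; exact: rpred0.
- by rewrite big1// => i _; rewrite mulr0.
- by move=> i; rewrite addr0.
Qed.

Lemma raviart_thomas0 n : raviart_thomas (R := R) n (fun=> 0).
Proof.
exists (fun=> 0), 0; split.
- by move=> i; rewrite mpoly.msize0.
- exact: rpred0.
- by move=> i; rewrite mulr0 addr0.
Qed.

Lemma nedelec_msize n P i : nedelec n P -> (mpoly.msize (P i) <= n.+2)%N.
Proof.
move=> [A [S [hA hS _ ->]]]; apply: leq_trans (mpoly.msizeD_le _ _) _.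
by rewrite geq_max (leq_trans (hA i))//= homog_msize.
Qed.

Lemma raviart_thomas_msize n P i : raviart_thomas n P -> (mpoly.msize (P i) <= n.+2)%N.
Proof.
move=> [A [b [hA hb ->]]]; apply: leq_trans (mpoly.msizeD_le _ _) _.
rewrite geq_max (leq_trans (hA i))//= homog_msize//.
have -> : n.+1 = (1 + n)%N by [].
apply: mpoly.dhomogM => //.
by rewrite mpoly.dhomogX /= mpoly.mdeg1.
Qed.

(** Nedelec polynomials have degree at most n + 1, so the curl has degree at most n and already lies
    in the full polynomial part. *)
Lemma raviart_thomas_pcurl n P : nedelec n P -> raviart_thomas n (pcurl P).
Proof.
move=> hP; exists (pcurl P), 0; split.
- move=> i; rewrite /pcurl -scaleN1r addrC; apply: (@Pk_lin n (-1) (fun=> _) (fun=> _) _ _ 0) => _;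
    by apply: msize_mderiv; exact: nedelec_msize.
- exact: rpred0.
- by move=> i; rewrite mulr0 addr0.
Qed.

Lemma peval0 : peval (fun=> 0 : mp) = 0 :> field R.
Proof. by apply/funext => x; apply/matrixP => i j; rewrite !mxE mpoly.meval0. Qed.

(** Vector polynomials given by finite tables of coefficients; these tables are the coordinates
    behind finite dimensionality. *)
Definition ptab d (c : 'I_3 -> mpoly.bmultinom 3 d -> R) : field R :=
  fun x => \col_i \sum_m c i m * pev (mpoly.mpolyX R (mpoly.bmnm m)) x.

Lemma peval_ptab d P : (forall i, mpoly.msize (P i) <= d)%N ->
  peval P = ptab (fun i (m : mpoly.bmultinom 3 d) => mpoly.mcoeff (mpoly.bmnm m) (P i)).
Proof.
move=> hP; apply/funext => x; apply/matrixP => i j; rewrite !mxE.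
rewrite {1}(mpoly.mpolywE (hP i)) raddf_sum /=.
by apply: eq_bigr => m _; rewrite mpoly.mevalZ.
Qed.

End Polynomials.

(** * Nedelec and Raviart-Thomas fields on the mesh *)

Section DiscreteSpaces.
Context {R : realType}.
Local Notation mu := (leb3 R).
Implicit Types (u v w : field R) (i j l : 'I_3).

Lemma ord3D : (((0 + 1)%R = 1%R :> 'I_3) * ((0 + 2%:R)%R = 2%:R%R :> 'I_3) *
  ((1 + 1)%R = 2%:R%R :> 'I_3) * ((1 + 2%:R)%R = 0%R :> 'I_3) *
  ((2%:R + 1)%R = 0%R :> 'I_3) * ((2%:R + 2%:R)%R = 1%R :> 'I_3))%type.
Proof. by do !split; exact/val_inj. Qed.

Lemma Rintegral_sum3 (V : set (pt R)) (F : 'I_3 -> pt R -> R) :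
  measurable (V : set (P3 R)) -> (forall i, mu.-integrable V (EFin \o F i)) ->
  \int[mu]_(x in V) (\sum_i F i x) = \sum_i \int[mu]_(x in V) F i x.
Proof.
move=> mV hF; rewrite sum3E.
have -> : (fun x => \sum_i F i x) = (fun x => F 0 x + F 1 x + F 2%:R x).
  by apply/funext => x; rewrite sum3E.
have h01 : mu.-integrable V (EFin \o (fun x => F 0 x + F 1 x)).
  by apply: eq_integrable (integrableD mV (hF 0) (hF 1)).
by rewrite (RintegralD mV h01 (hF 2%:R)) (RintegralD mV (hF 0) (hF 1)).
Qed.

(** Componentwise integration by parts; the two sums agree after a cyclic shift of the indices
    modulo 3. *)
Lemma ip_scurl (V : set (pt R)) u (phi : field R) : open V -> bounded_set V ->
  (forall i, Ck 1 (fun x => u x i 0)) -> testv V phi ->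
  ip V u (scurl phi) = ip V (scurl u) phi.
Proof.
move=> oV bV Cu tphi.
have mV : measurable (V : set (P3 R)) := open_pt_measurable oV.
pose U i : pt R -> R := fun x => u x i 0.
pose F i : pt R -> R := fun x => phi x i 0.
have cU i : continuous (U i) := Ck_continuous (Cu i).
have cF i : continuous (F i) := test_continuous (tphi i).
have cdU j i : continuous (pderiv j (U i)) := Ck_continuous (Ck_pderiv j (Cu i)).
have cdF j i : continuous (pderiv j (F i)) := test_continuous (test_pderiv j (tphi i)).
have int (f g : pt R -> R) : continuous f -> continuous g ->
    mu.-integrable V (EFin \o (fun x => f x * g x)).
  move=> cf cg; apply: (L2s_integrable oV bV); apply: (L2s_continuous oV bV) => x.
  by apply: cvgM; [exact: cf|exact: cg].
pose I i j l := \int[mu]_(x in V) (U i x * pderiv j (F l) x).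
have parts i j l : \int[mu]_(x in V) (pderiv j (U i) x * F l x) = - I i j l.
  exact: (integration_by_parts j (Cu i) (tphi l)).
have e1 : ip V u (scurl phi) = \sum_i (I i (i + 1) (i + 2%:R) - I i (i + 2%:R) (i + 1)).
  rewrite /ip (_ : (fun x => dot (u x) (scurl phi x)) = fun x => \sum_i
     (U i x * pderiv (i + 1) (F (i + 2%:R)) x - U i x * pderiv (i + 2%:R) (F (i + 1)) x));
         last first.
    by apply/funext => x; apply: eq_bigr => i _; rewrite /scurl mxE mulrBr.
  rewrite (@Rintegral_sum3 V (fun i x => U i x * pderiv (i + 1) (F (i + 2%:R)) x - U i x * pderiv
      (i + 2%:R) (F (i + 1)) x)) //.
    by apply: eq_bigr => i _; rewrite (RintegralB mV (int _ _ (cU i) (cdF _ _)) (int _ _ (cU i)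
        (cdF _ _))).
  by move=> i; apply: eq_integrable (integrableB mV (int _ _ (cU i) (cdF (i + 1) (i + 2%:R))) (int
      _ _ (cU i) (cdF (i + 2%:R) (i + 1)))).
have e2 : ip V (scurl u) phi = \sum_i (- I (i + 2%:R) (i + 1) i + I (i + 1) (i + 2%:R) i).
  rewrite /ip (_ : (fun x => dot (scurl u x) (phi x)) = fun x => \sum_i
     (pderiv (i + 1) (U (i + 2%:R)) x * F i x - pderiv (i + 2%:R) (U (i + 1)) x * F i x));
         last first.
    by apply/funext => x; apply: eq_bigr => i _; rewrite /scurl mxE mulrBl.
  rewrite (@Rintegral_sum3 V (fun i x => pderiv (i + 1) (U (i + 2%:R)) x * F i x - pderiv (i +
      2%:R) (U (i + 1)) x * F i x)) //.
    apply: eq_bigr => i _; rewrite (RintegralB mV (int _ _ (cdU _ _) (cF i)) (int _ _ (cdU _ _) (cF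
        i))).
    by rewrite (parts (i + 2%:R)) (parts (i + 1)) opprK.
  by move=> i; apply: eq_integrable (integrableB mV (int _ _ (cdU (i + 1) (i + 2%:R)) (cF i)) (int
      _ _ (cdU (i + 2%:R) (i + 1)) (cF i))).
rewrite e1 e2; clear; clearbody I; rewrite !sum3E.
rewrite !ord3D.
ring.
Qed.

Variables (Om : set (pt R)) (Th : set (tetra R)) (k : nat).
Hypotheses (hOm : bounded_lipschitz_domain Om) (hTh : is_mesh Om Th).

Let oOm : open Om. Proof. by case: hOm. Qed.
Let bOm : bounded_set Om. Proof. by case: hOm. Qed.
Let mOm : measurable (Om : set (P3 R)) := open_pt_measurable oOm.

Lemma aeeq_lin (A : set (pt R)) (s : R) u u' v v' :
  aeeq A u u' -> aeeq A v v' -> aeeq A (s *: u + v) (s *: u' + v').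
Proof. by move=> h1 h2; apply: aeeqD => //; exact: aeeqZ. Qed.

Lemma Nh_lin (s : R) u v : Nh Om Th k u -> Nh Om Th k v -> Nh Om Th k (s *: u + v).
Proof.
move=> [hu pu] [hv pv]; split; first exact: Hcurl_lin.
move=> a Ta; have [P [nP eP]] := pu a Ta; have [Q [nQ eQ]] := pv a Ta.
exists (plin s P Q); split; first exact: nedelec_lin.
by rewrite peval_plin; exact: aeeq_lin.
Qed.

Lemma Nh_0 : Nh Om Th k 0.
Proof.
split; first exact: Hcurl0.
move=> a Ta; exists (fun=> 0); split; first exact: nedelec0.
by rewrite peval0; exact: aeeq_refl.
Qed.

Lemma cross_lin (s : R) (a b n : vec R) : cross (s *: a + b) n = s *: cross a n + cross b n.
Proof. by apply/matrixP => i j; rewrite !mxE; ring. Qed.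

Lemma Nh0_lin (s : R) u v : Nh0 Om Th k u -> Nh0 Om Th k v -> Nh0 Om Th k (s *: u + v).
Proof.
move=> [hu pu] [hv pv]; split; first exact: Nh_lin.
move=> a Ta; have [P [nP eP bP]] := pu a Ta; have [Q [nQ eQ bQ]] := pv a Ta.
exists (plin s P Q); split; first exact: nedelec_lin.
  by rewrite peval_plin; exact: aeeq_lin.
move=> i fi x nu fx onx; rewrite peval_plin cross_lin.
by rewrite (bP i fi x nu fx onx) (bQ i fi x nu fx onx) scaler0 addr0.
Qed.

Lemma Nh0_0 : Nh0 Om Th k 0.
Proof.
split; first exact: Nh_0.
move=> a Ta; exists (fun=> 0); split; first exact: nedelec0.
  by rewrite peval0; exact: aeeq_refl.
move=> i _ x nu _ _; rewrite peval0.
by apply/matrixP => p q; rewrite !mxE !mul0r subrr.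
Qed.

Lemma RTh_lin (s : R) u v : RTh Om Th k u -> RTh Om Th k v -> RTh Om Th k (s *: u + v).
Proof.
move=> [hu pu] [hv pv]; split; first exact: Hdiv_lin.
move=> a Ta; have [P [nP eP]] := pu a Ta; have [Q [nQ eQ]] := pv a Ta.
exists (plin s P Q); split; first exact: raviart_thomas_lin.
by rewrite peval_plin; exact: aeeq_lin.
Qed.

Lemma RTh_0 : RTh Om Th k 0.
Proof.
split; first exact: Hdiv0.
move=> a Ta; exists (fun=> 0); split; first exact: raviart_thomas0.
by rewrite peval0; exact: aeeq_refl.
Qed.

Lemma ip_subdomain (V : set (pt R)) u v : V `<=` Om -> (forall x, ~ V x -> v x = 0) ->
  ip Om u v = ip V u v.
Proof.
move=> VOm v0; rewrite /ip /Rintegral; congr fine.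
rewrite -[V in RHS](setIidr VOm) integral_mkcondr; apply: eq_integral => x _.
rewrite patchE; case: ifPn => //; rewrite notin_setE => /v0 ->.
by rewrite /dot big1// => i _; rewrite mxE mulr0.
Qed.

Lemma testv_scurl_out (V : set (pt R)) (phi : field R) : testv V phi ->
  forall x, ~ V x -> scurl phi x = 0.
Proof.
move=> tphi x Vx; apply/matrixP => i j; rewrite !mxE.
by rewrite !(test_out (test_pderiv _ (tphi _)) Vx) subrr.
Qed.

Lemma testv_sub (V : set (pt R)) (phi : field R) : V `<=` Om -> testv V phi -> testv Om phi.
Proof.
move=> VOm tphi i; have [h [K [cK KV f0]]] := tphi i.
by split=> //; exists K; split=> //; exact: subset_trans VOm.
Qed.

Lemma bounded_subset (V : set (pt R)) : V `<=` Om -> bounded_set V.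
Proof.
move=> VOm; have [M [Mr h]] := bOm; exists M; split=> // y hy x Vx.
exact: (h y hy x (VOm _ Vx)).
Qed.

(* Test fields supported in the interior of the element suffice, since its
   boundary is a null set. *)
Lemma curl_tet (a : tetra R) v P : Th a -> Hcurl Om v -> aeeq (tet a) v (peval P) ->
  aeeq (tet a) (curl Om v) (peval (pcurl P)).
Proof.
move=> Ta hv eP; have [_ _ _ _ lip] := hOm; have [_ nd cl _] := hTh.
have [V [oV Vtet aeV]] := tet_interior (nd a Ta).
have VOm : V `<=` Om.
  apply: (interior_lipschitz lip oV) => x Vx; rewrite cl; exists a => //; exact: Vtet.
have [cL wc] := curlP hv; have vL := hv.1.
have pL Q : L2v Om (peval Q).
  move=> i; apply: (L2s_continuous oOm bOm).
  by rewrite (_ : (fun x => _) = pev (Q i)) ?peval_i//; [exact: continuous_pev|apply/funext => x;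
      rewrite peval_i].
have h : aeeq V (curl Om v - peval (pcurl P)) 0.
  apply: (L2v_orth_tests oOm bOm oV VOm); first exact: L2vB.
  move=> phi tV; have tO := testv_sub VOm tV.
  have hphi := testv_L2v oOm bOm tO; have hcphi := testv_scurl_L2v oOm bOm tO.
  rewrite -scaleN1r (ipDl mOm)//; last exact: L2vZ.
  rewrite (ipZl mOm)// mulN1r -wc//.
  have phi0 x : ~ V x -> phi x = 0.
    by move=> Vx; apply/matrixP => i j; rewrite (ord1 j) (test_out (tV i) Vx) mxE.
  rewrite (ip_subdomain v VOm (testv_scurl_out tV)) (ip_subdomain _ VOm phi0).
  rewrite -scurl_peval -ip_scurl//; last 2 first.
  - exact: bounded_subset.
  - move=> i; rewrite (_ : (fun x => _) = pev (P i)); first exact: Ck_pev.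
    by apply/funext => x; rewrite peval_i.
  have mV : measurable (V : set (P3 R)) := open_pt_measurable oV.
  have LV w : L2v Om w -> L2v V w.
    move=> hw i; apply/(L2sP mV); have [m1 i1] := (L2sP mOm _).1 (hw i).
    split; first exact: measurable_funS m1.
    by apply: integrableS i1.
  have aePV : aeeq V v (peval P) by apply: aeS eP => x h /Vtet /h.
  by rewrite (ip_ael mV (LV _ vL) (LV _ (pL P)) (LV _ hcphi) aePV) subrr.
apply: aeS2 aeV h => x h1 h2 tx.
by apply/eqP; rewrite -subr_eq0; apply/eqP; exact: (h2 (h1 tx)).
Qed.

(** Conformity in [Hdiv] takes no argument on faces: the curl has weak divergence zero on the whole
    domain. *)
Lemma curl_RTh v : Nh Om Th k v -> RTh Om Th k (curl Om v).
Proof.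
move=> [hv pv]; have [cL wc] := curlP hv; split.
  split=> //; exists (cst 0); split; first exact: L2s0.
  exact: (weak_div_curl oOm bOm hv.1 cL wc).
move=> a Ta; have [P [nP eP]] := pv a Ta; exists (pcurl P); split.
  exact: raviart_thomas_pcurl.
exact: curl_tet.
Qed.

End DiscreteSpaces.

(** * Bilinear forms on spaces of finite dimension modulo null elements *)

Section FiniteDimension.
Context {R : realFieldType}.

(* [S] is finite dimensional modulo [N]: its elements have coordinate vectors,
   linearly, and a vanishing coordinate vector forces membership in [N]. *)
Definition findim (V : lmodType R) (S N : set V) : Prop :=
  exists (M : nat) (Rep : V -> 'rV[R]_M -> Prop),
  [/\ forall s u v c d, Rep u c -> Rep v d -> Rep (s *: u + v) (s *: c + d),
      forall v, S v -> exists c, Rep v c & forall v, Rep v 0 -> N v].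

Lemma findim_sub (V : lmodType R) (S S' N : set V) : S' `<=` S -> findim S N -> findim S' N.
Proof. by move=> SS [M [Rep [h1 h2 h3]]]; exists M, Rep; split=> // v /SS; exact: h2. Qed.

Lemma findim_prod (V W : lmodType R) (S N : set V) (S' N' : set W) :
  findim S N -> findim S' N' -> findim (S `*` S') (N `*` N').
Proof.
move=> [M [Rep [h1 h2 h3]]] [M' [Rep' [h1' h2' h3']]].
exists (M + M')%N, (fun v c => Rep v.1 (lsubmx c) /\ Rep' v.2 (rsubmx c)); split.
- move=> s u v c d [c1 c2] [d1 d2]; split.
  + by rewrite [lsubmx _]linearP; exact: h1.
  + by rewrite [rsubmx _]linearP; exact: h1'.
- move=> [v w] /= [/h2[c hc] /h2'[c' hc']]; exists (row_mx c c').
  by rewrite row_mxKl row_mxKr.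
- by move=> [v w] /= [+ +]; rewrite !linear0 => /h3 ? /h3'.
Qed.

Variables (V : lmodType R) (S N : set V) (a : V -> V -> R).
Hypotheses (S0 : S 0) (Slin : forall s u v, S u -> S v -> S (s *: u + v)).
Hypothesis (Nlin : forall s v, N v -> N (s *: v)).
Hypothesis (fd : findim S N).
Hypothesis (al : forall s u v w, S u -> S v -> S w -> a (s *: u + v) w = s * a u w + a v w).
Hypothesis (ar : forall s u v w, S u -> S v -> S w -> a w (s *: u + v) = s * a w u + a w v).
Hypothesis (aN : forall v w, S v -> S w -> N v -> a v w = 0 /\ a w v = 0).
Hypothesis (nondeg : forall v, S v -> (forall w, S w -> a v w = 0) -> N v).

Let Ssum n (c : 'I_n -> R) (b : 'I_n -> V) : (forall i, S (b i)) -> S (\sum_i c i *: b i).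
Proof.
move=> Sb; elim/big_rec: _ => // i x _ Sx; exact: Slin.
Qed.

Let Fsum (F : V -> R) n (c : 'I_n -> R) (b : 'I_n -> V) :
  (forall s u v, S u -> S v -> F (s *: u + v) = s * F u + F v) ->
  (forall i, S (b i)) -> F (\sum_i c i *: b i) = \sum_i c i * F (b i).
Proof.
move=> Flin Sb.
have F0 : F 0 = 0.
  by have := Flin (-1) 0 0 S0 S0; rewrite scaler0 addr0 mulN1r addNr.
suff : S (\sum_i c i *: b i) /\ F (\sum_i c i *: b i) = \sum_i c i * F (b i) by case.
elim/big_rec2: _ => [//|i x y _ [Sy <-]].
by split; [exact: Slin|rewrite Flin].
Qed.

Definition independent n := exists b : 'I_n -> V, (forall i, S (b i)) /\
  forall c : 'rV[R]_n, N (\sum_i c 0 i *: b i) -> c = 0.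

(** With more elements than coordinates, the matrix of coordinate rows has a nonzero left kernel
    vector. The corresponding combination is represented by 0 and so lies in [N]. *)
Lemma independent_bound : exists M, forall n, independent n -> (n <= M)%N.
Proof.
have [M [Rep [h1 h2 h3]]] := fd; exists M => n [b [Sb ib]].
have /choice[c hc] : forall i, exists c : 'rV[R]_M, Rep (b i) c by move=> i; exact: h2.
have Rep0 : Rep 0 0.
  have [d hd] := h2 _ S0; have := h1 (-1) _ _ _ _ hd hd.
  by rewrite !scaleN1r !addNr.
pose C := \matrix_i c i.
rewrite leqNgt; apply/negP => Mn.
have : kermx C != 0.
  rewrite kermx_eq0 /row_free; apply: contraTneq Mn => rC.
  by rewrite -leqNgt -rC rank_leq_col.
move=> /rowV0Pn[x /sub_kermxP xC /eqP x0]; apply: x0; apply: ib; apply: h3.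
rewrite -xC mulmx_sum_row.
elim/big_rec2: _ => // i y1 y2 _ hy; rewrite rowK.
exact: h1.
Qed.

(** A family of maximal size: adjoining [v] creates a relation modulo [N], in which the coefficient
    of [v] cannot vanish by independence of the others. *)
Lemma basis_mod : exists n (b : 'I_n -> V), [/\ forall i, S (b i),
  forall c : 'rV[R]_n, N (\sum_i c 0 i *: b i) -> c = 0 &
  forall v, S v -> exists (t : R) (x : 'rV[R]_n), t != 0 /\ N (t *: v + \sum_i x 0 i *: b i)].
Proof.
have [M hM] := independent_bound.
have i0 : exists n, `[< independent n >].
  exists 0%N; apply/asboolP; exists (fun=> 0); split=> // c _.
  by apply/rowP => -[].
have i1 n : `[< independent n >] -> (n <= M)%N by move=> /asboolP; exact: hM.
case: (ex_maxnP i0 i1) => n /asboolP[b [Sb ib]] max; exists n, b; split=> // v Sv.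
apply: contrapT => h.
suff : (n + 1 <= n)%N by rewrite addn1 ltnn.
apply: max; apply/asboolP.
exists (fun i : 'I_(n + 1) => match fintype.split i with inl j => b j | inr _ => v end); split.
  by move=> i; case: (fintype.split i).
move=> c; rewrite big_split_ord big_ord1 /=.
rewrite (_ : fintype.split (rshift n 0) = inr 0); last by rewrite (unsplitK (inr 0)).
under eq_bigr => i _ do rewrite (_ : fintype.split (lshift 1 i) = inl i) ?(unsplitK (inl i))//.
have [t0|t0] := eqVneq (c 0 (rshift n 0)) 0.
  rewrite t0 scale0r addr0 => hN.
  have := ib (lsubmx c); under eq_bigr do rewrite mxE.
  move=> /(_ hN) l0; apply/rowP => i; rewrite mxE.
  case: (splitP i) => j hj.
    have -> : i = lshift 1 j by exact/val_inj.
    by have := congr1 (fun m : 'rV_n => m 0 j) l0; rewrite !mxE.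
  by have -> : i = rshift n 0 by apply/val_inj; rewrite /= hj (ord1 j).
move=> hN; exfalso; apply: h; exists (c 0 (rshift n 0)), (lsubmx c); split=> //.
by under eq_bigr do rewrite mxE; rewrite addrC.
Qed.

(** On a basis modulo [N] the form is a square matrix. Nondegeneracy on one side makes it injective,
    hence invertible; its transpose then gives nondegeneracy on the other side, and inverting either
    one solves the two linear problems. *)
Lemma findim_nondegenerate_solve :
  [/\ forall v, S v -> (forall w, S w -> a w v = 0) -> N v,
      forall F : V -> R, (forall s u v, S u -> S v -> F (s *: u + v) = s * F u + F v) ->
        (forall v, S v -> N v -> F v = 0) -> exists u, S u /\ forall w, S w -> a u w = F w &
      forall F : V -> R, (forall s u v, S u -> S v -> F (s *: u + v) = s * F u + F v) ->
        (forall v, S v -> N v -> F v = 0) -> exists u, S u /\ forall w, S w -> a w u = F w].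
Proof.
have [n [b [Sb ib span]]] := basis_mod.
pose A : 'M[R]_n := \matrix_(i, j) a (b i) (b j).
have Sx (x : 'rV[R]_n) : S (\sum_i x 0 i *: b i) by exact: Ssum.
have asuml (x : 'rV[R]_n) w : S w -> a (\sum_i x 0 i *: b i) w = \sum_i x 0 i * a (b i) w.
  by move=> Sw; rewrite (Fsum (F := a^~ w))// => s u v Su Sv; exact: al.
have asumr (x : 'rV[R]_n) w : S w -> a w (\sum_i x 0 i *: b i) = \sum_i x 0 i * a w (b i).
  by move=> Sw; rewrite (Fsum (F := a w))// => s u v Su Sv; exact: ar.
(* Linear functionals that vanish on [N] are determined by their values on the basis. *)
have ext (F G : V -> R) : (forall s u v, S u -> S v -> F (s *: u + v) = s * F u + F v) ->
    (forall v, S v -> N v -> F v = 0) ->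
    (forall s u v, S u -> S v -> G (s *: u + v) = s * G u + G v) ->
    (forall v, S v -> N v -> G v = 0) -> (forall i, F (b i) = G (b i)) ->
    forall w, S w -> F w = G w.
  move=> Fl FN Gl GN FG w Sw; have [t [x [t0 hN]]] := span w Sw.
  have St := Slin t Sw (Sx x).
  have := FN _ St hN; rewrite Fl// (Fsum _ Fl)//.
  have := GN _ St hN; rewrite Gl// (Fsum _ Gl)//.
  have -> : \sum_i x 0 i * F (b i) = \sum_i x 0 i * G (b i) by apply: eq_bigr => i _; rewrite FG.
  by move=> h1 h2; apply: (mulfI t0); apply: (addIr (\sum_i x 0 i * G (b i))); rewrite h1 h2.
have uA : A \in unitmx.
  rewrite unitmxE unitfE; apply/det0P => -[x /eqP x0 xA]; apply: x0; apply: ib.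
  apply: nondeg => // w Sw.
  apply: (ext (a (\sum_i x 0 i *: b i)) (fun=> 0)) => //.
  - by move=> s u v Su Sv; exact: ar.
  - by move=> v Sv Nv; have [] := aN Sv (Sx x) Nv.
  - by move=> *; rewrite mulr0 addr0.
  - move=> j; rewrite asuml//; have := congr1 (fun m : 'rV_n => m 0 j) xA; rewrite !mxE => xAj.
    by rewrite -[RHS]xAj; apply: eq_bigr => i _; rewrite mxE.
split.
- move=> v Sv hv; have [t [x [t0 hN]]] := span v Sv.
  have x0 : x = 0.
    suff : x *m A^T = 0 by move=> h; rewrite -(mulmxK (_ : A^T \in unitmx) x) ?h ?mul0mx//
        unitmx_tr.
    apply/rowP => j; rewrite !mxE.
    have := (aN (Slin t Sv (Sx x)) (Sb j) hN).2; rewrite ar// hv// mulr0 add0r asumr// => h.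
    by rewrite -[RHS]h; apply: eq_bigr => i _; rewrite !mxE.
  move: hN; rewrite x0; under eq_bigr do rewrite mxE scale0r.
  rewrite big1 ?addr0 // => /(Nlin t^-1).
  by rewrite scalerA mulVf// scale1r.
- move=> F Fl FN; pose y : 'rV[R]_n := \row_j F (b j).
  exists (\sum_i (y *m invmx A) 0 i *: b i); split=> // w Sw.
  apply: (ext (a _) F) => //.
  + by move=> s u v Su Sv; exact: ar.
  + by move=> v Sv Nv; have [] := aN Sv (Sx (y *m invmx A)) Nv.
  + move=> j; rewrite asuml//; transitivity (((y *m invmx A) *m A) 0 j).
      by rewrite [RHS]mxE; apply: eq_bigr => i _; rewrite [A i j]mxE.
    by rewrite mulmxKV// mxE.
- move=> F Fl FN; pose y : 'rV[R]_n := \row_j F (b j).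
  have uAT : A^T \in unitmx by rewrite unitmx_tr.
  exists (\sum_i (y *m invmx A^T) 0 i *: b i); split=> // w Sw.
  apply: (ext (a ^~ _) F) => //.
  + by move=> s u v Su Sv; exact: al.
  + by move=> v Sv Nv; have [] := aN Sv (Sx (y *m invmx A^T)) Nv.
  + move=> j; rewrite asumr//; transitivity (((y *m invmx A^T) *m A^T) 0 j).
      by rewrite [RHS]mxE; apply: eq_bigr => i _; rewrite [A^T i j]mxE [A j i]mxE.
    by rewrite mulmxKV// mxE.
Qed.

End FiniteDimension.

(** * Tensor fields and their square roots *)

Section Tensors.
Context {R : realType}.
Local Notation mu := (leb3 R).
Variables (Om : set (pt R)) (mOm : measurable (Om : set (P3 R))).
Implicit Types (A : tensor R) (u v : field R) (i j : 'I_3).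

Definition bounded_tensor A := forall i j,
  measurable_fun (Om : set (P3 R)) (fun x => A x i j) /\
  exists M, {ae mu, forall x, Om x -> `|A x i j| <= M}.

Lemma LinftyM_bounded A : LinftyM Om A -> bounded_tensor A.
Proof.
move=> hA i j; have := hA i j; rewrite inE => /andP[/[1!inE] /= mA].
have mE := measurable_restrictT (fun x => A x i j) mOm.
rewrite inE /= /finite_norm unlock => hf; split; first exact/mE.
move: hf; case: ifPn => [mu0|mu0].
  move=> /ess_supr_bounded[M hM]; exists M.
  by apply: aeS hM => x /= + Ox; rewrite patchE mem_set.
(* The remaining case of the norm at infinity is that of total measure zero, where the whole space
   is a null set. *)
move=> _; exists 0; exists setT; split; [exact: measurableT| |by []].
by apply/eqP; rewrite eq_le measure_ge0 andbT leNgt.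
Qed.

Lemma mact_L2v A v : bounded_tensor A -> L2v Om v -> L2v Om (mact A v).
Proof.
move=> hA hv i.
have h j : L2s Om (fun x => A x i j * v x j 0).
  have [mA [M hM]] := hA i j.
  apply: (L2s_dom mOm _ (L2sZ mOm M (hv j))).
    by apply: measurable_funM => //; exact: (L2s_meas mOm (hv j)).
  apply: aeS hM => x h Ox; rewrite !normrM ler_wpM2r//.
  by rewrite (le_trans (h Ox))// ler_norm.
rewrite (_ : (fun x => _) = fun x => A x i 0 * v x 0 0 + A x i 1 * v x 1 0 + A x i 2%:R * v x 2%:R
    0).
  by apply: (L2sD mOm); [exact: (L2sD mOm)|].
by apply/funext => x; rewrite mxE sum3E.
Qed.

Lemma mact_lin A (s : R) u v : mact A (s *: u + v) = s *: mact A u + mact A v.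
Proof. by apply/funext => x; rewrite /mact !fctE mulmxDr -scalemxAr. Qed.

Lemma ip_ae u v u' v' : L2v Om u -> L2v Om v -> L2v Om u' -> L2v Om v' ->
  {ae mu, forall x, Om x -> dot (u x) (v x) = dot (u' x) (v' x)} -> ip Om u v = ip Om u' v'.
Proof.
move=> hu hv hu' hv' h; congr fine; apply: ae_eq_integral => //.
- exact: (measurable_int mu (L2v_dot mOm hu hv)).
- exact: (measurable_int mu (L2v_dot mOm hu' hv')).
- by apply: aeS h => x h Ox; rewrite h.
Qed.

Lemma dotE (a b : vec R) : dot a b = (a^T *m b) 0 0.
Proof. by rewrite mxE; apply: eq_bigr => i _; rewrite mxE. Qed.

Lemma dot_tr (M : 'M[R]_3) (a b : vec R) : dot (M *m a) b = dot a (M^T *m b).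
Proof. by rewrite !dotE trmx_mul mulmxA. Qed.

Lemma ip_mact_sym A u v : bounded_tensor A ->
  {ae mu, forall x, Om x -> (A x)^T = A x} -> L2v Om u -> L2v Om v ->
  ip Om (mact A u) v = ip Om u (mact A v).
Proof.
move=> hA sA hu hv; apply: ip_ae => //; [exact: mact_L2v|exact: mact_L2v|].
by apply: aeS sA => x h Ox; rewrite dot_tr h.
Qed.

Lemma enorm_sq (a : vec R) : enorm a ^+ 2 = dot a a.
Proof. by rewrite sqr_sqrtr// dot_ge0. Qed.

Lemma ip_mact_coercive A v (c : R) : bounded_tensor A -> L2v Om v ->
  {ae mu, forall x, Om x -> forall xi : vec R, c * dot xi xi <= dot xi (A x *m xi)} ->
  c * ip Om v v <= ip Om (mact A v) v.
Proof.
move=> hA hv h; have hm := mact_L2v hA hv.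
rewrite -(ipZl mOm)//; have hc : L2v Om (c *: v) by exact: L2vZ.
rewrite -subr_ge0 -mulN1r -(ipZl mOm)// -(ipDl mOm)//; last exact: L2vZ.
pose w := mact A v + -1 *: (c *: v).
have hw : L2v Om w by apply: L2vD => //; exact: L2vZ.
have I1 := L2v_dot mOm hw hv.
rewrite /ip -/w fine_ge0//.
have e : {ae mu, forall x, Om x -> `|dot (w x) (v x)|%:E = (dot (w x) (v x))%:E :> \bar R}.
  apply: aeS h => x hx Ox; congr EFin; rewrite ger0_norm//.
  rewrite /w !fctE dotDl dotC /mact !dotZl mulN1r subr_ge0; exact: hx.
rewrite -(@ae_eq_integral _ _ _ mu Om _ (fun x => `|dot (w x) (v x)|%:E))//.
- by apply: integral_ge0 => x _; rewrite lee_fin.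
- by apply/measurable_EFinP; apply: measurableT_comp => //; apply/measurable_EFinP;
    exact: (measurable_int mu I1).
- exact: (measurable_int mu I1).
Qed.

Lemma measurable_det n (F : pt R -> 'M[R]_n) :
  (forall i j : 'I_n, measurable_fun (Om : set (P3 R)) (fun x => F x i j)) ->
  measurable_fun (Om : set (P3 R)) (fun x => \det (F x)).
Proof.
move=> mF; apply: measurable_sum => s; apply: measurable_funM; first exact: measurable_cst.
by apply: measurable_prod => i _; exact: mF.
Qed.

(** The inverse is f (f^2)^-1, a real power of a nonnegative base; where f vanishes both sides are
    0. *)
Lemma measurable_fun_inv (f : pt R -> R) : measurable_fun (Om : set (P3 R)) f ->
  measurable_fun (Om : set (P3 R)) (fun x => (f x)^-1).
Proof.
move=> mf; rewrite (_ : (fun x => _) = fun x => f x * (f x ^+ 2) `^ (-1)).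
  apply: measurable_funM => //.
  by apply: (measurableT_comp (measurable_powR (-1))); exact: measurable_funX.
apply/funext => x; rewrite powR_inv1 ?sqr_ge0//.
by have [->|f0] := eqVneq (f x) 0; [rewrite invr0 mul0r|field].
Qed.

Lemma measurable_minv A : bounded_tensor A ->
  forall i j, measurable_fun (Om : set (P3 R)) (fun x => minv A x i j).
Proof.
move=> hA i j; have mA i' j' := (hA i' j').1.
have md := measurable_det mA.
(* [invmx] returns a singular matrix unchanged; elsewhere its entries are cofactors over the
   determinant. *)
rewrite (_ : (fun x => _) = fun x => if \det (A x) == 0 then A x i j else (\det (A x))^-1 *
    cofactor (A x) j i).
  apply: measurable_fun_if => //.
  - by apply: measurable_fun_eqr.
  - by apply: measurable_funS (mA i j) => //; exact: subIsetl.
  - apply: (@measurable_funS _ _ _ _ Om) => //.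
    apply: measurable_funM; first exact: measurable_fun_inv.
    apply: measurable_funM; first exact: measurable_cst.
    apply: measurable_det => i' j'.
    rewrite (_ : (fun x => _) = fun x => A x (lift j i') (lift i j')); first exact: mA.
    by apply/funext => x; rewrite !mxE.
apply/funext => x; rewrite /minv /invmx unitmxE unitfE.
by case: eqP => // _; rewrite !mxE.
Qed.

Lemma coercive_unit (M : 'M[R]_3) (c : R) : 0 < c ->
  (forall xi : vec R, c * enorm xi ^+ 2 <= dot xi (M *m xi)) -> M \in unitmx.
Proof.
move=> c0 h; rewrite -unitmx_tr unitmxE unitfE; apply/det0P => -[x /eqP x0 xM]; apply: x0.
have := h x^T; rewrite -[M]trmxK -trmx_mul xM trmx0 enorm_sq.
rewrite (_ : dot x^T 0 = 0); last by rewrite /dot big1// => i _; rewrite [X in _ * X]mxE mulr0.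
rewrite pmulr_rle0// => h1.
have h2 : dot x^T x^T = 0 by apply/eqP; rewrite eq_le h1 dot_ge0.
by apply: trmx_inj; rewrite (dot_eq0 h2) trmx0.
Qed.

(** For xi the [j]-th column of the inverse, coercivity reads c |xi|^2 <= xi_j <= |xi|, hence |xi|
    <= 1/c. *)
Lemma coercive_inv_bound (M : 'M[R]_3) (c : R) : 0 < c ->
  (forall xi : vec R, c * enorm xi ^+ 2 <= dot xi (M *m xi)) ->
  forall i j, `|invmx M i j| <= c^-1.
Proof.
move=> c0 h i j; have uM := coercive_unit c0 h.
pose xi : vec R := invmx M *m delta_mx j 0.
have e1 : M *m xi = delta_mx j 0 by rewrite mulmxA mulmxV// mul1mx.
have e2 : dot xi (M *m xi) = xi j 0.
  rewrite e1 /dot (bigD1 j)//= [X in _ * X + _]mxE !eqxx mulr1 big1 ?addr0// => l lj.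
  by rewrite [X in _ * X]mxE (negbTE lj) mulr0.
have n_ge l : xi l 0 ^+ 2 <= dot xi xi.
  rewrite /dot (bigD1 l)//= -expr2 lerDl; apply: sumr_ge0 => m _.
  by rewrite -expr2 sqr_ge0.
have xiE : xi i 0 = invmx M i j.
  rewrite mxE (bigD1 j)//= [X in _ * X + _]mxE !eqxx mulr1 big1 ?addr0// => l lj.
  by rewrite [X in _ * X]mxE (negbTE lj) mulr0.
have h1 := h xi; rewrite enorm_sq e2 in h1.
have n0 := dot_ge0 xi.
have h3 : (c * `|xi i 0|) ^+ 2 <= 1.
  rewrite exprMn real_normK ?num_real//.
  have hi := n_ge i; have hj := n_ge j.
  have [nz|nz] := eqVneq (dot xi xi) 0; first by nra.
  have np : 0 < dot xi xi by rewrite lt_neqAle eq_sym nz.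
  have h4 : (c * dot xi xi) ^+ 2 <= dot xi xi.
    apply: le_trans hj; rewrite -ler_sqrt ?sqr_ge0// !sqrtr_sqr.
    rewrite ger0_norm; last by rewrite mulr_ge0// ltW.
    by rewrite (le_trans h1)// ler_norm.
  have h5 : c ^+ 2 * dot xi xi <= 1.
    by rewrite -(ler_pM2r np) mul1r; apply: le_trans h4; rewrite exprMn -mulrA -expr2.
  by apply: le_trans h5; rewrite ler_wpM2l ?sqr_ge0.
rewrite -xiE -[leRHS]mul1r ler_pdivlMr// mulrC.
have : 0 <= c * `|xi i 0| by rewrite mulr_ge0// ltW.
by move=> h6; rewrite -(@ler_sqr _ (c * _)) ?nnegrE// expr1n.
Qed.

Lemma minv_bounded A (c : R) : 0 < c -> bounded_tensor A ->
  {ae mu, forall x, Om x -> forall xi : vec R, c * enorm xi ^+ 2 <= dot xi (A x *m xi)} ->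
  bounded_tensor (minv A).
Proof.
move=> c0 hA hc i j; split; first exact: measurable_minv.
by exists c^-1; apply: aeS hc => x h Ox; exact: coercive_inv_bound (h Ox) _ _.
Qed.

Lemma minv_sym A : {ae mu, forall x, Om x -> (A x)^T = A x} ->
  {ae mu, forall x, Om x -> (minv A x)^T = minv A x}.
Proof. by apply: aeS => x h Ox; rewrite /minv trmx_inv h. Qed.

Lemma minv_psd A (c : R) : 0 < c ->
  {ae mu, forall x, Om x -> forall xi : vec R, c * enorm xi ^+ 2 <= dot xi (A x *m xi)} ->
  {ae mu, forall x, Om x -> forall xi : vec R, 0 <= dot xi (minv A x *m xi)}.
Proof.
move=> c0; apply: aeS => x h Ox xi; have uM := coercive_unit c0 (h Ox).
pose eta := minv A x *m xi.
have -> : xi = A x *m eta by rewrite mulmxA mulmxV// mul1mx.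
rewrite mulmxA mulVmx// mul1mx dotC; apply: le_trans (h Ox eta).
by rewrite mulr_ge0 ?sqr_ge0// ltW.
Qed.

End Tensors.

(** * Square roots of positive semidefinite matrices *)

Lemma interpolation (F : fieldType) (f : F -> F) (s : seq F) :
  exists q : {poly F}, forall x, x \in s -> q.[x] = f x.
Proof.
elim: s => [|a s [q hq]]; first by exists 0.
have [sa|sa] := boolP (a \in s).
  by exists q => x; rewrite inE => /predU1P[->|]; exact: hq.
pose w := \prod_(b <- s) ('X - b%:P).
have wa : w.[a] != 0.
  by have := root_prod_XsubC s a; rewrite /root (negbTE sa) => ->.
exists (q + ((f a - q.[a]) / w.[a]) *: w) => x; rewrite inE => /predU1P[->|xs].
  by rewrite hornerD hornerZ divfK// addrC subrK.
rewrite hornerD hornerZ hq// (_ : w.[x] = 0) ?mulr0 ?addr0//.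
by apply/rootP; rewrite /w root_prod_XsubC.
Qed.

Lemma trmx_horner (F : comNzRingType) n (A : 'M[F]_n.+1) q :
  A^T = A -> (horner_mx A q)^T = horner_mx A q.
Proof.
move=> sA; elim/poly_ind: q => [|q c ih]; first by rewrite rmorph0 trmx0.
rewrite rmorphD rmorphM /= horner_mx_X horner_mx_C linearD /= tr_scalar_mx.
by rewrite -[_ * A]/(_ *m A) trmx_mul sA ih; congr (_ + _); rewrite -comm_mx_horner.
Qed.

Section Psd.
Variable R : rcfType.

Lemma map_mx_Re m n p (u : 'M[R[i]]_(m, n)) (A : 'M[R]_(n, p)) :
  map_mx (@complex.Re R) (u *m map_mx (real_complex R) A) = map_mx (@complex.Re R) u *m A.
Proof.
apply/matrixP => k l; rewrite !mxE (big_morph (@complex.Re R) (id1 := 0) (op1 := +%R))//;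
    last by case=> ? ? [].
by apply: eq_bigr => j _; rewrite !mxE; case: (u k j) => x y /=; rewrite mulr0 subr0.
Qed.

Lemma map_mx_Im m n p (u : 'M[R[i]]_(m, n)) (A : 'M[R]_(n, p)) :
  map_mx (@complex.Im R) (u *m map_mx (real_complex R) A) = map_mx (@complex.Im R) u *m A.
Proof.
apply/matrixP => k l; rewrite !mxE (big_morph (@complex.Im R) (id1 := 0) (op1 := +%R))//;
    last by case=> ? ? [].
by apply: eq_bigr => j _; rewrite !mxE; case: (u k j) => x y /=; rewrite mulr0 add0r.
Qed.

(* The square of a symmetric fourth root is a square root that is visibly
   positive semidefinite. *)
Lemma psd_fourth_root n (A : 'M[R]_n.+1) : A^T = A ->
  (forall v : 'rV[R]_n.+1, 0 <= (v *m A *m v^T) 0 0) ->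
  exists S : 'M[R]_n.+1, S^T = S /\ S ^+ 4 = A.
Proof.
move=> sA pA; pose f : {rmorphism R -> R[i]} := real_complex R.
pose AC := map_mx f A.
have rf x : f x \is Num.real by apply/complex_realP; exists x.
have hAC : AC \is hermsymmx.
  apply: realsym_hermsym; last by apply/mxOverP => i j; rewrite mxE.
  by apply/is_hermitianmxP; rewrite expr0 scale1r map_mx_id// map_trmx sA.
have /orthomx_spectralP eA := hermitian_normalmx hAC.
have /mxOverP dR := hermitian_spectral_diag_real hAC.
set P := spectralmx AC in eA; set d := spectral_diag AC in eA dR.
have uP : P \in unitmx by exact: spectral_unit.
have /choice[r hr] i : exists r, d 0 i = f r by apply/complex_realP.
(* The eigenvalue is real, so the real and imaginary parts of the complex eigenvector satisfy the
   same eigenvalue equation for [A]. One of them is nonzero, and the quadratic form evaluated there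
   gives the sign. *)
have r0 i : 0 <= r i.
  pose a := map_mx (@complex.Re R) (row i P); pose b := map_mx (@complex.Im R) (row i P).
  have PA : P *m AC = diag_mx d *m P by rewrite {1}eA !mulmxA mulmxV// mul1mx.
  have rA : row i P *m AC = f (r i) *: row i P.
    by apply/rowP => j; rewrite -row_mul PA mul_diag_mx !mxE hr.
  have aA : a *m A = r i *: a.
    rewrite -map_mx_Re rA; apply/rowP => j; rewrite !mxE.
    by case: (P i j) => x y /=; rewrite mul0r subr0.
  have bA : b *m A = r i *: b.
    rewrite -map_mx_Im rA; apply/rowP => j; rewrite !mxE.
    by case: (P i j) => x y /=; rewrite mul0r addr0.
  have key (v : 'rV[R]_n.+1) : v *m A = r i *: v -> v != 0 -> 0 <= r i.
    move=> vA v0; have := pA v; rewrite vA -scalemxAl mxE.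
    have vv : 0 < (v *m v^T) 0 0.
      rewrite lt_neqAle eq_sym mxE; apply/andP; split; last first.
        by apply: sumr_ge0 => j _; rewrite mxE -expr2 sqr_ge0.
      rewrite psumr_neq0; last by move=> j _; rewrite mxE -expr2 sqr_ge0.
      have /rV0Pn[j vj] := v0; apply/hasP; exists j; rewrite ?mem_index_enum//=.
      by rewrite mxE -expr2 exprn_even_gt0.
    by rewrite pmulr_lge0.
  have [a0|] := eqVneq a 0; last exact: key.
  have [b0|] := eqVneq b 0; last exact: key.
  have : row i P = 0.
    apply/rowP => j; move/rowP/(_ j): a0; move/rowP/(_ j): b0; rewrite !mxE.
    by case: (P i j) => x y /= -> ->.
  move=> /(congr1 (mulmx^~ (invmx P))); rewrite -row_mul mulmxV// mul0mx.
  by move=> /rowP/(_ i)/eqP; rewrite !mxE eqxx oner_eq0.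
(* The fourth root is applied as a polynomial that interpolates it on the spectrum: a polynomial in
   [A] is real and symmetric, and its fourth power can be compared with [A] after
   diagonalization. *)
have [q hq] := interpolation (fun x => Num.sqrt (Num.sqrt x)) [seq r i | i : 'I_n.+1].
exists (horner_mx A q); split; first exact: trmx_horner.
rewrite -rmorphXn /= -[RHS]horner_mx_X; apply/eqP; rewrite -subr_eq0 -rmorphB /=.
rewrite -(map_mx_eq0 f) map_horner_mx -/AC eA horner_mx_uconjC// horner_mx_diag.
rewrite (_ : map_mx _ d = 0) ?linear0 ?mulmx0 ?mul0mx//.
apply/rowP => i; rewrite !mxE hr horner_map /= !hornerE hq; last by apply: map_f; rewrite mem_enum.
by rewrite -[4%N]/(2 * 2)%N exprM !sqr_sqrtr ?sqrtr_ge0// subrr.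
Qed.

End Psd.

Section Sqrt.
Variable R : realType.

Lemma sqrtmxP (A : 'M[R]_3) : A^T = A -> (forall xi : vec R, 0 <= dot xi (A *m xi)) ->
  (sqrtmx A)^T = sqrtmx A /\ sqrtmx A *m sqrtmx A = A.
Proof.
move=> sA pA; have [v|S [sS S4]] := psd_fourth_root sA.
  by have := pA v^T; rewrite dotE trmxK mulmxA.
suff /xgetPex : exists S, [set S | S^T = S /\ (forall xi, 0 <= dot xi (S *m xi)) /\ S *m S = A] S.
  by move=> /(_ 0)[? [_ ?]].
exists (S *m S); split; first by rewrite trmx_mul sS.
split; first by move=> xi; rewrite -mulmxA -{1}sS -dot_tr dot_ge0.
by rewrite -[RHS]S4 -[4%N]/(2 * 2)%N exprM !expr2.
Qed.

End Sqrt.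

Section AeIntegral.
Import HBNNSimple.
Context d (T : measurableType d) {R : realType} (mu : {measure set T -> \bar R}).
Variable D : set T.

(** A simple function below [f], set to zero on a measurable null set outside which [f] and [g]
    agree on [D], keeps its integral and lies below [g]. *)
Lemma ge0_ae_le_integral_gen (f g : T -> \bar R) :
  (forall x, 0 <= f x)%E -> (forall x, 0 <= g x)%E ->
  {ae mu, forall x, D x -> f x = g x} ->
  (\int[mu]_(x in D) f x <= \int[mu]_(x in D) g x)%E.
Proof.
move=> f0 g0 [N [mN N0 fgN]].
rewrite ge0_integralE// ge0_integralE//; apply: ge_ereal_sup => _ /= [h hf <-].
have mNc := measurableC mN.
pose h' := mul_nnsfun h (indic_nnsfun R mNc).
have -> : sintegral mu h = sintegral mu h'.
  rewrite -!integralT_nnsfun; apply: ae_eq_integral => //.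
  - by apply/measurable_EFinP.
  - by apply/measurable_EFinP.
  exists N; split => // x /= hx; apply: contrapT => xN; apply: hx => _.
  by rewrite -[RHS]/((h x * \1_(~` N) x)%:E) indicE mem_set// mulr1.
apply: ereal_sup_ubound; exists h' => // x; rewrite -[X in (X <= _)%E]/((h x * \1_(~` N) x)%:E).
have [xN|xN] := pselect (N x).
  rewrite indicE memNset ?mulr0//.
  by rewrite patchE; case: ifP.
rewrite indicE mem_set// mulr1; apply: le_trans (hf x) _.
rewrite !patchE; case: ifPn => // /set_mem Dx.
suff -> : f x = g x by [].
by apply: contrapT => h1; apply: xN; apply: fgN => /= /(_ Dx).
Qed.

(* Stated without measurability: [msqrt A] is not known to be measurable. *)
Lemma ae_eq_integral_gen (f g : T -> \bar R) : {ae mu, forall x, D x -> f x = g x} ->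
  (\int[mu]_(x in D) f x = \int[mu]_(x in D) g x)%E.
Proof.
have key (f1 f2 : T -> \bar R) : (forall x, 0 <= f1 x)%E -> (forall x, 0 <= f2 x)%E ->
    {ae mu, forall x, D x -> f1 x = f2 x} ->
    (\int[mu]_(x in D) f1 x = \int[mu]_(x in D) f2 x)%E.
  move=> f0 g0 h; apply/eqP; rewrite eq_le !ge0_ae_le_integral_gen//.
  by move: h; apply: filterS => x h Dx; rewrite h.
move=> h; rewrite [LHS]integralE [RHS]integralE; congr (_ - _)%E; apply: key => //.
- by move: h; apply: filterS => x h Dx; rewrite !funeposE h.
- by move: h; apply: filterS => x h Dx; rewrite !funenegE h.
Qed.

End AeIntegral.

(** For a symmetric root S of A, |S u|^2 is the quadratic form of A at u, so the roots disappear
    from the cost. *)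
Lemma normsq_msqrt (R : realType) (Om : set (pt R)) (A : tensor R) (u : field R) :
  {ae leb3 R, forall x, Om x -> (A x)^T = A x} ->
  {ae leb3 R, forall x, Om x -> forall xi : vec R, 0 <= dot xi (A x *m xi)} ->
  normsq Om (mact (msqrt A) u) = ip Om (mact A u) u.
Proof.
move=> sA pA; congr fine; apply: ae_eq_integral_gen.
apply: aeS2 sA pA => x sx px Ox; have [sS SS] := sqrtmxP (sx Ox) (px Ox).
by rewrite /mact /msqrt dot_tr sS mulmxA SS dotC.
Qed.

(** * Finite dimension of piecewise polynomials *)

Section PiecewisePolynomials.
Context {R : realType}.
Local Notation mu := (leb3 R).
Variables (Om : set (pt R)) (Th : set (tetra R)).
Hypothesis hTh : is_mesh Om Th.

Definition ae_zero : set (field R) := [set v | aeeq Om v 0].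

Definition piecewise_poly d : set (field R) := [set v | forall a, Th a ->
  exists P : pvec (R := R), (forall i, (mpoly.msize (P i) <= d)%N) /\ aeeq (tet a) v (peval P)].

Lemma ptab_lin d s (c c' : 'I_3 -> mpoly.bmultinom 3 d -> R) :
  ptab (fun i m => s * c i m + c' i m) = s *: ptab c + ptab c'.
Proof.
apply/funext => x; apply/matrixP => i j; rewrite !fctE !mxE mulr_sumr -big_split.
by apply: eq_bigr => m _ /=; rewrite mulrDl mulrA.
Qed.

(** The coordinates are the coefficient tables on all elements. They are only related to the field,
    so no uniqueness of the polynomial on an element has to be shown; zero tables make the field
    null because the elements cover [Om]. *)
Lemma findim_piecewise_poly d : findim (piecewise_poly d) ae_zero.
Proof.
have [fT _ cl _] := hTh; have [s sE] := (finite_seqP Th).1 fT.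
pose b (j : 'I_(size s)) : tetra R := tnth (in_tuple s) j.
have Tb j : Th (b j) by rewrite sE /= /b mem_tnth.
pose I : finType := ('I_(size s) * 'I_3 * mpoly.bmultinom 3 d)%type.
pose tab (c : 'rV[R]_#|I|) j : field R := ptab (fun i (m : mpoly.bmultinom 3 d) => c 0 (enum_rank
    (j, i, m))).
exists #|I|, (fun v c => forall j, aeeq (tet (b j)) v (tab c j)); split.
- move=> k u v c e hu hv j.
  suff -> : tab (k *: c + e) j = k *: tab c j + tab e j by exact: aeeq_lin.
  rewrite /tab -ptab_lin; congr ptab.
  by apply/funext => i; apply/funext => m; rewrite !mxE.
- move=> v hv; have /choice[P hP] j := hv _ (Tb j).
  pose c : 'rV[R]_#|I| := \row_l mpoly.mcoeff (mpoly.bmnm (enum_val l).2) (P (enum_val l).1.1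
      (enum_val l).1.2).
  exists c.
  move=> j; have [hd he] := hP j; rewrite (peval_ptab hd) in he.
  suff -> : tab c j = ptab (fun i (m : mpoly.bmultinom 3 d) => mpoly.mcoeff (mpoly.bmnm m) (P j i))
      by [].
  by congr ptab; apply/funext => i; apply/funext => m; rewrite mxE enum_rankK.
move=> v hv.
have h0 : {ae mu, forall x, forall j, tet (b j) x -> v x = 0}.
  have h1 (l : seq 'I_(size s)) : {ae mu, forall x, forall j, j \in l -> tet (b j) x -> v x = 0}.
    elim: l => [|j l ih]; first exact: aeW.
    apply: aeS2 (hv j) ih => x h1 h2 j'; rewrite inE => /predU1P[->|/h2//] tx.
    rewrite h1//; apply/matrixP => i l'; rewrite !mxE.
    by rewrite big1// => m _; rewrite mxE mul0r.
  by apply: aeS (h1 (enum 'I_(size s))) => x h j; apply: h; rewrite mem_enum.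
apply: aeS h0 => x h Ox.
have : closure Om x by exact: subset_closure.
rewrite cl => -[a Ta tx]; move: Ta tx; rewrite sE /= => /(nthP a)[j js <-] tx.
by apply: (h (Ordinal js)); rewrite /b (tnth_nth a).
Qed.

Variable k : nat.

Lemma Nh_piecewise_poly : Nh Om Th k `<=` piecewise_poly k.+2.
Proof.
move=> v [_ hv] a Ta; have [P [nP eP]] := hv a Ta.
by exists P; split=> // i; exact: nedelec_msize.
Qed.

Lemma Nh0_piecewise_poly : Nh0 Om Th k `<=` piecewise_poly k.+2.
Proof. by move=> v [/Nh_piecewise_poly]. Qed.

Lemma RTh_piecewise_poly : RTh Om Th k `<=` piecewise_poly k.+2.
Proof.
move=> v [_ hv] a Ta; have [P [nP eP]] := hv a Ta.
by exists P; split=> // i; exact: raviart_thomas_msize.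
Qed.

End PiecewisePolynomials.

(** * Time averages *)

Section FiberMean.
Context d1 d2 (T1 : measurableType d1) (T2 : measurableType d2) (R : realType).
Variables (m1 : {sigma_finite_measure set T1 -> \bar R})
  (m2 : {sigma_finite_measure set T2 -> \bar R}).
Variables (A : set T1) (c : R) (G : T1 * T2 -> R).
Hypotheses (mA : measurable A) (m1A : m1 A = c%:E) (c0 : 0 < c).
Hypothesis iG : (m1 \x m2)%E.-integrable setT (EFin \o G).
Hypothesis iG2 : (m1 \x m2)%E.-integrable setT (EFin \o (fun q => G q ^+ 2)).
Hypothesis GA : forall x y, ~ A x -> G (x, y) = 0.

(** Cauchy-Schwarz on a set of measure [c], from the nonnegative integral of (f - m)^2 over [A],
    where m is the mean a / c. *)
Lemma sqr_Rintegral_le (f : T1 -> R) : m1.-integrable setT (EFin \o f) ->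
  m1.-integrable setT (EFin \o (fun x => f x ^+ 2)) -> (forall x, ~ A x -> f x = 0) ->
  (\int[m1]_x f x) ^+ 2 <= c * \int[m1]_x (f x ^+ 2).
Proof.
move=> i1 i2 fA; set a := \int[m1]_x f x; set b := \int[m1]_x _.
pose m := a / c.
have iA : m1.-integrable setT (EFin \o (\1_A : T1 -> R)).
  apply/integrableP; split; first by apply/measurable_EFinP; exact: measurable_indic.
  rewrite (eq_integral (fun x => (\1_A x)%:E)); last by move=> x _; rewrite gee0_abs// lee_fin.
  by rewrite integral_indic// setIT (le_lt_trans (y := c%:E)) ?ltry// -m1A.
have j1 := integrableZl measurableT (- (2 * m)) i1.
have jA := integrableZl measurableT (m ^+ 2) iA.
have j1' : m1.-integrable setT (EFin \o (fun x => - (2 * m) * f x)).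
  by apply: eq_integrable j1.
have jA' : m1.-integrable setT (EFin \o (fun x => m ^+ 2 * \1_A x)).
  by apply: eq_integrable jA.
have j12 : m1.-integrable setT (EFin \o (fun x => f x ^+ 2 + - (2 * m) * f x)).
  by apply: eq_integrable (integrableD measurableT i2 j1').
have : 0 <= \int[m1]_x (f x ^+ 2 + - (2 * m) * f x + m ^+ 2 * \1_A x).
  apply: Rintegral_ge0 => x _; have [Ax|Ax] := pselect (A x).
    rewrite indicE mem_set//= mulr1 (_ : _ + _ = (f x - m) ^+ 2) ?sqr_ge0//; ring.
  by rewrite (fA x Ax) indicE memNset//= !mulr0 expr0n !addr0.
rewrite (RintegralD measurableT j12 jA') (RintegralD measurableT i2 j1').
rewrite RintegralZl// RintegralZl// -/a -/b.
have -> : \int[m1]_x \1_A x = c.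
  by rewrite /Rintegral integral_indic// setIT -[LHS]/(fine (m1 A)) m1A.
move=> h; have mc : m * c = a by rewrite /m divfK// gt_eqF.
have h2 : 0 <= c * (b + - (2 * m) * a + m ^+ 2 * c) by rewrite mulr_ge0// ltW.
rewrite -mc in h2 *; lra.
Qed.

Let g y := \int[m1]_(x in A) G (x, y).

Lemma fiber_integral_measurable : measurable_fun setT g.
Proof.
rewrite (_ : g = fine \o fubini_G m1 (EFin \o G)).
  apply: measurableT_comp; last exact: measurable_fubini_G iG.
  exact: fine_measurable.
apply/funext => y; rewrite /g Rintegral_mkcond /Rintegral /fubini_G; congr fine.
apply: eq_integral => x _ /=; rewrite patchE; case: ifPn => //.
by rewrite notin_setE => /GA ->.
Qed.

(** On almost every fiber [sqr_Rintegral_le] bounds the square of the integral by [c] times the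
    integral of the square, and by Tonelli the latter is integrable in [y]. *)
Lemma fiber_integral_sqr_integrable : m2.-integrable setT (EFin \o (fun y => g y ^+ 2)).
Proof.
have mg := fiber_integral_measurable.
have i2 : m2.-integrable setT (fubini_G m1 (EFin \o (fun q => G q ^+ 2))).
  apply/integrableP; split; first exact: measurable_fubini_G iG2.
  have /measurable_int mG2 := iG2.
  apply: le_lt_trans ((integrable21ltyP m1 m2 mG2).1 iG2).
  rewrite le_eqVlt; apply/orP; left; apply/eqP; apply: eq_integral => y _.
  rewrite gee0_abs; last by apply: integral_ge0 => x _; rewrite lee_fin sqr_ge0.
  by apply: eq_integral => x _; rewrite gee0_abs// lee_fin sqr_ge0.
 have i3 := integrableZl measurableT c i2.
have [m3 f3] := integrableP _ _ _ i3.
have mg2 : measurable_fun setT (EFin \o (fun y => g y ^+ 2)).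
  by apply/measurable_EFinP; exact: measurable_funX.
apply/integrableP; split=> //; apply: le_lt_trans f3.
apply: ae_ge0_le_integral => //; try exact: measurableT_comp.
have a1 := ae_integrable2 iG; have a2 := ae_integrable2 iG2.
apply: (@filterS2 _ _ (ae_filter_ringOfSetsType m2) _ _ _ _ a1 a2) => y h1 h2 _.
have := sqr_Rintegral_le h1 h2 (fun x => @GA x y).
have -> : fubini_G m1 (EFin \o (fun q => G q ^+ 2)) y = (\int[m1]_x (G (x, y) ^+ 2))%:E.
  exact: esym (fineK (integrable_fin_num measurableT h2)).
rewrite /= => h; rewrite lee_fin.
rewrite !ger0_norm ?sqr_ge0//; last first.
  by rewrite mulr_ge0 ?(ltW c0)//; apply: fine_ge0; apply: integral_ge0 => x _;
      rewrite lee_fin sqr_ge0.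
rewrite (_ : g y = \int[m1]_x G (x, y))//.
rewrite /g Rintegral_mkcond; apply: eq_Rintegral => x _; rewrite patchE.
by case: ifPn => //; rewrite notin_setE => /GA ->.
Qed.

End FiberMean.

Section TimeAverage.
Context {R : realType}.
Variables (Om : set (pt R)) (oOm : open Om) (bOm : bounded_set Om).
Variables (T : R) (Nt : nat).
Hypotheses (hT : 0 < T) (hNt : (0 < Nt)%N).

Let mOm : measurable (Om : set (P3 R)) := open_pt_measurable oOm.
Local Notation mu1 := (@lebesgue_measure R).
Local Notation mup := (mu1 \x leb3 R)%E.

Lemma dt_gt0 : 0 < dt T Nt.
Proof. by rewrite divr_gt0// ltr0n. Qed.

Lemma tnS n : tn T Nt n.+1 = tn T Nt n + dt T Nt.
Proof. by rewrite /tn -natr1 mulrDl mul1r. Qed.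

Lemma tn_le n : (n <= Nt)%N -> tn T Nt n <= T.
Proof.
move=> nN; rewrite /tn /dt mulrA ler_pdivrMr ?ltr0n// mulrC ler_wpM2l ?ler_nat//.
exact: ltW.
Qed.

(** The source is square integrable on the space-time cylinder only. Its cell average is an integral
    over fibers, so spatial measurability comes from Fubini and the bound from Cauchy-Schwarz in
    time. *)
Lemma tavg_L2v (I : R -> field R) n : L2L2 Om T I -> (n < Nt)%N -> L2v Om (tavg T Nt I n).
Proof.
move=> hI nN i; have d0 := dt_gt0.
have := hI i; set F := _ \_ _ => hF.
have mF : measurable_fun (setT : set (measurableTypeR R * P3 R)%type) F by move: hF;
    rewrite inE => /andP[/[1!inE]].
have iF2 := Lfun2_integrable_sqr hF.
pose A : set (measurableTypeR R) := [set` `[tn T Nt n, tn T Nt n.+1]].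
have mA : measurable A by exact: measurable_itv.
have muA : mu1 A = (dt T Nt)%:E.
  by rewrite lebesgue_measure_itv/= lte_fin tnS ltrDl d0 -EFinB addrC addKr.
pose AO : set (measurableTypeR R * P3 R)%type := A `*` (Om : set (P3 R)).
have mAO : measurable AO by exact: measurableX.
have muAO : (mup AO < +oo)%E.
  have -> : mup AO = (mu1 A * leb3 R Om)%E by exact: product_measure1E.
  by rewrite muA lte_mul_pinfty ?lee_fin ?(ltW d0)//; exact: bounded_leb3.
pose G : R * pt R -> R := F \_ AO.
have mG : measurable_fun (setT : set (measurableTypeR R * P3 R)%type) G.
  by apply/(measurable_restrictT _ mAO); exact: measurable_funTS.
have G_le q : G q ^+ 2 <= F q ^+ 2.
  by rewrite /G patchE; case: ifP => // _; rewrite expr0n sqr_ge0.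
have iG2 : mup.-integrable setT (EFin \o (fun q => G q ^+ 2)).
  apply: (le_integrable measurableT _ _ iF2).
    by apply/measurable_EFinP; exact: measurable_funX.
  by move=> q _ /=; rewrite lee_fin !ger0_norm ?sqr_ge0.
have iAO : mup.-integrable setT (EFin \o (\1_AO : R * pt R -> R)).
  apply/integrableP; split; first by apply/measurable_EFinP; exact: measurable_indic.
  rewrite (eq_integral (fun x => (\1_AO x)%:E)); last by move=> x _; rewrite gee0_abs// lee_fin.
  have := integral_indic mup measurableT mAO; rewrite setIT => e; rewrite -e in muAO; exact: muAO.
have iG : mup.-integrable setT (EFin \o G).
  apply: (le_integrable measurableT _ _ (integrableD measurableT iAO iG2)).
    exact/measurable_EFinP.
  move=> q _ /=; rewrite lee_fin [leRHS]ger0_norm ?addr_ge0 ?sqr_ge0//.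
  rewrite indicE /G patchE; case: ifP => _ /=; last by rewrite normr0 expr0n addr0.
  by rewrite -[F q ^+ 2]real_normK ?num_real//; nra.
have GA s x : ~ A s -> G (s, x) = 0.
  by move=> As; rewrite /G patchE; case: ifPn => // /set_mem[].
have mg := @fiber_integral_measurable _ _ (measurableTypeR R) (P3 R) R mu1 (leb3 R) A G iG GA.
have ig := @fiber_integral_sqr_integrable _ _ (measurableTypeR R) (P3 R) R mu1 (leb3 R) A (dt T Nt)
    G mA muA d0 iG iG2 GA.
set g := (fun y : pt R => _) in mg; rewrite -/g in ig.
have hg : L2s Om (fun x => (dt T Nt)^-1 * g x).
  apply: L2sZ => //; apply/(L2sP mOm); split; first exact: measurable_funTS.
  exact: integrableS ig.
move: hg; rewrite /L2s; set f1 := _ \_ _; set f2 := _ \_ _.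
suff -> : f1 = f2 by [].
apply/funext => x; rewrite /f1 /f2 !patchE; case: ifPn => // /set_mem Ox.
rewrite mxE; congr (_ * fine _); apply: ae_eq_integral_gen.
(* The source is controlled on the open interval (0, T), while the averaging cells are closed and
   may contain 0 or [T]. *)
exists [set 0; T]; split.
- by apply: measurableU; exact: measurable_set1.
- by apply: countable_lebesgue_measure0; exact: finite_set_countable.
move=> s /= hs; apply: contrapT => s0T; apply: hs => As; congr EFin.
rewrite /G /F !patchE mem_set; last by split.
rewrite mem_set//; split=> //=; rewrite in_itv /=.
move: As; rewrite /A /= in_itv /= => /andP[s1 s2].
have s0 : 0 <= s by apply: le_trans s1; rewrite mulr_ge0// ltW.
have sT : s <= T by rewrite (le_trans s2)// tn_le.
apply/andP; split; rewrite lt_neqAle ?s0 ?sT andbT; apply/eqP => h; apply: s0T.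
  by left.
by right.
Qed.

End TimeAverage.

(** * The optimality system *)

Section Duality.
Context {R : realType}.
Variables (W : lmodType R) (S N : set W) (a b : W -> W -> R).

Definition linear_on (F : W -> R) := forall s u v, S u -> S v -> F (s *: u + v) = s * F u + F v.

Hypotheses (S0 : S 0) (Slin : forall s u v, S u -> S v -> S (s *: u + v)).

Lemma linear_on_sub F1 F2 : linear_on F1 -> linear_on F2 -> linear_on (fun w => F1 w - F2 w).
Proof. by move=> h1 h2 s u v Su Sv; rewrite h1// h2//; ring. Qed.

Lemma linear_on_add F1 F2 : linear_on F1 -> linear_on F2 -> linear_on (fun w => F1 w + F2 w).
Proof. by move=> h1 h2 s u v Su Sv; rewrite h1// h2//; ring. Qed.

Lemma linear_on_scale t F1 : linear_on F1 -> linear_on (fun w => t * F1 w).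
Proof. by move=> h1 s u v Su Sv; rewrite h1//; ring. Qed.

Lemma linear_on0 F : linear_on F -> F 0 = 0.
Proof. by move=> lF; have := lF (-1) 0 0 S0 S0; rewrite scaler0 addr0 mulN1r addNr. Qed.

Lemma linear_onD F u v : linear_on F -> S u -> S v -> F (u + v) = F u + F v.
Proof. by move=> lF Su Sv; rewrite -[u in LHS]scale1r lF// mul1r. Qed.

Lemma linear_onZ F s u : linear_on F -> S u -> F (s *: u) = s * F u.
Proof. by move=> lF Su; rewrite -[_ *: _]addr0 lF// linear_on0// addr0. Qed.

Lemma linear_onB F u v : linear_on F -> S u -> S v -> F (u - v) = F u - F v.
Proof. by move=> lF Su Sv; rewrite addrC -scaleN1r lF// mulN1r addrC. Qed.

Lemma closedD u v : S u -> S v -> S (u + v).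
Proof. by move=> Su Sv; rewrite -[u]scale1r; exact: Slin. Qed.

Lemma closedZ s u : S u -> S (s *: u).
Proof. by move=> Su; rewrite -[_ *: _]addr0; exact: Slin. Qed.

Lemma closedB u v : S u -> S v -> S (u - v).
Proof. by move=> Su Sv; rewrite addrC -scaleN1r; exact: Slin. Qed.

Lemma recursive_sequence (Nt : nat) (P : nat -> W -> W -> Prop) :
  (forall n x, (n < Nt)%N -> S x -> exists y, S y /\ P n x y) ->
  exists X : nat -> W, [/\ X 0%N = 0, forall n, (n <= Nt)%N -> S (X n) &
    forall n, (n < Nt)%N -> P n (X n) (X n.+1)].
Proof.
move=> h.
have /choice[f hf] : forall q : nat * W, exists y, (q.1 < Nt)%N -> S q.2 -> S y /\ P q.1 q.2 y.
  move=> [n x]; have [[nN Sx]|hn] := pselect ((n < Nt)%N /\ S x).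
    by have [y hy] := h n x nN Sx; exists y.
  by exists 0 => nN Sx; exfalso; exact: hn.
pose X := fix X n := if n is m.+1 then f (m, X m) else 0.
have SX n : (n <= Nt)%N -> S (X n).
  elim: n => [//|n ih] nN; by have [] := hf (n, X n) nN (ih (ltnW nN)).
exists X; split=> // n nN; exact: (hf (n, X n) nN (SX n (ltnW nN))).2.
Qed.

Hypothesis al : forall w, S w -> linear_on (a ^~ w).
Hypothesis ar : forall w, S w -> linear_on (a w).
Hypothesis bl : forall w, S w -> linear_on (b ^~ w).
Hypothesis br : forall w, S w -> linear_on (b w).
Hypothesis aN : forall v w, S v -> S w -> N v -> a v w = 0 /\ a w v = 0.
Hypothesis bN : forall v w, S v -> S w -> N v -> b v w = 0 /\ b w v = 0.
Hypothesis solvel : forall F, linear_on F -> (forall v, S v -> N v -> F v = 0) ->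
  exists u, S u /\ forall w, S w -> a u w = F w.
Hypothesis solver : forall F, linear_on F -> (forall v, S v -> N v -> F v = 0) ->
  exists u, S u /\ forall w, S w -> a w u = F w.
Hypothesis nondegl : forall v, S v -> (forall w, S w -> a v w = 0) -> N v.

Variables (Nt : nat) (F G : nat -> W -> R).

Lemma forward_sequence :
  (forall n, (n < Nt)%N -> linear_on (G n) /\ forall v, S v -> N v -> G n v = 0) ->
  exists X : nat -> W, [/\ X 0%N = 0, forall n, (n <= Nt)%N -> S (X n) &
    forall n, (n < Nt)%N -> forall w, S w -> a w (X n.+1) + b w (X n) = G n w].
Proof.
move=> hG.
apply: (@recursive_sequence Nt (fun n x y => forall w, S w -> a w y + b w x = G n w)) => n x nN Sx.
have [lG GN] := hG n nN.
have [|v Sv Nv|y [Sy hy]] := @solver (fun w => G n w - b w x).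
- by apply: linear_on_sub => //; exact: bl.
- by rewrite GN// (bN Sv Sx Nv).1 subrr.
by exists y; split=> // w Sw; rewrite hy// subrK.
Qed.

Lemma backward_sequence :
  (forall n, (n < Nt)%N -> linear_on (F n) /\ forall v, S v -> N v -> F n v = 0) ->
  exists p : nat -> W, [/\ p Nt = 0, forall n, (n <= Nt)%N -> S (p n) &
    forall n, (n < Nt)%N -> forall w, S w -> a (p n) w + b (p n.+1) w = F n w].
Proof.
move=> hF.
(* Time is reversed: step [n] of the recursion solves the backward equation of index [Nt - n.+1]. *)
have [n x nN Sx|q [q0 Sq hq]] := @recursive_sequence Nt
    (fun n x y => forall w, S w -> a y w + b x w = F (Nt - n.+1)%N w).
  have [lF FN] := hF (Nt - n.+1)%N (rev_ord_proof (Ordinal nN)).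
  have [|v Sv Nv|y [Sy hy]] := @solvel (fun w => F (Nt - n.+1)%N w - b x w).
  - by apply: linear_on_sub => //; exact: br.
  - by rewrite FN// (bN Sv Sx Nv).2 subrr.
  by exists y; split=> // w Sw; rewrite hy// subrK.
exists (fun n => q (Nt - n)%N); split; first by rewrite subnn.
  by move=> n nN; apply: Sq; exact: leq_subr.
move=> n nN w Sw; have := hq (Nt - n.+1)%N (rev_ord_proof (Ordinal nN)) w Sw.
by rewrite !subnSK// subKn// ltnW.
Qed.

Lemma backward_unique p q :
  (forall n, (n <= Nt)%N -> S (p n)) -> (forall n, (n <= Nt)%N -> S (q n)) ->
  N (q Nt - p Nt) ->
  (forall n, (n < Nt)%N -> forall w, S w -> a (p n) w + b (p n.+1) w = F n w) ->
  (forall n, (n < Nt)%N -> forall w, S w -> a (q n) w + b (q n.+1) w = F n w) ->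
  forall n, (n <= Nt)%N -> N (q n - p n).
Proof.
move=> Sp Sq NT hp hq n nN; rewrite -(subKn nN).
elim: (Nt - n)%N (leq_subr n Nt) => [|m ih] mN; first by rewrite subn0.
have iN := rev_ord_proof (Ordinal mN); rewrite /= in iN.
have Si := Sp _ (ltnW iN); have Ti := Sq _ (ltnW iN); have Si1 := Sp _ iN; have Ti1 := Sq _ iN.
apply: nondegl; first exact: closedB.
move=> w Sw; have h1 := hp _ iN w Sw; have h2 := hq _ iN w Sw.
rewrite (linear_onB (al Sw))//.
have Nm : N (q (Nt - m.+1).+1 - p (Nt - m.+1).+1) by rewrite subnSK//; apply: ih; exact: ltnW.
by have [] := bN (closedB Ti1 Si1) Sw Nm; rewrite (linear_onB (bl Sw))//; lra.
Qed.

(* Summation by parts in time: the difference of the two sides telescopes. *)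
Lemma duality_sum p X : (forall n, (n <= Nt)%N -> S (p n)) -> (forall n, (n <= Nt)%N -> S (X n)) ->
  N (p Nt) -> X 0%N = 0 ->
  (forall n, (n < Nt)%N -> forall w, S w -> a (p n) w + b (p n.+1) w = F n w) ->
  (forall n, (n < Nt)%N -> forall w, S w -> a w (X n.+1) + b w (X n) = G n w) ->
  \sum_(n < Nt) F n (X n.+1 + X n) = \sum_(n < Nt) G n (p n.+1 + p n).
Proof.
move=> Sp SX pN X0 hp hX.
(* The mixed terms a(p_n, X_(n+1)) and b(p_(n+1), X_n) cancel. Of the telescoping rest, the term at
   0 vanishes since [X 0 = 0], and the term at [Nt] since the terminal adjoint is null. *)
pose D n := a (p n) (X n) - b (p n) (X n).
have step (n : 'I_Nt) : F n (X n.+1 + X n) - G n (p n.+1 + p n) = D n - D n.+1.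
  have nN := ltn_ord n; have S1 := Sp _ (ltnW nN); have S2 := Sp _ nN.
  have S3 := SX _ (ltnW nN); have S4 := SX _ nN.
  rewrite -hp//; last exact: closedD.
  rewrite -hX//; last exact: closedD.
  rewrite (linear_onD (ar S1))// (linear_onD (br S2))// (linear_onD (al S4))// (linear_onD (bl
      S3))//.
  by rewrite /D; ring.
apply/eqP; rewrite -subr_eq0 -sumrB (eq_bigr _ (fun n _ => step n)).
rewrite -(big_mkord xpredT (fun n => D n - D n.+1)) (@telescope_sumr_eq _ _ _ (fun n => - D n))//;
    last first.
  by move=> n _; rewrite opprK addrC.
have S1 := Sp _ (leqnn Nt); have S2 := SX _ (leqnn Nt); have S3 := Sp _ (leq0n Nt).
rewrite /D X0 (aN S1 S2 pN).1 (bN S1 S2 pN).1 (linear_on0 (ar S3)) (linear_on0 (br S3)).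
by rewrite !subrr.
Qed.

End Duality.

(** * The Crank-Nicolson step as a bilinear form *)

Section CrankNicolson.
Context {R : realType}.
Variables (Om : set (pt R)) (hOm : bounded_lipschitz_domain Om).
Variables (Th : set (tetra R)) (hTh : is_mesh Om Th) (k : nat).
Variables (T : R) (Nt : nat).
Variables (eps sigma M : tensor R) (eps0 : R).
Hypotheses (beps : bounded_tensor Om eps) (bsigma : bounded_tensor Om sigma)
  (bM : bounded_tensor Om M).
Hypothesis eps_sym : {ae leb3 R, forall x, Om x -> (eps x)^T = eps x}.
Hypothesis sigma_sym : {ae leb3 R, forall x, Om x -> (sigma x)^T = sigma x}.
Hypothesis eps0_gt0 : 0 < eps0.
Hypothesis eps_pos : {ae leb3 R, forall x, Om x -> forall xi : vec R,
  eps0 * dot xi xi <= dot xi (eps x *m xi)}.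
Hypothesis sigma_psd : {ae leb3 R, forall x, Om x -> forall xi : vec R,
  0 <= dot xi (sigma x *m xi)}.
Hypothesis M_psd : {ae leb3 R, forall x, Om x -> forall xi : vec R,
  0 <= dot xi (M x *m xi)}.

Let oOm : open Om. Proof. by case: hOm. Qed.
Let bOm : bounded_set Om. Proof. by case: hOm. Qed.
Let mOm : measurable (Om : set (P3 R)) := open_pt_measurable oOm.

Local Notation ip := (ip Om).
Local Notation curl := (curl Om).
Local Notation Nh := (Nh Om Th k).
Local Notation Nh0 := (Nh0 Om Th k).
Local Notation RTh := (RTh Om Th k).
Implicit Types (u v w : field R).

Lemma L2v_lin (s : R) u v : L2v Om u -> L2v Om v -> L2v Om (s *: u + v).
Proof. by move=> hu hv; apply: L2vD => //; exact: L2vZ. Qed.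

Lemma Nh_curl v : Nh v -> Hcurl Om v. Proof. by case. Qed.
Lemma Nh_L2v v : Nh v -> L2v Om v. Proof. by case=> -[]. Qed.
Lemma Nh_curlL2v v : Nh v -> L2v Om (curl v).
Proof. by move=> /Nh_curl /curlP[]. Qed.
Lemma Nh0_Nh v : Nh0 v -> Nh v. Proof. by case. Qed.
Lemma RTh_L2v v : RTh v -> L2v Om v. Proof. by case=> -[]. Qed.

Lemma ip_linl v : L2v Om v -> linear_on (L2v Om) (fun u => ip u v).
Proof. by move=> hv s u w hu hw; rewrite ipDl ?ipZl//; exact: L2vZ. Qed.
Lemma ip_linr v : L2v Om v -> linear_on (L2v Om) (ip v).
Proof. by move=> hv s u w hu hw; rewrite ipDr ?ipZr//; exact: L2vZ. Qed.
Lemma ip_mact_linl A v : bounded_tensor Om A -> L2v Om v ->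
  linear_on (L2v Om) (fun u => ip (mact A u) v).
Proof.
by move=> bA hv s u w hu hw; rewrite mact_lin ip_linl//; exact: mact_L2v.
Qed.

Lemma curl_linl v : L2v Om v -> linear_on Nh (fun u => ip (curl u) v).
Proof. by move=> hv s u w hu hw; apply: ip_curl_lin => //; exact: Nh_curl. Qed.
Lemma curl_linr v : L2v Om v -> linear_on Nh (fun u => ip v (curl u)).
Proof. by move=> hv s u w hu hw; rewrite !(ipC _ v) curl_linl. Qed.

Lemma ip_null u v : L2v Om u -> L2v Om v -> aeeq Om u 0 -> ip u v = 0.
Proof. by move=> hu hv u0; rewrite (ip_ael mOm hu (L2v0 mOm) hv u0) ip0l. Qed.
Lemma mact_null A u : aeeq Om u 0 -> aeeq Om (mact A u) 0.
Proof. by apply: aeS => x h /h e; rewrite /mact e mulmx0. Qed.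
Lemma ip_mact_null A u v : bounded_tensor Om A -> L2v Om u -> L2v Om v ->
  aeeq Om u 0 -> ip (mact A u) v = 0.
Proof. by move=> bA hu hv u0; apply: ip_null => //; [exact: mact_L2v|exact: mact_null]. Qed.
Lemma ip_curl_null u v : Nh u -> L2v Om v -> aeeq Om u 0 -> ip (curl u) v = 0.
Proof.
move=> hu hv u0; apply: ip_null => //; first exact: Nh_curlL2v.
by apply: curl_ae0 => //; exact: Nh_curl.
Qed.

Section Differences.
Variables (A : set (field R)) (A0 : A 0).
Hypothesis Alin : forall (s : R) u v, A u -> A v -> A (s *: u + v).
Variables (F : field R -> R) (lF : linear_on A F) (g : nat -> field R) (n : nat).
Hypotheses (g0 : A (g n)) (g1 : A (g n.+1)).

Lemma closed_mid : A (mid g n).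
Proof. by apply: (closedZ A0 Alin); exact: (closedD Alin). Qed.

(** Linearity is taken relative to a set [A], because pairings with [curl] are linear on [Nh]
    only. *)
Lemma linear_mid : F (mid g n) = 2^-1 * (F (g n.+1) + F (g n)).
Proof. by rewrite (linear_onZ A0 _ lF) ?(linear_onD lF)//; exact: (closedD Alin). Qed.
Lemma linear_ddt : F (ddt T Nt g n) = (dt T Nt)^-1 * (F (g n.+1) - F (g n)).
Proof. by rewrite (linear_onZ A0 _ lF) ?(linear_onB lF)//; exact: (closedB Alin). Qed.
Lemma linear_ddtm : F (ddtm T Nt g n) = (dt T Nt)^-1 * (F (g n) - F (g n.+1)).
Proof. by rewrite (linear_onZ A0 _ lF) ?(linear_onB lF)//; exact: (closedB Alin). Qed.
End Differences.

Notation fpair := (field R * field R)%type.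
Implicit Types x y : fpair.

(* The Crank-Nicolson step: one time step of the adjoint scheme reads
   [cn_form s p_n w + cn_form (- s) p_(n+1) w = rhs] with s = 1 / dt, and one
   step of the state is the transpose of this form. *)
Definition cn_form (s : R) x y : R :=
  s * ip (mact eps x.1) y.1 + 2^-1 * ip (mact sigma x.1) y.1 + 2^-1 * ip (curl y.1) x.2
  + s * ip x.2 y.2 - 2^-1 * ip (mact M y.2) (curl x.1).

Definition pairs : set fpair := Nh0 `*` RTh.
Definition null_pairs : set fpair := ae_zero Om `*` ae_zero Om.

Lemma pairs0 : pairs 0.
Proof. by split; [exact: Nh0_0|exact: RTh_0]. Qed.

Lemma pairs_lin (s : R) x y : pairs x -> pairs y -> pairs (s *: x + y).
Proof. by move=> [? ?] [? ?]; split; [exact: Nh0_lin|exact: RTh_lin]. Qed.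

Lemma pairs_L2v x : pairs x ->
  [/\ Nh x.1, L2v Om x.1, L2v Om x.2 & L2v Om (curl x.1)].
Proof.
move=> [/Nh0_Nh h1 h2]; split=> //; [exact: Nh_L2v|exact: RTh_L2v|exact: Nh_curlL2v].
Qed.

Lemma linear_on_fst (A : set (field R)) F : (forall x, pairs x -> A x.1) ->
  linear_on A F -> linear_on pairs (fun x => F x.1).
Proof. by move=> h lF t u v /h hu /h hv; exact: lF. Qed.

Lemma linear_on_snd (A : set (field R)) F : (forall x, pairs x -> A x.2) ->
  linear_on A F -> linear_on pairs (fun x => F x.2).
Proof. by move=> h lF t u v /h hu /h hv; exact: lF. Qed.

Let pairs_L1 x (hx : pairs x) : L2v Om x.1. Proof. by case: (pairs_L2v hx). Qed.
Let pairs_L2 x (hx : pairs x) : L2v Om x.2. Proof. by case: (pairs_L2v hx). Qed.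
Let pairs_Nh x (hx : pairs x) : Nh x.1. Proof. by case: (pairs_L2v hx). Qed.

Lemma cn_form_linl s y : pairs y -> linear_on pairs (fun x => cn_form s x y).
Proof.
move=> /pairs_L2v[y1 y2 y3 y4].
apply: linear_on_sub; [apply: linear_on_add; [apply: linear_on_add; [apply: linear_on_add|]|]|];
    apply: linear_on_scale.
- exact: (linear_on_fst pairs_L1 (ip_mact_linl beps y2)).
- exact: (linear_on_fst pairs_L1 (ip_mact_linl bsigma y2)).
- exact: (linear_on_snd pairs_L2 (ip_linr y4)).
- exact: (linear_on_snd pairs_L2 (ip_linl y3)).
- exact: (linear_on_fst pairs_Nh (curl_linr (mact_L2v mOm bM y3))).
Qed.

Lemma cn_form_linr s x : pairs x -> linear_on pairs (cn_form s x).
Proof.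
move=> /pairs_L2v[y1 y2 y3 y4].
apply: linear_on_sub; [apply: linear_on_add; [apply: linear_on_add; [apply: linear_on_add|]|]|];
    apply: linear_on_scale.
- exact: (linear_on_fst pairs_L1 (ip_linr (mact_L2v mOm beps y2))).
- exact: (linear_on_fst pairs_L1 (ip_linr (mact_L2v mOm bsigma y2))).
- exact: (linear_on_fst pairs_Nh (curl_linl y3)).
- exact: (linear_on_snd pairs_L2 (ip_linr y3)).
- exact: (linear_on_snd pairs_L2 (ip_mact_linl bM y4)).
Qed.

Lemma cn_form_null s x y : pairs x -> pairs y -> null_pairs x ->
  cn_form s x y = 0 /\ cn_form s y x = 0.
Proof.
move=> /pairs_L2v[x1 x2 x3 x4] /pairs_L2v[y1 y2 y3 y4] [n1 n2]; split; rewrite /cn_form.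
- rewrite (ip_mact_null beps x2 y2 n1) (ip_mact_null bsigma x2 y2 n1).
  rewrite (ipC _ (curl y.1)) (ip_null x3 y4 n2) (ip_null x3 y3 n2).
  rewrite (ipC _ (mact M y.2)) (ip_curl_null x1 (mact_L2v mOm bM y3) n1).
  by rewrite !mulr0 !addr0 subrr.
- rewrite (ipC _ (mact eps y.1)) (ip_null x2 (mact_L2v mOm beps y2) n1).
  rewrite (ipC _ (mact sigma y.1)) (ip_null x2 (mact_L2v mOm bsigma y2) n1).
  rewrite (ip_curl_null x1 y3 n1) (ipC _ y.2) (ip_null x3 y3 n2) (ip_mact_null bM x3 y4 n2).
  by rewrite !mulr0 !addr0 subrr.
Qed.

(* Discrete energy estimate: testing with [(0, b + curl e / (2 s))], admissible
   because curl maps Nh into RTh, eliminates [b]; then test with [(e, 0)]. *)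
Lemma cn_form_nondegenerate s x : 0 < s -> pairs x ->
  (forall y, pairs y -> cn_form s y x = 0) -> null_pairs x.
Proof.
move=> s0 hx h; have [x1 x2 x3 x4] := pairs_L2v hx; have [x0 xR] := hx.
have eq2 phi : RTh phi -> 2^-1 * ip (curl x.1) phi + s * ip phi x.2 = 0.
  move=> hphi; have hp := RTh_L2v hphi.
  have := h (0, phi) (conj (Nh0_0 Th k hOm) hphi); rewrite /cn_form /=.
  have N0 : Nh 0 := Nh_0 Th k hOm; have z0 := aeeq_refl Om 0.
  rewrite (ip_mact_null beps (L2v0 mOm) x2 z0) (ip_mact_null bsigma (L2v0 mOm) x2 z0).
  rewrite (ipC _ (mact _ _)) (ip_curl_null N0 (mact_L2v mOm bM x3) z0).
  by rewrite !mulr0 subr0 !add0r.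
pose phi := (2 * s)^-1 *: curl x.1 + x.2.
have hphi : RTh phi by apply: RTh_lin => //; exact: curl_RTh.
have phi0 : aeeq Om phi 0.
  apply: (ip_eq0 mOm (RTh_L2v hphi)).
  have -> : ip phi phi = s^-1 * (2^-1 * ip (curl x.1) phi + s * ip phi x.2).
    rewrite {1}/phi ip_linl//; last exact: RTh_L2v.
    by rewrite (ipC _ x.2); field; rewrite gt_eqF.
  by rewrite eq2// mulr0.
have bE : aeeq Om x.2 (- (2 * s)^-1 *: curl x.1).
  apply: aeS phi0 => z hz Oz; have := hz Oz; rewrite /phi !fctE => /eqP.
  by rewrite addrC addr_eq0 scaleNr => /eqP.
(* Substituting curl e = - 2 s b turns the coupling term into + s (M b, b). Three nonnegative terms
   then sum to zero, and coercivity of [eps] forces e = 0. *)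
have eq1 : s * ip (mact eps x.1) x.1 + 2^-1 * ip (mact sigma x.1) x.1 + s * ip (mact M x.2) x.2 = 0.
  have := h (x.1, 0) (conj x0 (RTh_0 Th k hOm)); rewrite /cn_form /=.
  rewrite (ipC _ _ 0) !ip0l.
  have -> : ip (mact M x.2) (curl x.1) = - (2 * s) * ip (mact M x.2) x.2.
    rewrite !(ipC _ (mact _ _)) (ip_ael mOm x3 _ (mact_L2v mOm bM x3) bE); last exact: L2vZ.
    by rewrite ipZl//; [field; rewrite gt_eqF|exact: mact_L2v].
  rewrite !mulr0 !addr0 => <-.
  by field.
have p1 := ip_mact_coercive mOm beps x2 eps_pos.
have psd A u : bounded_tensor Om A -> L2v Om u ->
    {ae leb3 R, forall z, Om z -> forall xi : vec R, 0 <= dot xi (A z *m xi)} ->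
    0 <= ip (mact A u) u.
  move=> bA hu hA; rewrite -[X in X <= _](mul0r (ip u u)); apply: ip_mact_coercive => //.
  by apply: aeS hA => z hz Oz xi; rewrite mul0r; exact: hz.
have p2 := psd _ _ bsigma x2 sigma_psd; have p3 := psd _ _ bM x3 M_psd.
have e0 : aeeq Om x.1 0.
  apply: (ip_eq0 mOm x2); apply/eqP; rewrite eq_le ip_ge0 andbT.
  rewrite -(pmulr_rle0 _ eps0_gt0) (le_trans p1)//.
  by rewrite -(pmulr_rle0 _ s0); have := mulr_ge0 (ltW s0) p3; lra.
split=> //; apply: aeeq_trans bE _.
rewrite -[X in aeeq _ _ X](scaler0 _ (- (2 * s)^-1)); apply: aeeqZ.
exact: (curl_ae0 oOm bOm x1.1 e0).
Qed.

Lemma findim_pairs : findim pairs null_pairs.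
Proof.
apply: findim_prod.
- exact: findim_sub (@Nh0_piecewise_poly _ _ _ _) (findim_piecewise_poly hTh _).
- exact: findim_sub (@RTh_piecewise_poly _ _ _ _) (findim_piecewise_poly hTh _).
Qed.

Lemma cn_form_solve s : 0 < s ->
  [/\ forall x, pairs x -> (forall y, pairs y -> cn_form s x y = 0) -> null_pairs x,
      forall F : fpair -> R, linear_on pairs F -> (forall x, pairs x -> null_pairs x -> F x = 0) ->
        exists x, pairs x /\ forall y, pairs y -> cn_form s x y = F y &
      forall F : fpair -> R, linear_on pairs F -> (forall x, pairs x -> null_pairs x -> F x = 0) ->
        exists x, pairs x /\ forall y, pairs y -> cn_form s y x = F y].
Proof.
move=> s0.
(* The energy argument tests in the first slot, so the solver is applied to the flipped form and its
   last two conclusions are exchanged at the end. *)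
have [||||||h1 h2 h3] := @findim_nondegenerate_solve R fpair pairs null_pairs (fun x y => cn_form s
    y x) pairs0 pairs_lin.
- by move=> t x [n1 n2]; split; rewrite /ae_zero /= -(scaler0 _ t); exact: aeeqZ.
- exact: findim_pairs.
- by move=> t x y z hx hy hz; exact: cn_form_linr.
- by move=> t x y z hx hy hz; exact: (cn_form_linl s hz).
- by move=> x y hx hy nx; have [e1 e2] := cn_form_null s hx hy nx; exact: conj e2 e1.
- by move=> x hx; exact: cn_form_nondegenerate.
- by split; [exact: h1|exact: h3|exact: h2].
Qed.
Local Notation rdt := ((dt T Nt)^-1).

Lemma ip_mact_swap A u v : bounded_tensor Om A ->
  {ae leb3 R, forall z, Om z -> (A z)^T = A z} -> L2v Om u -> L2v Om v ->
  ip (mact A u) v = ip (mact A v) u.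
Proof. by move=> bA sA hu hv; rewrite (ip_mact_sym mOm bA sA hu hv) ipC. Qed.

(** The two equations are equivalent to their sum over all pairs, as testing with (psi, 0) and (0,
    phi) separates them. Symmetry of [eps] and [sigma] brings the state into the second slot, so
    that the adjoint can occupy the first. *)
Lemma state_step (E B : nat -> field R) n src :
  pairs (E n, B n) -> pairs (E n.+1, B n.+1) -> L2v Om src ->
  (forall psi phi, Nh0 psi -> RTh phi ->
     ip (mact eps (ddt T Nt E n)) psi + ip (mact sigma (mid E n)) psi
       - ip (mact M (mid B n)) (curl psi) = ip src psi /\
     ip (ddt T Nt B n) phi + ip (curl (mid E n)) phi = 0) <->
  (forall y, pairs y -> cn_form rdt y (E n.+1, B n.+1) + cn_form (- rdt) y (E n, B n) = ip src y.1).
Proof.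
move=> h0 h1 hsrc; have [E0 E0L B0L _] := pairs_L2v h0; have [E1 E1L B1L _] := pairs_L2v h1.
rewrite /= in E0 E0L B0L E1 E1L B1L.
pose e1 psi := ip (mact eps (ddt T Nt E n)) psi + ip (mact sigma (mid E n)) psi
       - ip (mact M (mid B n)) (curl psi).
pose e2 phi := ip (ddt T Nt B n) phi + ip (curl (mid E n)) phi.
have Ll := L2v_lin; have L0 := L2v0 mOm; have N0 : Nh 0 := Nh_0 Th k hOm.
have Nl : forall (s : R) u v, Nh u -> Nh v -> Nh (s *: u + v) by move=> *; exact: Nh_lin.
have mB := closed_mid L0 Ll B0L B1L.
have key y : pairs y -> e1 y.1 + e2 y.2 =
    cn_form rdt y (E n.+1, B n.+1) + cn_form (- rdt) y (E n, B n).
  move=> /pairs_L2v[y1 y2 y3 y4].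
  have F1 := linear_ddt L0 Ll (ip_mact_linl beps y2) E0L E1L.
  have F2 := linear_mid L0 Ll (ip_mact_linl bsigma y2) E0L E1L.
  have F3 := linear_mid L0 Ll (ip_mact_linl bM y4) B0L B1L.
  have F4 := linear_ddt L0 Ll (ip_linl y3) B0L B1L.
  have F5 := linear_mid N0 Nl (curl_linl y3) E0 E1.
  rewrite /e1 /e2 /= F1 F2 F3 F4 F5 /cn_form /=.
  rewrite (ip_mact_swap beps eps_sym E1L y2) (ip_mact_swap beps eps_sym E0L y2).
  rewrite (ip_mact_swap bsigma sigma_sym E1L y2) (ip_mact_swap bsigma sigma_sym E0L y2).
  rewrite (ipC _ (B n.+1)) (ipC _ (B n)).
  have idn (s t a b c d e f g i j l : R) :
    s * (a - b) + t * (c + d) - t * (e + f) + (s * (g - i) + t * (j + l)) =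
    s * a + t * c + t * j + s * g - t * e + (- s * b + t * d + t * l + - s * i - t * f) by ring.
  exact: idn.
have e10 : e1 0 = 0.
  rewrite /e1 (ipC _ (mact eps _)) (ipC _ (mact sigma _)) !ip0l (ipC _ (mact M _)).
  by rewrite (ip_curl_null N0 (mact_L2v mOm bM mB) (aeeq_refl Om 0)) addr0 subrr.
have e20 : e2 0 = 0 by rewrite /e2 ipC ip0l ipC ip0l addr0.
split=> [h y hy|h psi phi hpsi hphi].
  have [k1 k2] := h _ _ hy.1 hy.2.
  by rewrite -key// /e1 /e2 k1 k2 addr0.
have hy : pairs (psi, 0) := conj hpsi (RTh_0 Th k hOm).
have hz : pairs (0, phi) := conj (Nh0_0 Th k hOm) hphi.
split; first by have := key _ hy; rewrite h// /= e20 addr0.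
by have := key _ hz; rewrite h// /= e10 add0r ipC ip0l.
Qed.

Lemma adjoint_step (pE pB : nat -> field R) n f g :
  pairs (pE n, pB n) -> pairs (pE n.+1, pB n.+1) -> L2v Om f -> L2v Om g ->
  ((forall psi, Nh0 psi ->
     ip (mact eps (ddtm T Nt pE n)) psi + ip (mact sigma (mid pE n)) psi
       + ip (curl psi) (mid pB n) = ip (mact eps f) psi) /\
   (forall phi, RTh phi ->
     ip (ddtm T Nt pB n) phi - ip (mact M phi) (curl (mid pE n)) = ip (mact M g) phi)) <->
  (forall y, pairs y -> cn_form rdt (pE n, pB n) y + cn_form (- rdt) (pE n.+1, pB n.+1) y
     = ip (mact eps f) y.1 + ip (mact M g) y.2).
Proof.
move=> h0 h1 hf hg; have [E0 E0L B0L _] := pairs_L2v h0; have [E1 E1L B1L _] := pairs_L2v h1.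
rewrite /= in E0 E0L B0L E1 E1L B1L.
pose e1 psi := ip (mact eps (ddtm T Nt pE n)) psi + ip (mact sigma (mid pE n)) psi
       + ip (curl psi) (mid pB n).
pose e2 phi := ip (ddtm T Nt pB n) phi - ip (mact M phi) (curl (mid pE n)).
have Ll := L2v_lin; have L0 := L2v0 mOm; have N0 : Nh 0 := Nh_0 Th k hOm.
have Nl : forall (s : R) u v, Nh u -> Nh v -> Nh (s *: u + v) by move=> *; exact: Nh_lin.
have mB := closed_mid L0 Ll B0L B1L.
have mEN := closed_mid N0 Nl E0 E1.
have mEc := Nh_curlL2v mEN.
have key y : pairs y -> e1 y.1 + e2 y.2 =
    cn_form rdt (pE n, pB n) y + cn_form (- rdt) (pE n.+1, pB n.+1) y.
  move=> /pairs_L2v[y1 y2 y3 y4].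
  have F1 := linear_ddtm L0 Ll (ip_mact_linl beps y2) E0L E1L.
  have F2 := linear_mid L0 Ll (ip_mact_linl bsigma y2) E0L E1L.
  have F3 := linear_mid L0 Ll (ip_linr y4) B0L B1L.
  have F4 := linear_ddtm L0 Ll (ip_linl y3) B0L B1L.
  have F5 := linear_mid N0 Nl (curl_linr (mact_L2v mOm bM y3)) E0 E1.
  rewrite /e1 /e2 /= F1 F2 F3 F4 F5 /cn_form /=.
  have idn (s t a b c d e f' g' i j l : R) :
    s * (b - a) + t * (c + d) + t * (e + f') + (s * (i - g') - t * (j + l)) =
    s * b + t * d + t * f' + s * i - t * l + (- s * a + t * c + t * e + - s * g' - t * j) by ring.
  exact: idn.
have e10 : e1 0 = 0.
  rewrite /e1 (ipC _ (mact eps _)) (ipC _ (mact sigma _)) !ip0l.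
  by rewrite (ip_curl_null N0 mB (aeeq_refl Om 0)) !addr0.
have e20 : e2 0 = 0.
  rewrite /e2 (ipC _ (ddtm _ _ _ _)) ip0l.
  by rewrite (ip_mact_null bM L0 mEc (aeeq_refl Om 0)) subrr.
split=> [[h h'] y hy|h].
  rewrite -key//; congr (_ + _); [exact: h _ hy.1|exact: h' _ hy.2].
split=> [psi hpsi|phi hphi].
  have hy : pairs (psi, 0) := conj hpsi (RTh_0 Th k hOm).
  by have := key _ hy; rewrite h// /= e20 addr0 (ipC _ (mact M g)) ip0l addr0.
have hy : pairs (0, phi) := conj (Nh0_0 Th k hOm) hphi.
by have := key _ hy; rewrite h// /= e10 add0r (ipC _ (mact eps f)) ip0l add0r.
Qed.

End CrankNicolson.

(** * Equivalence of the two stationarity conditions *)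

Section Stationarity.
Context {R : realType}.
Variables (Om : set (pt R)) (hOm : bounded_lipschitz_domain Om).
Variables (Th : set (tetra R)) (hTh : is_mesh Om Th) (k : nat).
Variables (T : R) (hT : 0 < T) (Nt : nat) (hNt : (0 < Nt)%N).

Let oOm : open Om. Proof. by case: hOm. Qed.
Let mOm : measurable (Om : set (P3 R)) := open_pt_measurable oOm.

Local Notation ip := (ip Om).
Local Notation curl := (curl Om).
Local Notation Nh := (Nh Om Th k).
Local Notation RTh := (RTh Om Th k).
Implicit Types (u v w : field R).

(** The inner product is itself a form nondegenerate modulo null fields, so the abstract solver
    applies. *)
Lemma riesz (S : set (field R)) (F : field R -> R) :
  S 0 -> (forall (s : R) u v, S u -> S v -> S (s *: u + v)) -> S `<=` L2v Om ->
  findim S (ae_zero Om) -> linear_on S F -> (forall v, S v -> aeeq Om v 0 -> F v = 0) ->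
  exists u, S u /\ forall w, S w -> ip u w = F w.
Proof.
move=> S0 Sl SL fd lF FN.
have [||||||_ h _] := @findim_nondegenerate_solve R (field R) S (ae_zero Om) ip S0 Sl.
- by move=> t v n; rewrite /ae_zero /= -(scaler0 _ t); exact: aeeqZ.
- exact: fd.
- by move=> t u v w /SL hu /SL hv /SL hw; exact: (ip_linl hOm hw).
- by move=> t u v w /SL hu /SL hv /SL hw; exact: (ip_linr hOm hw).
- move=> v w /SL hv /SL hw nv; split; first exact: (ip_null hOm).
  by rewrite ipC; exact: (ip_null hOm).
- by move=> v Sv hv; apply: (ip_eq0 mOm (SL _ Sv)); exact: hv.
exact: h.
Qed.

Lemma Cstar_spec q : L2v Om q ->
  Nh (Cstar Om Th k q) /\ forall w, Nh w -> ip (Cstar Om Th k q) w = ip q (curl w).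
Proof.
move=> hq; have [||v hv|||v hv nv|u hu] := @riesz Nh (fun w => ip q (curl w)).
- exact: Nh_0.
- by move=> *; exact: Nh_lin.
- exact: Nh_L2v hv.
- exact: findim_sub (@Nh_piecewise_poly _ _ _ _) (findim_piecewise_poly hTh _).
- exact: curl_linr.
- by rewrite ipC; exact: (ip_curl_null hOm hv hq nv).
exact: (@xgetPex _ _ [set v | Nh v /\ forall w, Nh w -> ip v w = ip q (curl w)]) (ex_intro _ u hu).
Qed.

Lemma Ph_spec u : L2v Om u ->
  RTh (Ph Om Th k u) /\ forall w, RTh w -> ip (Ph Om Th k u) w = ip u w.
Proof.
move=> hu; have [||v hv|||v hv nv|p hp] := @riesz RTh (ip u).
- exact: RTh_0.
- by move=> *; exact: RTh_lin.
- exact: RTh_L2v hv.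
- exact: findim_sub (@RTh_piecewise_poly _ _ _ _) (findim_piecewise_poly hTh _).
- by move=> s v w hv hw; exact: (ip_linr hOm hu s (RTh_L2v hv) (RTh_L2v hw)).
- by rewrite ipC; exact: (ip_null hOm (RTh_L2v hv) hu nv).
exact: (@xgetPex _ _ (is_L2proj Om RTh u)) (ex_intro _ p hp).
Qed.

Variables (alpha1 alpha2 : R) (z : R -> field R) (pE : nat -> field R).
Hypothesis hz : Zh Om Th k T Nt z.
Hypothesis hpE : forall n, (n < Nt)%N -> L2v Om (mid pE n).

(** The weak form on one time cell, through which both stationarity conditions are compared. *)
Definition cell_stationary n := forall v, Nh v ->
  alpha1 * ip (cell T Nt z n) v + alpha2 * ip (curl (cell T Nt z n)) (curl v)
  + ip (mid pE n) (curl v) = 0.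

(** The strong residual lies in [Nh] and its pairing with [v] is the weak residual; [Ph] drops out
    because [curl v] lies in [RTh]. Testing with the residual itself then gives norm zero. *)
Lemma cellwise_stationaryE : cellwise_stationary Om Th k T Nt alpha1 alpha2 z pE <->
  forall n, (n < Nt)%N -> cell_stationary n.
Proof.
have key n : (n < Nt)%N ->
    let r := alpha1 *: cell T Nt z n + Cstar Om Th k (alpha2 *: curl (cell T Nt z n) + Ph Om Th k
        (mid pE n)) in
    Nh r /\ forall v, Nh v -> ip r v = alpha1 * ip (cell T Nt z n) v
      + alpha2 * ip (curl (cell T Nt z n)) (curl v) + ip (mid pE n) (curl v).
  move=> nN r; have [zN _] := hz nN; have hp := hpE nN.
  have [PR PE] := Ph_spec hp; have PL := RTh_L2v PR.
  have cL := Nh_curlL2v zN.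
  have [CN CE] := Cstar_spec (L2v_lin hOm alpha2 cL PL).
  split; first exact: Nh_lin.
  move=> v hv; have vL := Nh_L2v hv; have cvL := Nh_curlL2v hv.
  rewrite /r (ip_linl hOm vL) ?CE ?(ip_linl hOm cvL) ?PE ?addrA//.
  - exact: curl_RTh.
  - exact: Nh_L2v zN.
  - exact: Nh_L2v CN.
split=> h n nN; have [rN rE] := key n nN.
  move=> v hv; rewrite -rE//; exact: (ip_null hOm (Nh_L2v rN) (Nh_L2v hv) (h n nN)).
by apply: (ip_eq0 mOm (Nh_L2v rN)); rewrite rE//; exact: h.
Qed.

Lemma tn_mono m n : (m <= n)%N -> tn T Nt m <= tn T Nt n.
Proof. by move=> mn; rewrite /tn ler_wpM2r ?ler_nat// ltW// dt_gt0. Qed.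

Lemma stationaryE : stationary Om Th k T Nt alpha1 alpha2 z pE <->
  forall n, (n < Nt)%N -> cell_stationary n.
Proof.
have d0 := dt_gt0 hT hNt.
split=> h.
  move=> n nN v hv.
  (* The cells are open on the left and [cell] reads the value at the right endpoint, so this
     control has value [v] on cell [n] and 0 on all others. *)
  pose w t := if (tn T Nt n < t) && (t <= tn T Nt n.+1) then v else 0.
  have wE m t : tn T Nt m < t <= tn T Nt m.+1 -> w t = if m == n then v else 0.
    move=> /andP[t1 t2]; rewrite /w; have [mn|nm|mn] := ltngtP m n.
    - by rewrite ltNge (le_trans t2 (tn_mono mn)).
    - by rewrite [t <= _]leNgt (le_lt_trans (tn_mono nm) t1) andbF.
    - by rewrite mn in t1 t2; rewrite t1 t2.
  have cE m : cell T Nt w m = if m == n then v else 0.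
    by apply: wE; rewrite lexx andbT tnS ltrDl.
  have hw : Zh Om Th k T Nt w.
    move=> m mN; rewrite cE; split; first by case: eqP => // _; exact: Nh_0.
    by move=> t ht; rewrite (wE m)//; exact: aeeq_refl.
  have L0 : L2v Om 0 := L2v0 mOm.
  have N0 : Nh 0 := Nh_0 Th k hOm.
  have sumE (f : nat -> field R -> R) : (forall m, (m < Nt)%N -> f m 0 = 0) ->
      \sum_(m < Nt) dt T Nt * f m (cell T Nt w m) = dt T Nt * f n v.
    move=> f0; rewrite (bigD1 (Ordinal nN))//= cE eqxx big1 ?addr0// => m mn.
    by rewrite cE (_ : (m : nat) == n = false) ?f0 ?mulr0//; exact/negbTE.
  have c0 u : L2v Om u -> ip u (curl 0) = 0.
    by move=> hu; rewrite ipC; apply: (ip_curl_null hOm N0 hu); exact: aeeq_refl.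
  have := h w hw.
  rewrite (sumE (fun m u => ip (cell T Nt z m) u)); last by move=> m _; rewrite ipC ip0l.
  rewrite (sumE (fun m u => ip (curl (cell T Nt z m)) (curl u))); last first.
    by move=> m mN; apply: c0; apply: (Nh_curlL2v (hz mN).1).
  rewrite (sumE (fun m u => ip (mid pE m) (curl u))); last by move=> m mN; apply: c0; exact: hpE.
  rewrite mulrCA (mulrCA alpha2) -!mulrDr => /eqP.
  by rewrite mulf_eq0 gt_eqF//= => /eqP.
move=> w hw; rewrite !mulr_sumr -!big_split /= big1// => n _.
rewrite (mulrCA alpha1) (mulrCA alpha2) -!mulrDr h ?mulr0//; exact: (hw n (ltn_ord n)).1.
Qed.

End Stationarity.

(** [K] may have any sign and is replaced by a positive upper bound L; at - D / (2 L) the quadratic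
    is at most - D^2 / (4 L). *)
Lemma linear_coef_eq0 (R : realFieldType) (D K : R) :
  (forall t : R, 0 <= t * D + t ^+ 2 * K) -> D = 0.
Proof.
move=> h; pose L := `|K| + 1; have L0 : 0 < L by rewrite ltr_wpDl.
have KL : K <= L by rewrite (le_trans (ler_norm K))// lerDl.
have := h (- (D / (2 * L))); set t := D / (2 * L).
have DE : D = 2 * L * t by rewrite /t mulrC divfK// gt_eqF// mulr_gt0.
rewrite sqrrN mulNr {1}DE => h1.
have h2 : t ^+ 2 * K <= t ^+ 2 * L by rewrite ler_wpM2l ?sqr_ge0.
have h3 : t ^+ 2 * L <= 0 by rewrite expr2 in h1 h2 *; lra.
have /eqP : t ^+ 2 = 0.
  by apply/eqP; rewrite eq_le sqr_ge0 andbT -(pmulr_lle0 _ L0).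
by rewrite sqrf_eq0 => /eqP t0; rewrite DE t0 mulr0.
Qed.

Lemma sum_quadratic (R : realFieldType) n (c t : R) (x x' d k : 'I_n -> R) :
  (forall i, x' i = x i + 2 * t * d i + t ^+ 2 * k i) ->
  2^-1 * \sum_i c * x' i =
  2^-1 * \sum_i c * x i + t * \sum_i c * d i + t ^+ 2 * (2^-1 * \sum_i c * k i).
Proof.
move=> h; rewrite !mulr_sumr -!big_split; apply: eq_bigr => i _ /=.
by rewrite h; field.
Qed.

(** * First variation of the cost *)

Section Optimality.
Context {R : realType}.
Variables (Om : set (pt R)) (hOm : bounded_lipschitz_domain Om).
Variables (Th : set (tetra R)) (hTh : is_mesh Om Th) (k : nat).
Variables (T : R) (hT : 0 < T) (Nt : nat) (hNt : (0 < Nt)%N).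
Variables (eps sigma mu : tensor R) (eps0 : R).
Local Notation M := (minv mu).
Hypotheses (beps : bounded_tensor Om eps) (bsigma : bounded_tensor Om sigma)
  (bM : bounded_tensor Om M).
Hypothesis eps_sym : {ae leb3 R, forall x, Om x -> (eps x)^T = eps x}.
Hypothesis sigma_sym : {ae leb3 R, forall x, Om x -> (sigma x)^T = sigma x}.
Hypothesis M_sym : {ae leb3 R, forall x, Om x -> (M x)^T = M x}.
Hypothesis eps0_gt0 : 0 < eps0.
Hypothesis eps_pos : {ae leb3 R, forall x, Om x -> forall xi : vec R,
  eps0 * dot xi xi <= dot xi (eps x *m xi)}.
Hypothesis sigma_psd : {ae leb3 R, forall x, Om x -> forall xi : vec R,
  0 <= dot xi (sigma x *m xi)}.
Hypothesis M_psd : {ae leb3 R, forall x, Om x -> forall xi : vec R,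
  0 <= dot xi (M x *m xi)}.

Let oOm : open Om. Proof. by case: hOm. Qed.
Let mOm : measurable (Om : set (P3 R)) := open_pt_measurable oOm.

Local Notation ip := (ip Om).
Local Notation curl := (curl Om).
Local Notation S := (pairs Om Th k).
Local Notation N := (null_pairs Om).
Local Notation rdt := ((dt T Nt)^-1).
Local Notation a := (cn_form Om eps sigma M rdt).
Local Notation b := (cn_form Om eps sigma M (- rdt)).
Local Notation fpair := (field R * field R)%type.

Let L0 : L2v Om 0 := L2v0 mOm.
Let Ll := L2v_lin hOm.
Let S0 : S 0 := pairs0 hOm Th k.
Let Sl : forall (s : R) (x y : fpair), S x -> S y -> S (s *: x + y).
Proof. by move=> *; exact: pairs_lin. Qed.
Let al y (hy : S y) := cn_form_linl hOm beps bsigma bM rdt hy.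
Let ar y (hy : S y) := cn_form_linr hOm beps bsigma bM rdt hy.
Let bl y (hy : S y) := cn_form_linl hOm beps bsigma bM (- rdt) hy.
Let br y (hy : S y) := cn_form_linr hOm beps bsigma bM (- rdt) hy.
Let aN x y (hx : S x) (hy : S y) (nx : N x) := cn_form_null hOm beps bsigma bM rdt hx hy nx.
Let bN x y (hx : S x) (hy : S y) (nx : N x) := cn_form_null hOm beps bsigma bM (- rdt) hx hy nx.
Let solve := cn_form_solve hOm hTh k beps bsigma bM eps0_gt0 eps_pos sigma_psd M_psd
  (etrans (invr_gt0 _) (dt_gt0 hT hNt)).

Lemma ip_mact_quadratic A (t : R) (u v : field R) : bounded_tensor Om A ->
  {ae leb3 R, forall x, Om x -> (A x)^T = A x} -> L2v Om u -> L2v Om v ->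
  ip (mact A (t *: u + v)) (t *: u + v) =
  ip (mact A v) v + 2 * t * ip (mact A v) u + t ^+ 2 * ip (mact A u) u.
Proof.
move=> bA sA hu hv; have huv := Ll t hu hv.
have mu1 := mact_L2v mOm bA hu; have mv := mact_L2v mOm bA hv.
rewrite (ip_mact_linl hOm bA huv t hu hv) (ip_linr hOm mu1 t hu hv) (ip_linr hOm mv t hu hv).
rewrite (ip_mact_swap hOm bA sA hu hv).
move: (ip (mact A u) u) (ip (mact A v) u) (ip (mact A v) v) => p q r; ring.
Qed.

Lemma normsq_lin (t : R) (u v : field R) : L2v Om u -> L2v Om v ->
  normsq Om (t *: u + v) = normsq Om v + 2 * t * ip v u + t ^+ 2 * normsq Om u.
Proof.
move=> hu hv; have huv := Ll t hu hv; rewrite /normsq.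
rewrite (ip_linl hOm huv t hu hv) (ip_linr hOm hu t hu hv) (ip_linr hOm hv t hu hv).
rewrite (ipC Om u v); move: (ip u u) (ip v u) (ip v v) => p q r; ring.
Qed.

Lemma normsq_curl_lin (t : R) (u v : field R) : Nh Om Th k u -> Nh Om Th k v ->
  normsq Om (curl (t *: u + v)) =
  normsq Om (curl v) + 2 * t * ip (curl v) (curl u) + t ^+ 2 * normsq Om (curl u).
Proof.
move=> hu hv; have hw := Nh_lin hOm t hu hv; rewrite /normsq.
have cu := Nh_curlL2v hu; have cv := Nh_curlL2v hv; have cw := Nh_curlL2v hw.
rewrite (curl_linl hOm cw t hu hv) (curl_linr hOm cu t hu hv) (curl_linr hOm cv t hu hv).
rewrite (ipC Om (curl u) (curl v)).
move: (ip (curl u) (curl u)) (ip (curl v) (curl u)) (ip (curl v) (curl v)) => p q r; ring.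
Qed.

Lemma mid_lin (t : R) (f g : nat -> field R) (c : field R) n :
  mid (fun m => t *: f m + g m) n - c = t *: mid f n + (mid g n - c).
Proof. by apply/funext => x; apply/matrixP => i j; rewrite /mid !fctE !mxE; ring. Qed.

Variables (Isrc : R -> field R) (E0 B0 : field R) (alpha1 alpha2 : R).
Variables (Ed Bd : nat -> field R) (z : R -> field R) (E B : nat -> field R).
Hypothesis hsrc : forall n, (n < Nt)%N -> L2v Om (tavg T Nt Isrc n).
Hypothesis hEd : forall n, (n < Nt)%N -> L2v Om (Ed n).
Hypothesis hBd : forall n, (n < Nt)%N -> L2v Om (Bd n).
Hypothesis hmin : minimizer Om Th k T Nt eps mu sigma Isrc E0 B0 alpha1 alpha2 Ed Bd z E B.

(** Derivative of the [n]-th misfit at the midpoint state, and at the same time the load of the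
    adjoint scheme. *)
Let F n (y : fpair) := ip (mact eps (mid E n - Ed n)) y.1 + ip (mact M (mid B n - Bd n)) y.2.

Let hz : Zh Om Th k T Nt z. Proof. by case: hmin. Qed.
Let hS n : (n <= Nt)%N -> S (E n, B n).
Proof. by case: hmin => _ [h _ _ _] _ /h. Qed.

Let hmE n : (n < Nt)%N -> L2v Om (mid E n - Ed n).
Proof.
move=> nN; have [_ e0 _ _] := pairs_L2v (hS (ltnW nN)); have [_ e1 _ _] := pairs_L2v (hS nN).
exact: (L2vB mOm (closed_mid L0 Ll e0 e1) (hEd nN)).
Qed.

Let hmB n : (n < Nt)%N -> L2v Om (mid B n - Bd n).
Proof.
move=> nN; have [_ _ e0 _] := pairs_L2v (hS (ltnW nN)); have [_ _ e1 _] := pairs_L2v (hS nN).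
exact: (L2vB mOm (closed_mid L0 Ll e0 e1) (hBd nN)).
Qed.

Let hF n : (n < Nt)%N -> linear_on S (F n) /\ forall v, S v -> N v -> F n v = 0.
Proof.
move=> nN; have m1 := mact_L2v mOm beps (hmE nN); have m2 := mact_L2v mOm bM (hmB nN); split.
  apply: linear_on_add.
    apply: (linear_on_fst _ (ip_linr hOm m1)) => x hx; by have [] := pairs_L2v hx.
  apply: (linear_on_snd _ (ip_linr hOm m2)) => x hx; by have [] := pairs_L2v hx.
move=> x /pairs_L2v[_ h1 h2 _] [n1 n2].
by rewrite /F !(ipC Om (mact _ _)) (ip_null hOm h1 m1 n1) (ip_null hOm h2 m2 n2) addr0.
Qed.

Lemma adjointE pE pB : adjoint Om Th k T Nt eps mu sigma Ed Bd E B pE pB <->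
  [/\ forall n, (n <= Nt)%N -> S (pE n, pB n), N (pE Nt, pB Nt) &
    forall n, (n < Nt)%N -> forall y, S y ->
      a (pE n, pB n) y + b (pE n.+1, pB n.+1) y = F n y].
Proof.
split=> [[h1 h2 h3 h4]|[h1 [h2 h3] h4]].
  split=> [//|//|n nN].
  exact: (adjoint_step hOm T Nt beps bsigma bM (h1 n (ltnW nN)) (h1 _ nN) (hmE nN) (hmB nN)).1 (h4
      n nN).
split=> // n nN.
exact: (adjoint_step hOm T Nt beps bsigma bM (h1 n (ltnW nN)) (h1 _ nN) (hmE nN) (hmB nN)).2 (h4 n
    nN).
Qed.

Lemma adjoint_exists : exists pE pB, adjoint Om Th k T Nt eps mu sigma Ed Bd E B pE pB.
Proof.
have [_ solvel _] := solve.
have [p [pN pS hp]] := backward_sequence S0 br bN solvel hF.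
exists (fun n => (p n).1), (fun n => (p n).2); apply/adjointE; split.
- by move=> n /pS; rewrite -surjective_pairing.
- by rewrite pN; split; exact: aeeq_refl.
- by move=> n nN; rewrite -!surjective_pairing; exact: hp.
Qed.

Lemma adjoint_unique pE pB qE qB : adjoint Om Th k T Nt eps mu sigma Ed Bd E B pE pB ->
  adjoint Om Th k T Nt eps mu sigma Ed Bd E B qE qB ->
  forall n, (n <= Nt)%N -> aeeq Om (qE n) (pE n) /\ aeeq Om (qB n) (pB n).
Proof.
move=> /adjointE[p1 [p2 p2'] p3] /adjointE[q1 [q2 q2'] q3] n nN.
have sub0 (u v : field R) : aeeq Om (u - v) 0 -> aeeq Om u v.
  by apply: aeS => x h /h; rewrite !fctE => /eqP; rewrite subr_eq0 => /eqP.
have sub1 (u v : field R) : aeeq Om u 0 -> aeeq Om v 0 -> aeeq Om (u - v) 0.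
  by apply: aeS2 => x h1 h2 Ox; rewrite !fctE h1// h2// subrr.
have [nondegl _ _] := solve.
have [|/sub0 ? /sub0 ?] := @backward_unique _ _ _ _ _ _ Sl al bl bN nondegl Nt F
  (fun n => (pE n, pB n)) (fun n => (qE n, qB n)) p1 q1 _ p3 q3 n nN.
  by split; exact: sub1.
by [].
Qed.

Section Variation.
Variables (pE pB : nat -> field R).
Hypothesis hp : adjoint Om Th k T Nt eps mu sigma Ed Bd E B pE pB.
Variables (w : R -> field R) (hw : Zh Om Th k T Nt w).

Let G n (y : fpair) := ip (curl (cell T Nt w n)) y.1.

(** [X] is the derivative of the state in the control direction [w]: zero initial data and source
    curl [w]. *)
Lemma homogeneous_state : exists X : nat -> fpair, [/\ X 0%N = 0,
  forall n, (n <= Nt)%N -> S (X n) &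
  forall n, (n < Nt)%N -> forall y, S y -> a y (X n.+1) + b y (X n) = G n y].
Proof.
have [_ _ solver] := solve.
apply: (forward_sequence S0 bl bN solver) => n nN.
have cw := Nh_curlL2v (hw nN).1; split.
  by apply: (linear_on_fst _ (ip_linr hOm cw)) => x hx; have [] := pairs_L2v hx.
move=> x /pairs_L2v[_ h1 _ _] [n1 _].
by rewrite /G ipC (ip_null hOm h1 cw n1).
Qed.

Let zw t : R -> field R := fun s => t *: w s + z s.

Let hzw t : Zh Om Th k T Nt (zw t).
Proof.
move=> n nN; have [z1 z2] := hz nN; have [w1 w2] := hw nN; split.
  exact: (Nh_lin hOm t w1 z1).
by move=> s hs; apply: aeeq_lin; [exact: w2|exact: z2].
Qed.

(** Superposition; since [X 0 = 0], the projected initial data are unchanged. *)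
Lemma perturbed_state X t : X 0%N = 0 -> (forall n, (n <= Nt)%N -> S (X n)) ->
  (forall n, (n < Nt)%N -> forall y, S y -> a y (X n.+1) + b y (X n) = G n y) ->
  cn_state Om Th k T Nt eps mu sigma Isrc E0 B0 (zw t)
    (fun n => t *: (X n).1 + E n) (fun n => t *: (X n).2 + B n).
Proof.
move=> X0 XS hX; have [_ [hEB pE0 pB0 hEq] _] := hmin.
have S' n : (n <= Nt)%N -> S (t *: (X n).1 + E n, t *: (X n).2 + B n).
  by move=> nN; exact: (Sl t (XS n nN) (hS nN)).
split; [exact: S'| | |].
- by rewrite X0 /= scaler0 add0r; exact: pE0.
- by rewrite X0 /= scaler0 add0r; exact: pB0.
move=> n nN; have n1 := ltnW nN; have [z1 _] := hz nN; have [w1 _] := hw nN.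
have cz := Nh_curlL2v z1; have c' := Nh_curlL2v (Nh_lin hOm t w1 z1).
have src := L2vD mOm (hsrc nN) cz.
apply: (state_step hOm T Nt beps bsigma bM eps_sym sigma_sym (S' n n1) (S' _ nN)
  (L2vD mOm (hsrc nN) c')).2 => y hy.
have old := (state_step hOm T Nt beps bsigma bM eps_sym sigma_sym (hS n1) (hS nN) src).1
  (hEq n nN) y hy.
have [_ y1 _ _] := pairs_L2v hy.
have e1 := cn_form_linr hOm beps bsigma bM rdt hy t (XS _ nN) (hS nN).
have e2 := cn_form_linr hOm beps bsigma bM (- rdt) hy t (XS _ n1) (hS n1).
apply: (etrans (congr2 +%R e1 e2)).
rewrite (ipDl mOm (hsrc nN) c' y1) (curl_linl hOm y1 t w1 z1).
rewrite (ipDl mOm (hsrc nN) cz y1) in old.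
have := hX n nN y hy; rewrite -/(cell T Nt z n) -/(cell T Nt w n) /G; move: old.
move: (a y (X n.+1)) (b y (X n)) (a y (E n.+1, B n.+1)) (b y (E n, B n))
  (ip (tavg T Nt Isrc n) y.1) (ip (curl (cell T Nt z n)) y.1)
  (ip (curl (cell T Nt w n)) y.1) => p q r s f g h old new.
by rewrite -new addrACA -mulrDr old addrCA.
Qed.

(** The constant [K] collects the second order terms and is the same for all [t]. The factor 1/2 in
    front of [F] comes from the midpoints of [X]. *)
Lemma cost_variation (X : nat -> fpair) : (forall n, (n <= Nt)%N -> S (X n)) ->
  exists K, forall t, cost Om T Nt eps mu alpha1 alpha2 Ed Bd (zw t)
    (fun n => t *: (X n).1 + E n) (fun n => t *: (X n).2 + B n) =
  cost Om T Nt eps mu alpha1 alpha2 Ed Bd z E B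
  + t * (\sum_(n < Nt) dt T Nt * (2^-1 * F n (X n.+1 + X n))
    + \sum_(n < Nt) dt T Nt * (alpha1 * ip (cell T Nt z n) (cell T Nt w n)
      + alpha2 * ip (curl (cell T Nt z n)) (curl (cell T Nt w n))))
  + t ^+ 2 * K.
Proof.
move=> XS.
have eps_psd : {ae leb3 R, forall x, Om x -> forall xi : vec R, 0 <= dot xi (eps x *m xi)}.
  by apply: aeS eps_pos => x h Ox xi; apply: le_trans (h Ox xi); rewrite mulr_ge0 ?dot_ge0 ?ltW.
pose m1 n := mid (fun m => (X m).1) n; pose m2 n := mid (fun m => (X m).2) n.
pose KE := 2^-1 * \sum_(n < Nt) dt T Nt * (ip (mact eps (m1 n)) (m1 n) + ip (mact M (m2 n)) (m2 n)).
pose KZ := 2^-1 * \sum_(n < Nt) dt T Nt * (alpha1 * normsq Om (cell T Nt w n)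
      + alpha2 * normsq Om (curl (cell T Nt w n))).
exists (KE + KZ) => t; rewrite /cost /normZsq.
have L1 n : (n < Nt)%N -> L2v Om (m1 n) /\ L2v Om (m2 n).
  move=> nN; have [_ u1 u2 _] := pairs_L2v (XS n (ltnW nN));
      have [_ v1 v2 _] := pairs_L2v (XS _ nN).
  by split; exact: (closed_mid L0 Ll).
have FE n : (n < Nt)%N -> 2^-1 * F n (X n.+1 + X n) =
    ip (mact eps (mid E n - Ed n)) (m1 n) + ip (mact M (mid B n - Bd n)) (m2 n).
  move=> nN; have [_ u1 u2 _] := pairs_L2v (XS n (ltnW nN));
      have [_ v1 v2 _] := pairs_L2v (XS _ nN).
  have r1 := mact_L2v mOm beps (hmE nN); have r2 := mact_L2v mOm bM (hmB nN).
  rewrite (linear_mid L0 Ll (ip_linr hOm r1) u1 v1) (linear_mid L0 Ll (ip_linr hOm r2) u2 v2).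
  by rewrite /F /= (ipDr mOm v1 u1 r1) (ipDr mOm v2 u2 r2) -mulrDr.
have h1 (n : 'I_Nt) : normsq Om (mact (msqrt eps) (mid (fun n => t *: (X n).1 + E n) n - Ed n))
    + normsq Om (mact (msqrt M) (mid (fun n => t *: (X n).2 + B n) n - Bd n)) =
    (normsq Om (mact (msqrt eps) (mid E n - Ed n)) + normsq Om (mact (msqrt M) (mid B n - Bd n)))
    + 2 * t * (2^-1 * F n (X n.+1 + X n))
    + t ^+ 2 * (ip (mact eps (m1 n)) (m1 n) + ip (mact M (m2 n)) (m2 n)).
  have nN := ltn_ord n; have [l1 l2] := L1 n nN.
  rewrite !mid_lin (normsq_msqrt _ eps_sym eps_psd) (normsq_msqrt _ M_sym M_psd).
  rewrite (normsq_msqrt _ eps_sym eps_psd) (normsq_msqrt _ M_sym M_psd) (FE n nN).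
  rewrite (ip_mact_quadratic t beps eps_sym l1 (hmE nN)) (ip_mact_quadratic t bM M_sym l2 (hmB nN)).
  have idn (x1 x2 y1 y2 c1 c2 : R) : x1 + 2 * t * y1 + t ^+ 2 * c1 + (x2 + 2 * t * y2 + t ^+ 2 *
      c2) =
    x1 + x2 + 2 * t * (y1 + y2) + t ^+ 2 * (c1 + c2) by ring.
  exact: idn.
have h2 (n : 'I_Nt) : alpha1 * normsq Om (cell T Nt (zw t) n) + alpha2 * normsq Om (curl (cell T Nt
    (zw t) n)) =
    (alpha1 * normsq Om (cell T Nt z n) + alpha2 * normsq Om (curl (cell T Nt z n)))
    + 2 * t * (alpha1 * ip (cell T Nt z n) (cell T Nt w n)
      + alpha2 * ip (curl (cell T Nt z n)) (curl (cell T Nt w n)))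
    + t ^+ 2 * (alpha1 * normsq Om (cell T Nt w n) + alpha2 * normsq Om (curl (cell T Nt w n))).
  have nN := ltn_ord n; have [z1 _] := hz nN; have [w1 _] := hw nN.
  have q1 := normsq_lin t (Nh_L2v w1) (Nh_L2v z1); have q2 := normsq_curl_lin t w1 z1.
  apply: (etrans (congr2 (fun x y => alpha1 * x + alpha2 * y) q1 q2)).
  have idn (x1 x2 y1 y2 c1 c2 : R) : alpha1 * (x1 + 2 * t * y1 + t ^+ 2 * c1)
      + alpha2 * (x2 + 2 * t * y2 + t ^+ 2 * c2) = alpha1 * x1 + alpha2 * x2
      + 2 * t * (alpha1 * y1 + alpha2 * y2) + t ^+ 2 * (alpha1 * c1 + alpha2 * c2) by ring.
  exact: idn.
apply: (etrans (congr2 +%R (sum_quadratic (dt T Nt) h1) (sum_quadratic (dt T Nt) h2))).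
have idn (s1 d1 k1 s2 d2 k2 : R) : s1 + t * d1 + t ^+ 2 * k1 + (s2 + t * d2 + t ^+ 2 * k2) =
  s1 + s2 + t * (d1 + d2) + t ^+ 2 * (k1 + k2) by ring.
exact: idn.
Qed.

Lemma adjoint_stationary_dir :
  alpha1 * \sum_(n < Nt) dt T Nt * ip (cell T Nt z n) (cell T Nt w n)
  + alpha2 * \sum_(n < Nt) dt T Nt * ip (curl (cell T Nt z n)) (curl (cell T Nt w n))
  + \sum_(n < Nt) dt T Nt * ip (mid pE n) (curl (cell T Nt w n)) = 0.
Proof.
have [X [X0 XS hX]] := homogeneous_state.
have [K hK] := cost_variation XS.
have [_ _ hle] := hmin; have [pS pN hpF] := (adjointE pE pB).1 hp.
have D0 : \sum_(n < Nt) dt T Nt * (2^-1 * F n (X n.+1 + X n))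
    + \sum_(n < Nt) dt T Nt * (alpha1 * ip (cell T Nt z n) (cell T Nt w n)
      + alpha2 * ip (curl (cell T Nt z n)) (curl (cell T Nt w n))) = 0.
  apply: (@linear_coef_eq0 R _ K) => t.
  have := hle _ _ _ (hzw t) (perturbed_state t X0 XS hX).
  by rewrite (hK t) -addrA lerDl; apply.
have dual := @duality_sum _ _ _ _ _ _ S0 Sl al ar bl br aN bN Nt F G
  (fun n => (pE n, pB n)) X pS XS pN X0 hpF hX.
(* Duality pairs sums of consecutive values, so the factor 1/2 passes from the midpoints of [X] to
   those of the adjoint. *)
have Fp : \sum_(n < Nt) dt T Nt * (2^-1 * F n (X n.+1 + X n)) =
    \sum_(n < Nt) dt T Nt * ip (mid pE n) (curl (cell T Nt w n)).
  rewrite -mulr_sumr -mulr_sumr dual mulr_sumr mulr_sumr; apply: eq_bigr => n _.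
  have nN := ltn_ord n; have cw := Nh_curlL2v (hw nN).1.
  have [_ u1 _ _] := pairs_L2v (pS n (ltnW nN)); have [_ v1 _ _] := pairs_L2v (pS _ nN).
  rewrite (ipC Om (mid pE n)) (linear_mid L0 Ll (ip_linr hOm cw) u1 v1).
  by rewrite /G /= (ipDr mOm v1 u1 cw).
rewrite -[RHS]D0 Fp [RHS]addrC; congr (_ + _).
rewrite !mulr_sumr -big_split; apply: eq_bigr => n _ /=.
by rewrite mulrDr mulrCA (mulrCA alpha2).
Qed.

End Variation.

Lemma adjoint_stationary pE pB : adjoint Om Th k T Nt eps mu sigma Ed Bd E B pE pB ->
  stationary Om Th k T Nt alpha1 alpha2 z pE.
Proof. by move=> hp w hw; exact: (adjoint_stationary_dir hp hw). Qed.

End Optimality.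

(** Uniqueness is equality almost everywhere, as fields are functions and not classes, and it
    concerns the indices up to [Nt]. The equivalence of the stationarity conditions is stated for
    every admissible control with this adjoint: at the minimizer both conditions hold and the
    equivalence would say nothing. *)
Theorem theorem6 (R : realType)
    (Om : set (pt R)) (hOm : bounded_lipschitz_domain Om)
    (T : R) (hT : 0 < T)
    (eps mu sigma : tensor R)
    (heps : LinftyM Om eps) (hmu : LinftyM Om mu) (hsigma : LinftyM Om sigma)
    (heps_sym : {ae leb3 R, forall x, Om x -> (eps x)^T = eps x})
    (hmu_sym : {ae leb3 R, forall x, Om x -> (mu x)^T = mu x})
    (hsigma_sym : {ae leb3 R, forall x, Om x -> (sigma x)^T = sigma x})
    (eps0 mu0 : R) (heps0 : 0 < eps0) (hmu0 : 0 < mu0)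
    (heps_pos : {ae leb3 R, forall x, Om x -> forall xi : vec R,
       eps0 * enorm xi ^+ 2 <= dot xi (eps x *m xi)})
    (hmu_pos : {ae leb3 R, forall x, Om x -> forall xi : vec R,
       mu0 * enorm xi ^+ 2 <= dot xi (mu x *m xi)})
    (hsigma_psd : {ae leb3 R, forall x, Om x -> forall xi : vec R,
       0 <= dot xi (sigma x *m xi)})
    (Isrc : R -> field R) (hIsrc : L2L2 Om T Isrc)
    (E0 B0 : field R) (hE0 : L2v Om E0) (hB0 : L2v Om B0)
    (hdivB0 : weak_div Om B0 (cst 0))
    (alpha1 alpha2 : R) (halpha1 : 0 < alpha1) (halpha2 : 0 < alpha2)
    (H : Type) (mesh : H -> set (tetra R))
    (hmesh : forall h, is_mesh Om (mesh h)) (hreg : shape_regular mesh)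
    (h : H) (k : nat) (Nt : nat) (hNt : (0 < Nt)%N)
    (Ed Bd : nat -> field R)
    (hEd : forall n, (n < Nt)%N -> L2v Om (Ed n))
    (hBd : forall n, (n < Nt)%N -> L2v Om (Bd n))
    (z : R -> field R) (E B : nat -> field R)
    (hmin : minimizer Om (mesh h) k T Nt eps mu sigma Isrc E0 B0
              alpha1 alpha2 Ed Bd z E B) :
  exists pE pB : nat -> field R,
    [/\ adjoint Om (mesh h) k T Nt eps mu sigma Ed Bd E B pE pB,
        (forall qE qB : nat -> field R,
           adjoint Om (mesh h) k T Nt eps mu sigma Ed Bd E B qE qB ->
           forall n, (n <= Nt)%N ->
             aeeq Om (qE n) (pE n) /\ aeeq Om (qB n) (pB n)),
        stationary Om (mesh h) k T Nt alpha1 alpha2 z pE,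
        cellwise_stationary Om (mesh h) k T Nt alpha1 alpha2 z pE &
        forall z' : R -> field R, Zh Om (mesh h) k T Nt z' ->
          (stationary Om (mesh h) k T Nt alpha1 alpha2 z' pE <->
           cellwise_stationary Om (mesh h) k T Nt alpha1 alpha2 z' pE)].
Proof.
have [oOm _ _ bOm _] := hOm; have mOm := open_pt_measurable oOm.
have beps := LinftyM_bounded mOm heps; have bmu := LinftyM_bounded mOm hmu.
have bsigma := LinftyM_bounded mOm hsigma.
have bM := minv_bounded mOm hmu0 bmu hmu_pos.
have M_sym := minv_sym hmu_sym; have M_psd := minv_psd hmu0 hmu_pos.
have eps_pos : {ae leb3 R, forall x, Om x -> forall xi : vec R,
    eps0 * dot xi xi <= dot xi (eps x *m xi)}.
  by apply: aeS heps_pos => x h' Ox xi; rewrite -enorm_sq; exact: h'.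
have hsrc n : (n < Nt)%N -> L2v Om (tavg T Nt Isrc n).
  by move=> nN; exact: tavg_L2v.
have [pE [pB hp]] := adjoint_exists hOm (hmesh h) hT hNt beps bsigma bM heps0 eps_pos
  hsigma_psd M_psd hEd hBd hmin.
have hpE n : (n < Nt)%N -> L2v Om (mid pE n).
  move=> nN; have [hpS _ _ _] := hp; have [p0 _] := hpS n (ltnW nN); have [p1 _] := hpS _ nN.
  exact: (closed_mid (L2v0 mOm) (L2v_lin hOm) (Nh_L2v p0.1) (Nh_L2v p1.1)).
have stE z' (hz' : Zh Om (mesh h) k T Nt z') :=
  iff_trans (stationaryE hOm hT hNt alpha1 alpha2 hz' hpE)
    (iff_sym (cellwise_stationaryE hOm (hmesh h) alpha1 alpha2 hz' hpE)).
have st := adjoint_stationary hOm (hmesh h) hT hNt beps bsigma bM heps_sym hsigma_sym M_sym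
  heps0 eps_pos hsigma_psd M_psd hsrc hEd hBd hmin hp.
exists pE, pB; split=> //.
- by move=> qE qB hq n nN; exact: (adjoint_unique hOm (hmesh h) hT hNt beps bsigma bM
    heps0 eps_pos hsigma_psd M_psd hEd hBd hmin hp hq nN).
- by have [hz _ _] := hmin; apply/stE.
Qed.
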